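(* Let $N$ be a positive integer with $k=T/N<1$, $t_n=nk$, let $\epsilon\in(0,1)$, and let $\gamma$ be the sum-of-exponentials kernel below. Define the fast scheme \[ x_n=x_0+\sum_{j=1}^n b(x_{j-1})\int_{t_{j-1}}^{t_j}\gamma(t_n-s)\,ds+G(t_n),\qquad 0\le n\le N, \] using the same realization of $x_0$ and $G$ as the exact solution. (1) Assume $\mathbb E(|x_0|^2+|b(x_0)|^2)<\infty$. Then there is $C(T)$ independent of $k$ and $\epsilon$ with \[ \sup_{0\le n\le N}\|x_n-x(t_n)\|\le C(T)\big(k^{H+\alpha-1}+\epsilon\big); \] in particular, if $\epsilon=k^{H+\alpha-1}$ then $\sup_n\|x_n-x(t_n)\|\le C(T)k^{H+\alpha-1}$. (2) Assume $\alpha=2-2H$, $b(x)=Bx$ for a constant $d\times d$ matrix $B$, $\mathbb E|x_0|^2<\infty$, and $\epsilon=k^{\min(3/2-H,\,3-3H)}$. Then \[ \sup_{0\le n\le N}\|x_n-x(t_n)\|\le \begin{cases} C(T,H)\,k^{3-3H}, & H\in(3/4,1),\\ C(T,H)\,\sqrt{|\ln k|}\,k^{3/4}, & H=3/4,\\ C(T,H)\,k^{3/2-H}, & H\in(1/2,3/4), \end{cases} \] with $C(T,H)$ independent of $k$.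
   Context: Fix $T>0$, $d\ge1$, $\alpha\in(0,1)$, $H\in(1/2,1)$, $\sigma>0$. On a probability space let $x_0$ be an $\mathbb R^d$-valued random variable and $B_H$ a $d$-dimensional process with independent fractional Brownian motion components of Hurst index $H$ (centered Gaussian, $B_H^i(0)=0$, covariance $\tfrac12(t^{2H}+s^{2H}-|t-s|^{2H})$). Let $b:\mathbb R^d\to\mathbb R^d$ satisfy $|b(x)-b(y)|\le L|x-y|$. Let $G(t)=\frac{\sigma}{\Gamma(\alpha)}\int_0^t (t-s)^{\alpha-1}\,dB_H(s)$ and let $x(t)$, $t\in[0,T]$, be the unique continuous strong solution of $x(t)=x_0+\frac{1}{\Gamma(\alpha)}\int_0^t (t-s)^{\alpha-1} b(x(s))\,ds+G(t)$. Let $\omega_i,s_i>0$ ($1\le i\le M$) satisfy $\big|t^{\alpha-1}-\sum_{i=1}^M\omega_ie^{-s_it}\big|\le\epsilon$ for all $t\in[k,T]$, and set \[ \gamma(t)=\begin{cases}\frac{1}{\Gamma(\alpha)}t^{\alpha-1}, & 0<t\le k,\\[2pt] \frac{1}{\Gamma(\alpha)}\sum_{i=1}^M\omega_ie^{-s_it}, & t>k.\end{cases} \] $\|v\|:=\sqrt{\mathbb E|v|^2}$. *)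

(* Defs.v *)
From HB Require Import structures.
From mathcomp Require Import all_boot all_order all_algebra.
From mathcomp Require Import all_classical all_reals all_analysis.
Set Implicit Arguments. Unset Strict Implicit. Unset Printing Implicit Defensive.
Import Order.TTheory GRing.Theory Num.Theory.
Import numFieldNormedType.Exports.
Local Open Scope classical_set_scope.
Local Open Scope ring_scope.

Section Defs.
Context {R : realType}.
Notation leb := (@lebesgue_measure R).

Definition Gammaf (a : R) : R :=
  \int[leb]_(x in [set x : R | 0 <= x]) (powR x (a - 1) * expR (- x)).

Definition nrm2 (d : nat) (v : 'cV[R]_d) : R := \sum_(i < d) (v i 0) ^+ 2.

Context {d0 : measure_display} {Omega : measurableType d0}.
Variable P : probability Omega R.

Definition centered_gaussian (X : Omega -> R) (v : R) : Prop :=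
  measurable_fun setT X /\
  (if v == 0 then P [set w | X w = 0] = 1%E
   else forall A : set R, measurable A ->
          P (X @^-1` A) = normal_prob 0 (Num.sqrt v) A).

Definition fbm_cov (H t s : R) : R :=
  (powR t (2 * H) + powR s (2 * H) - powR `|t - s| (2 * H)) / 2.

(** Bh is a d-dimensional process whose components are independent
    fractional Brownian motions of Hurst index H (indexed by t >= 0):
    each component is a centered Gaussian process (every finite linear
    combination is centered Gaussian) with covariance fbm_cov H,
    starting at 0, and the d component processes are mutually
    independent (product rule on all finite-dimensional cylinder events). *)
Definition is_fBm (d : nat) (H : R) (Bh : R -> Omega -> 'cV[R]_d) : Prop :=
  (forall w (i : 'I_d), Bh 0 w i 0 = 0) /\
  (forall (i : 'I_d) (m : nat) (ts : 'I_m -> R) (c : 'I_m -> R),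
     (forall l, 0 <= ts l) ->
     centered_gaussian (fun w => \sum_(l < m) c l * Bh (ts l) w i 0)
       (\sum_(l < m) \sum_(l' < m) c l * c l' * fbm_cov H (ts l) (ts l'))) /\
  (forall (m : nat) (ts : 'I_m -> R) (A : 'I_d -> 'I_m -> set R),
     (forall l, 0 <= ts l) -> (forall i l, measurable (A i l)) ->
     P (\bigcap_(i in [set: 'I_d]) \bigcap_(l in [set: 'I_m])
          [set w | A i l (Bh (ts l) w i 0)]) =
     \big[*%E/1%E]_(i < d)
       P (\bigcap_(l in [set: 'I_m]) [set w | A i l (Bh (ts l) w i 0)])).

(** left-point Riemann–Stieltjes sum, on the uniform partition of [0,t]
    into n pieces, of  sigma/Γ(alpha) ∫_0^t (t-s)^(alpha-1) dBh(s) *)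
Definition RL_sum (d : nat) (alpha sigma : R) (Bh : R -> Omega -> 'cV[R]_d)
    (t : R) (n : nat) (w : Omega) : 'cV[R]_d :=
  (sigma / Gammaf alpha) *:
    \sum_(j < n) (powR (t - t * j%:R / n%:R) (alpha - 1) *:
                   (Bh (t * j.+1%:R / n%:R) w - Bh (t * j%:R / n%:R) w)).

(** G(t) = sigma/Γ(alpha) ∫_0^t (t-s)^(alpha-1) dBh(s), t in [0,T],
    the Wiener integral w.r.t. fBm, realised as the L^2(P) limit of the
    Riemann–Stieltjes sums above *)
Definition is_G (d : nat) (T alpha sigma : R) (Bh : R -> Omega -> 'cV[R]_d)
    (G : R -> Omega -> 'cV[R]_d) : Prop :=
  forall t, 0 <= t <= T ->
    (forall i : 'I_d, measurable_fun setT (fun w => G t w i 0)) /\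
    ((fun n => (\int[P]_w (nrm2 (G t w - RL_sum alpha sigma Bh t n w))%:E)%E)
       @ \oo --> 0%E).

Definition RL_drift (d : nat) (alpha : R) (b : 'cV[R]_d -> 'cV[R]_d)
    (x : R -> Omega -> 'cV[R]_d) (t : R) (w : Omega) : 'cV[R]_d :=
  \col_(i < d) ((Gammaf alpha)^-1 *
     \int[leb]_(s in [set s : R | 0 <= s <= t])
        (powR (t - s) (alpha - 1) * b (x s w) i 0)).

Definition is_solution (d : nat) (T alpha : R) (b : 'cV[R]_d -> 'cV[R]_d)
    (x0 : Omega -> 'cV[R]_d) (G x : R -> Omega -> 'cV[R]_d) : Prop :=
  (forall t (i : 'I_d), measurable_fun setT (fun w => x t w i 0)) /\
  (forall w (i : 'I_d),
     {within [set t : R | 0 <= t <= T], continuous (fun t => x t w i 0)}) /\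
  (forall t, 0 <= t <= T ->
     {ae P, forall w, x t w = x0 w + RL_drift alpha b x t w + G t w}).

Definition soe_kernel (alpha k : R) (M : nat) (om sv : 'I_M -> R) (t : R) : R :=
  if t <= k then (Gammaf alpha)^-1 * powR t (alpha - 1)
  else (Gammaf alpha)^-1 * \sum_(i < M) om i * expR (- sv i * t).

Definition soe_weight (gam : R -> R) (k : R) (n j : nat) : R :=
  \int[leb]_(s in [set s : R | j%:R * k <= s <= j.+1%:R * k])
     gam (n%:R * k - s).

(** the list [x_0; ...; x_n] of the fast scheme
    x_n = x0 + Σ_{j=1}^n b(x_{j-1}) ∫_{t_{j-1}}^{t_j} γ(t_n - s) ds + G(t_n) *)
Fixpoint fast_list (d : nat) (gam : R -> R) (k : R) (b : 'cV[R]_d -> 'cV[R]_d)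
    (x0 : Omega -> 'cV[R]_d) (G : R -> Omega -> 'cV[R]_d) (w : Omega)
    (n : nat) : seq 'cV[R]_d :=
  match n with
  | 0 => [:: x0 w + G 0 w]
  | n'.+1 =>
      let s := fast_list gam k b x0 G w n' in
      rcons s (x0 w + \sum_(j < n'.+1) (soe_weight gam k n'.+1 j *: b (nth 0 s j))
                + G (n'.+1%:R * k) w)
  end.

Definition fast_scheme (d : nat) (gam : R -> R) (k : R) (b : 'cV[R]_d -> 'cV[R]_d)
    (x0 : Omega -> 'cV[R]_d) (G : R -> Omega -> 'cV[R]_d) (n : nat)
    (w : Omega) : 'cV[R]_d :=
  nth 0 (fast_list gam k b x0 G w n) n.

(** E |x_n - x(t_n)|^2  (so ||x_n - x(t_n)|| is its square root) *)
Definition err2 (d : nat) (gam : R -> R) (k : R) (b : 'cV[R]_d -> 'cV[R]_d)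
    (x0 : Omega -> 'cV[R]_d) (G x : R -> Omega -> 'cV[R]_d) (n : nat) : \bar R :=
  (\int[P]_w (nrm2 (fast_scheme gam k b x0 G n w - x (n%:R * k) w))%:E)%E.

End Defs.

(* Main.v *)
(** Write [theta = H + alpha - 1].  The covariance of fractional Brownian increments is
nonnegative for [H > 1/2], so norms of nonnegative combinations of increments are explicit,
and summation by parts bounds the Riemann-Liouville sums: [|G t - G s| <= C (t - s)^theta]
in [L2].  The existence of the [L2] limit [G] excludes [theta < 0], and for [theta = 0] the
noise is bounded in [L2] by scaling.  Second moments of the solution are bounded by a
contraction in the norm weighted by [exp (lambda t)], localised on events where the path is
bounded, and [theta]-Hoelder continuity in [L2] follows from Minkowski's inequality for
fractional integrals.

The error of the scheme satisfies a discrete Volterra inequality whose source consists of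
the kernel error, of size [eps], and of the quadrature error
[sum_j int_{t_j}^{t_{j+1}} (t_n - s)^(alpha - 1) (b (x s) - b (x t_j)) ds].
A weighted induction, based on [exp (- y) <= y^(- alpha / 2)], bounds the error by its source,
and the Hoelder bound on [x] gives the first rate.

If [alpha = 2 - 2 H], disjoint increments of [G] are negatively correlated, because
[v |-> E ((G t1 - G t2) B v)] is nondecreasing and convex.  For linear [b] the quadrature
errors of the noise on different cells are then negatively correlated as well, so the square
of their norm is at most the sum of the squares, which is where
[sum_i i^(2 alpha - 2)] and the three regimes of [H] come from; the drift part is smoother
and is estimated directly. *)
Require Import Defs.
From HB Require Import structures.
From mathcomp Require Import all_boot all_order all_algebra.
From mathcomp Require Import all_classical all_reals all_analysis.
From mathcomp Require Import measurable_realfun.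
From mathcomp Require Import ring lra zify.
Set Implicit Arguments. Unset Strict Implicit. Unset Printing Implicit Defensive.
Import Order.TTheory GRing.Theory Num.Theory.
Import numFieldNormedType.Exports.
Local Open Scope classical_set_scope.
Local Open Scope ring_scope.

(** * Power inequalities and power sums *)

Section powR_inequalities.
Context {R : realType}.
Implicit Types p q x y h : R.

Lemma expR_ln_powR x p : 0 < x -> x `^ p = expR (p * ln x).
Proof. by move=> x0; rewrite /powR gt_eqF. Qed.

Lemma ln_leB1 x : 0 < x -> ln x <= x - 1.
Proof.
by move=> x0; have := @le_ln1Dx R (x - 1); rewrite [1 + _]addrC subrK; apply; lra.
Qed.

Lemma powR_le_affine x p : 0 <= x -> 0 < p <= 1 -> x `^ p <= 1 + p * (x - 1).
Proof.
rewrite le_eqVlt => /predU1P[<-|x0] /andP[p0 p1].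
  by rewrite powR0 ?gt_eqF//; lra.
have m0 : 0 < 1 + p * (x - 1).
  have : 0 < p * x by rewrite mulr_gt0. lra.
rewrite -[leRHS](lnK m0)//= expR_ln_powR// ler_expR.
set m := _ + _ in m0 *.
have le1 : ln (x / m) <= x / m - 1.
  exact: ln_leB1 (divr_gt0 _ _).
have le2 : ln (1 / m) <= 1 / m - 1.
  exact: ln_leB1 (divr_gt0 _ _).
rewrite !ln_div ?posrE// ln1 in le1 le2.
have -> : p * ln x = p * (ln x - ln m) + (1 - p) * (0 - ln m) + ln m by ring.
rewrite -[leRHS]add0r lerD2r.
apply: (@le_trans _ _ (p * (x / m - 1) + (1 - p) * (1 / m - 1))).
  by apply: lerD; apply: ler_wpM2l => //; lra.
have -> : p * (x / m - 1) + (1 - p) * (1 / m - 1) = (p * x + (1 - p)) / m - 1.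
  by field; rewrite gt_eqF.
rewrite (_ : p * x + (1 - p) = m) ?divff ?subrr ?gt_eqF//.
by rewrite /m; ring.
Qed.

Lemma powRN_ge_affine x q : 0 < x -> 0 <= q -> 1 - q * (x - 1) <= x `^ (- q).
Proof.
move=> x0 q0; rewrite expR_ln_powR//; apply: le_trans (expR_ge1Dx _).
rewrite mulNr lerD2l lerN2 ler_wpM2l//.
exact: ln_leB1.
Qed.

Lemma powR_scale1 x y p : 0 < x -> 0 <= y -> y `^ p = x `^ p * (y / x) `^ p.
Proof.
move=> x0 y0; rewrite -powRM ?divr_ge0//; try exact: ltW.
by rewrite mulrCA divff ?mulr1// gt_eqF.
Qed.

Lemma powRB1E x p : 0 < x -> x `^ (p - 1) = x `^ p / x.
Proof. by move=> x0; rewrite powRB ?powRr1 ?ltW// (gt_eqF x0) implybT. Qed.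

Lemma powR_split x p q : 0 < x -> x `^ (p + q) = x `^ p * x `^ q.
Proof. by move=> x0; rewrite powRD// (gt_eqF x0) implybT. Qed.

Lemma subr_powR_le x y p : 0 <= y <= x -> 0 < x -> 0 < p <= 1 ->
  x `^ p - y `^ p <= x `^ (p - 1) * (x - y).
Proof.
move=> /andP[y0 yx] x0 /andP[p0 p1].
rewrite (powR_scale1 p x0 y0) powRB1E// -[X in X - _]mulr1 -mulrBr -mulrA.
apply: ler_wpM2l; first exact: powR_ge0.
have -> : x^-1 * (x - y) = 1 - y / x by field; rewrite gt_eqF.
rewrite lerD2l lerN2.
move: y0; rewrite le_eqVlt => /predU1P[<-|y0]; first by rewrite mul0r powR_ge0.
apply: ger1_powR => //; rewrite divr_gt0//= ler_pdivrMr ?mul1r//.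
Qed.

Lemma subr_powR_ge x y p : 0 <= y <= x -> 0 < x -> 0 < p <= 1 ->
  p * x `^ (p - 1) * (x - y) <= x `^ p - y `^ p.
Proof.
move=> /andP[y0 yx] x0 hp.
rewrite (powR_scale1 p x0 y0) powRB1E// -[X in _ <= X - _]mulr1 -mulrBr.
have -> : p * (x `^ p / x) * (x - y) = x `^ p * (p * (1 - y / x)).
  by field; rewrite gt_eqF.
apply: ler_wpM2l; first exact: powR_ge0.
have := powR_le_affine (divr_ge0 y0 (ltW x0)) hp; lra.
Qed.

Lemma subr_powRN_ge x y q : 0 < y <= x -> 0 <= q ->
  q * x `^ (- q - 1) * (x - y) <= y `^ (- q) - x `^ (- q).
Proof.
move=> /andP[y0 yx] q0; have x0 := lt_le_trans y0 yx.
rewrite (powR_scale1 (- q) x0 (ltW y0)) powRB1E// -[X in _ <= _ - X]mulr1 -mulrBr.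
have -> : q * (x `^ (- q) / x) * (x - y) = x `^ (- q) * (q * (1 - y / x)).
  by field; rewrite gt_eqF.
apply: ler_wpM2l; first exact: powR_ge0.
have := powRN_ge_affine (divr_gt0 y0 x0) q0; lra.
Qed.

Lemma ler_powRN x y q : 0 < y <= x -> q <= 0 -> x `^ q <= y `^ q.
Proof.
move=> /andP[y0 yx] q0; have x0 := lt_le_trans y0 yx.
rewrite -[q]opprK powRN [leRHS]powRN lef_pV2 ?posrE ?powR_gt0//.
by apply: ge0_ler_powR; rewrite ?nnegrE ?oppr_ge0// ltW.
Qed.

Lemma powR_kernel_diff_ge0 y h a : 0 < y -> 0 <= h -> a < 1 ->
  0 <= y `^ (a - 1) - (y + h) `^ (a - 1).
Proof.
move=> y0 h0 a1; rewrite subr_ge0 ler_powRN//; first by rewrite y0 lerDl.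
lra.
Qed.

Lemma powR_kernel_diff_le y h a : 0 < y -> 0 <= h -> 0 < a < 1 ->
  y `^ (a - 1) - (y + h) `^ (a - 1) <= y `^ (a - 1) * (h / (y + h)).
Proof.
move=> y0 h0 /andP[a0 a1]; have yh0 : 0 < y + h by lra.
rewrite (powR_scale1 (a - 1) y0 (ltW yh0)) -[X in X - _]mulr1 -mulrBr.
apply: ler_wpM2l; first exact: powR_ge0.
have -> : h / (y + h) = 1 - y / (y + h) by field; rewrite gt_eqF.
rewrite lerD2l lerN2.
have -> : a - 1 = - (1 - a) by ring.
rewrite powRN -[X in X <= _]invrK lef_pV2 ?posrE ?powR_gt0 ?invr_gt0 ?divr_gt0//.
rewrite invf_div ler1_powR//; last by lra.
by rewrite ler_pdivlMr// mul1r lerDl.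
Qed.

Lemma expRN_le_powR x (q : R) : 0 < x -> 0 <= q <= 1 -> expR (- x) <= x `^ (- q).
Proof.
move=> x0 /andP[q0 q1]; rewrite expR_ln_powR// ler_expR mulNr lerN2.
have [lx|lx] := leP (ln x) 0.
  by apply: le_trans (ltW x0); rewrite mulr_ge0_le0.
apply: (@le_trans _ _ (ln x)); first by rewrite ler_piMl// ltW.
by apply: ltW; exact: ln_sublinear.
Qed.

End powR_inequalities.

Section power_sums.
Context {R : realType}.
Implicit Types p : R.

Lemma natS_powR_sub_le p i : 0 < p <= 1 ->
  i.+1%:R `^ p - i%:R `^ p <= i.+1%:R `^ (p - 1) :> R.
Proof.
move=> hp; have := @subr_powR_le R i.+1%:R i%:R p.
rewrite -[X in _ * X](_ : 1 = _) ?mulr1; last by rewrite -natr1; ring.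
by apply => //; rewrite ?ltr0n// ler0n ler_nat/= leqnSn.
Qed.

Lemma natS_powR_sub_ge p i : 0 < p <= 1 ->
  p * i.+1%:R `^ (p - 1) <= i.+1%:R `^ p - i%:R `^ p :> R.
Proof.
move=> hp; have := @subr_powR_ge R i.+1%:R i%:R p.
rewrite -[X in _ * X](_ : 1 = _) ?mulr1; last by rewrite -natr1; ring.
by apply => //; rewrite ?ltr0n// ler0n ler_nat/= leqnSn.
Qed.

Lemma natS_powRN_sub_ge (q : R) i : 0 <= q -> (0 < i)%N ->
  i.+1%:R `^ (- q - 1) * q <= i%:R `^ (- q) - i.+1%:R `^ (- q) :> R.
Proof.
move=> hp i0; have := @subr_powRN_ge R i.+1%:R i%:R q.
rewrite -[X in _ * X](_ : 1 = _) ?mulr1; last by rewrite -natr1; ring.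
rewrite [q * _]mulrC; apply => //.
by rewrite ltr0n i0 ler_nat/= leqnSn.
Qed.

Lemma sum_powR_le p n : 0 < p <= 1 ->
  \sum_(i < n) (i.+1%:R : R) `^ (p - 1) <= n%:R `^ p / p.
Proof.
move=> /andP[p0 p1]; elim: n => [|n IH].
  by rewrite big_ord0 divr_ge0 ?powR_ge0// ltW.
rewrite big_ord_recr/=; apply: le_trans (lerD IH (lexx _)) _.
rewrite -lerBrDl -mulrBl ler_pdivlMr// mulrC.
by apply: natS_powR_sub_ge; rewrite p0.
Qed.

Lemma sum_powR_tail p l m : 0 < p < 1 -> (0 < l)%N ->
  \sum_(l <= i < m) (i.+1%:R : R) `^ (p - 2) <= l%:R `^ (p - 1) / (1 - p).
Proof.
move=> /andP[p0 p1] l0.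
have q0 : 0 < 1 - p by lra.
have [ml|lm] := leqP m l.
  by rewrite big_geq// divr_ge0 ?powR_ge0// ltW.
suff : \sum_(l <= i < m) (i.+1%:R : R) `^ (p - 2) <=
    (l%:R `^ (p - 1) - m%:R `^ (p - 1)) / (1 - p).
  move/le_trans; apply; rewrite ler_pM2r ?invr_gt0// lerBlDr lerDl powR_ge0//.
elim: m lm => // m IH; rewrite ltnS leq_eqVlt => /predU1P[<-|lm].
  rewrite big_nat1 ler_pdivlMr//.
  have := natS_powRN_sub_ge (ltW q0) l0; rewrite opprB.
  by rewrite (_ : p - 1 - 1 = p - 2)//; ring.
rewrite big_nat_recr ?(ltnW lm)//=; apply: le_trans (lerD (IH lm) (lexx _)) _.
rewrite -lerBrDl -mulrBl ler_pdivlMr//.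
have := natS_powRN_sub_ge (ltW q0) (leq_trans l0 (ltnW lm)); rewrite opprB.
by rewrite (_ : p - 1 - 1 = p - 2); [lra|ring].
Qed.

Lemma sum_harmonic_le n : (0 < n)%N ->
  \sum_(i < n) (i.+1%:R : R)^-1 <= 1 + ln n%:R.
Proof.
elim: n => // -[|n] IH _.
  by rewrite big_ord_recr big_ord0/= ln1 invr1; lra.
rewrite big_ord_recr/=; apply: le_trans (lerD (IH isT) (lexx _)) _.
rewrite -addrA lerD2l -lerBrDl -ln_div ?posrE ?ltr0n//.
have x0 : 0 < (n.+2%:R : R) by rewrite ltr0n.
have y0 : 0 < (n.+1%:R : R) by rewrite ltr0n.
rewrite -[leRHS]opprK -lnV ?posrE ?divr_gt0// invf_div lerNr.
have -> : (n.+1%:R : R) / n.+2%:R = 1 + - n.+2%:R^-1.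
  apply: (mulIf (lt0r_neq0 x0)); rewrite divfK ?lt0r_neq0//.
  by rewrite mulrDl mulNr mulVf ?lt0r_neq0// -[n.+2%:R]natr1; ring.
by apply: le_ln1Dx; rewrite ltrN2 invf_lt1// ltr1n.
Qed.

Lemma sum_powR_weight (a H : R) l : 0 < H <= 1 -> 0 < a + H - 1 <= 1 ->
  \sum_(i < l) (i.+1%:R : R) `^ (a - 1) * (i.+1%:R `^ H - i%:R `^ H)
   <= l%:R `^ (a + H - 1) / (a + H - 1).
Proof.
move=> hH ht; apply: le_trans (sum_powR_le _ ht).
apply: ler_sum => i _.
have -> : a + H - 1 - 1 = (a - 1) + (H - 1) by ring.
rewrite (powR_split (a - 1) (H - 1)) ?ltr0n// ler_wpM2l ?powR_ge0//.
exact: natS_powR_sub_le.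
Qed.

Lemma sum_powR_diff_weight (a H : R) l m : 0 < a < 1 -> 0 < H <= 1 ->
  0 < a + H - 1 < 1 -> (0 < l)%N ->
  \sum_(i < m) ((i.+1%:R : R) `^ (a - 1) - (i.+1 + l)%:R `^ (a - 1)) *
               (i.+1%:R `^ H - i%:R `^ H)
   <= l%:R `^ (a + H - 1) * ((a + H - 1)^-1 + (2 - a - H)^-1).
Proof.
move=> ha hH /andP[t0 t1] l0.
have lR : 0 < (l%:R : R) by rewrite ltr0n.
pose g i : R := (i.+1%:R : R) `^ (a - 1) - (i.+1 + l)%:R `^ (a - 1).
pose d i : R := i.+1%:R `^ H - i%:R `^ H.
have d0 i : 0 <= d i.
  rewrite subr_ge0; case/andP: hH => H0 _.
  by apply: ge0_ler_powR; rewrite ?nnegrE ?ler0n ?ler_nat// ltW.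
have g0 i : 0 <= g i.
  rewrite /g natrD; apply: powR_kernel_diff_ge0; rewrite ?ltr0n ?ler0n//.
  by case/andP: ha.
have dle i : d i <= i.+1%:R `^ (H - 1).
  exact: natS_powR_sub_le.
have gle1 i : g i <= i.+1%:R `^ (a - 1).
  by rewrite /g lerBlDr lerDl powR_ge0.
have gle2 i : g i <= l%:R * i.+1%:R `^ (a - 2).
  rewrite /g natrD; apply: le_trans (powR_kernel_diff_le _ _ ha) _.
  - by rewrite ltr0n.
  - by rewrite ler0n.
  rewrite (_ : a - 2 = a - 1 - 1); last by ring.
  rewrite [X in _ <= l%:R * X]powRB1E ?ltr0n// mulrCA.
  rewrite ler_wpM2l ?powR_ge0// ler_wpM2l ?ler0n//.
  by rewrite lef_pV2 ?posrE ?ltr_wpDr ?ler0n ?ltr0n// lerDl ler0n.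
rewrite -(big_mkord xpredT (fun i => g i * d i)).
have le1 : \sum_(0 <= i < minn l m) g i * d i <= l%:R `^ (a + H - 1) / (a + H - 1).
  apply: (@le_trans _ _ (\sum_(0 <= i < l) i.+1%:R `^ (a - 1) * d i)).
    rewrite (big_cat_nat (n := minn l m) (p := l)) ?geq_minl//=.
    rewrite -[leLHS]addr0; apply: lerD.
      by apply: ler_sum => i _; rewrite ler_wpM2r.
    by apply: sumr_ge0 => i _; rewrite mulr_ge0 ?powR_ge0.
  by rewrite big_mkord; apply: sum_powR_weight => //; rewrite t0 ltW.
have le2 : \sum_(minn l m <= i < m) g i * d i <= l%:R `^ (a + H - 1) / (2 - a - H).
  have [ml|lm] := leqP m l.
    by rewrite big_geq// mulr_ge0 ?powR_ge0// invr_ge0; lra.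
  apply: (@le_trans _ _ (l%:R * \sum_(l <= i < m) i.+1%:R `^ (a + H - 1 - 2))).
    rewrite mulr_sumr; apply: ler_sum => i _.
    have -> : a + H - 1 - 2 = (a - 2) + (H - 1) by ring.
    by rewrite (powR_split (a - 2) (H - 1)) ?ltr0n// mulrA ler_pM.
  have -> : 2 - a - H = 1 - (a + H - 1) by ring.
  rewrite -[X in X / _](_ : l%:R * l%:R `^ (a + H - 1 - 1) = _); last first.
    by rewrite mulr_powRB1// ltW.
  rewrite -mulrA ler_wpM2l ?ler0n//; apply: sum_powR_tail => //.
  by rewrite t0 t1.
rewrite (big_cat_nat (n := minn l m)) ?geq_minr//= mulrDr.
exact: lerD.
Qed.

End power_sums.

(** * Bounds in L2 *)

Section L2le.
Context {R : realType} {d0 : measure_display} {Omega : measurableType d0}.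
Variable P : probability Omega R.
Implicit Types X Y : Omega -> R.

Definition L2le X (c : R) : Prop :=
  [/\ measurable_fun setT X, 0 <= c &
      (\int[P]_w ((X w) ^+ 2)%:E <= (c ^+ 2)%:E)%E].

Lemma measurable_EFin_sqr X : measurable_fun setT X ->
  measurable_fun setT (fun w => ((X w) ^+ 2)%:E).
Proof. by move=> mX; apply/measurable_EFinP; exact: measurable_funX. Qed.

Lemma L2le_measurable X c : L2le X c -> measurable_fun setT X.
Proof. by case. Qed.

Lemma L2le_ge0 X c : L2le X c -> 0 <= c.
Proof. by case. Qed.

Lemma L2le_mono X c c' : c <= c' -> L2le X c -> L2le X c'.
Proof.
move=> cc' [mX c0 hX]; split => //; first exact: le_trans cc'.
by apply: le_trans hX _; rewrite lee_fin lerXn2r ?nnegrE// (le_trans c0).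
Qed.

Lemma L2le_dom X Y c : measurable_fun setT X ->
  (forall w, `|X w| <= `|Y w|) -> L2le Y c -> L2le X c.
Proof.
move=> mX XY [mY c0 hY]; split => //.
apply: le_trans hY; apply: ge0_le_integral => //.
- by move=> w _; rewrite lee_fin sqr_ge0.
- exact: measurable_EFin_sqr.
- exact: measurable_EFin_sqr.
- by move=> w _; rewrite lee_fin -[X in X <= _]real_normK ?num_real//
    -[leRHS]real_normK ?num_real// lerXn2r ?nnegrE.
Qed.

Lemma L2le_norm X c : L2le X c -> L2le (fun w => `|X w|) c.
Proof.
move=> hX; have mX := L2le_measurable hX; apply: L2le_dom hX.
  exact: measurableT_comp.
by move=> w; rewrite normr_id.
Qed.

Lemma L2le_ae X Y c : measurable_fun setT X ->
  {ae P, forall w, X w = Y w} -> L2le Y c -> L2le X c.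
Proof.
move=> mX XY [mY c0 hY]; split => //.
rewrite (ge0_ae_eq_integral (g := fun w => ((Y w) ^+ 2)%:E))//.
- exact: measurable_EFin_sqr.
- exact: measurable_EFin_sqr.
- by move=> w _; rewrite lee_fin sqr_ge0.
- by move=> w _; rewrite lee_fin sqr_ge0.
- by apply: filterS XY => w XYw _; rewrite XYw.
Qed.

Lemma L2le_eps X c : 0 <= c -> (forall e, 0 < e -> L2le X (c + e)) -> L2le X c.
Proof.
move=> c0 h; have [mX _ _] := h 1 ltr01; split => //.
apply/lee_addgt0Pr => e e0.
pose e' := Num.min 1 (e / (2 * c + 1)).
have c1 : 0 < 2 * c + 1 by lra.
have e'0 : 0 < e' by rewrite /e' lt_min ltr01 divr_gt0.
have [_ _ /le_trans] := h _ e'0; apply; rewrite -EFinD lee_fin.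
have e'1 : e' <= 1 by rewrite /e' ge_min lexx.
have e'2 : e' * (2 * c + 1) <= e by rewrite -ler_pdivlMr// /e' ge_min lexx orbT.
have : e' * e' <= e' * 1 by rewrite ler_pM2l.
by rewrite !expr2; nra.
Qed.

Lemma L2le0 : L2le (fun=> 0) 0.
Proof. by split => //; under eq_integral do rewrite expr0n/=; rewrite integral0. Qed.

Lemma L2leZ k X c : L2le X c -> L2le (fun w => k * X w) (`|k| * c).
Proof.
move=> [mX c0 hX]; split; first exact: measurable_funM.
  by rewrite mulr_ge0.
under eq_integral do rewrite exprMn EFinM.
rewrite ge0_integralZl//.
- rewrite exprMn real_normK ?num_real// [leRHS]EFinM; apply: lee_wpmul2l => //.
  by rewrite lee_fin sqr_ge0.
- exact: measurable_EFin_sqr.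
- by move=> w _; rewrite lee_fin sqr_ge0.
- by rewrite lee_fin sqr_ge0.
Qed.

Lemma L2leN X c : L2le X c -> L2le (fun w => - X w) c.
Proof.
move=> hX; have := L2leZ (-1) hX; rewrite normrN1 mul1r.
by under eq_fun do rewrite mulN1r.
Qed.

Lemma L2leD X Y a b : L2le X a -> L2le Y b -> L2le (fun w => X w + Y w) (a + b).
Proof.
move=> hX hY; have [mX a0 iX] := hX; have [mY b0 iY] := hY.
apply: L2le_eps; first exact: addr_ge0.
move=> e e0; pose A := a + e / 2; pose B := b + e / 2.
have A0 : 0 < A by rewrite /A; lra.
have B0 : 0 < B by rewrite /B; lra.
have -> : a + b + e = A + B by rewrite /A /B; lra.
have [_ _ jX] : L2le X A by apply: L2le_mono hX; rewrite /A; lra.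
have [_ _ jY] : L2le Y B by apply: L2le_mono hY; rewrite /B; lra.
have t0 : 0 < B / A by rewrite divr_gt0.
have s0 : 0 < A / B by rewrite divr_gt0.
split; [exact: measurable_funD|exact: ltW (addr_gt0 _ _)|].
apply: (@le_trans _ _ (\int[P]_w ((1 + B / A)%:E * (X w ^+ 2)%:E +
    (1 + A / B)%:E * (Y w ^+ 2)%:E)))%E.
  apply: ge0_le_integral => //.
  - by move=> w _; rewrite lee_fin sqr_ge0.
  - by apply: measurable_EFin_sqr; exact: measurable_funD.
  - by apply: emeasurable_funD; apply: measurable_funeM; exact: measurable_EFin_sqr.
  - move=> w _; rewrite -!EFinM -EFinD lee_fin.
    have -> : (1 + B / A) * X w ^+ 2 + (1 + A / B) * Y w ^+ 2 =
      (X w + Y w) ^+ 2 + (B * X w - A * Y w) ^+ 2 / (A * B).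
      by field; rewrite !gt_eqF.
    by rewrite lerDl divr_ge0 ?sqr_ge0// ltW// mulr_gt0.
rewrite ge0_integralD//; last 4 first.
- by move=> w _; rewrite mule_ge0 ?lee_fin ?sqr_ge0 ?addr_ge0 ?ltW.
- by apply: measurable_funeM; exact: measurable_EFin_sqr.
- by move=> w _; rewrite mule_ge0 ?lee_fin ?sqr_ge0 ?addr_ge0 ?ltW.
- by apply: measurable_funeM; exact: measurable_EFin_sqr.
rewrite !ge0_integralZl//; last 6 first.
- exact: measurable_EFin_sqr.
- by move=> w _; rewrite lee_fin sqr_ge0.
- by rewrite lee_fin addr_ge0// ltW.
- exact: measurable_EFin_sqr.
- by move=> w _; rewrite lee_fin sqr_ge0.
- by rewrite lee_fin addr_ge0// ltW.
apply: (@le_trans _ _ ((1 + B / A)%:E * (A ^+ 2)%:E + (1 + A / B)%:E * (B ^+ 2)%:E))%E.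
  by apply: leeD; apply: lee_wpmul2l => //; rewrite lee_fin addr_ge0// ltW.
rewrite -!EFinM -EFinD lee_fin le_eqVlt; apply/orP; left; apply/eqP.
by field; rewrite !gt_eqF.
Qed.

Lemma L2leB X Y a b : L2le X a -> L2le Y b -> L2le (fun w => X w - Y w) (a + b).
Proof. by move=> hX /L2leN; exact: L2leD. Qed.

Lemma L2le_sum (I : Type) (r : seq I) (Q : pred I) (X : I -> Omega -> R) (c : I -> R) :
  (forall i, Q i -> L2le (X i) (c i)) ->
  L2le (fun w => \sum_(i <- r | Q i) X i w) (\sum_(i <- r | Q i) c i).
Proof.
move=> h; elim: r => [|i r IH].
  by under eq_fun do rewrite big_nil; rewrite big_nil; exact: L2le0.
under eq_fun do rewrite big_cons; rewrite big_cons; case: ifP => // Qi.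
by apply: L2leD => //; exact: h.
Qed.

Lemma L2le_cvg X (c : R) : measurable_fun setT X -> 0 <= c ->
  (forall e, 0 < e -> exists Y, L2le Y c /\ L2le (fun w => X w - Y w) e) -> L2le X c.
Proof.
move=> mX c0 h; apply: L2le_eps => // e /h[Y [hY hXY]].
rewrite (_ : X = fun w => Y w + (X w - Y w)); last by apply/funext => w; rewrite addrC subrK.
exact: L2leD.
Qed.

Lemma L2le_lim0 (X_ : nat -> Omega -> R) X c : measurable_fun setT X ->
  (forall w, X_ ^~ w @ \oo --> X w) -> (forall n, L2le (X_ n) c) -> L2le X c.
Proof.
move=> mX cX hX; have [m0 c0 _] := hX 0%N; split => //.
have -> : (\int[P]_w ((X w) ^+ 2)%:E =
  \int[P]_w limn_einf (fun n => ((X_ n w) ^+ 2)%:E))%E.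
  apply: eq_integral => w _; apply/esym.
  have cv : (fun n => ((X_ n w) ^+ 2)%:E) @ \oo --> ((X w) ^+ 2)%:E.
    apply: cvg_EFin; first exact: nearW.
    rewrite /comp/= expr2; under eq_fun do rewrite expr2.
    exact: cvgM.
  by rewrite is_cvg_limn_einfE; [exact/cvg_lim|apply/cvg_ex; eexists; exact: cv].
apply: le_trans (fatou _ _ _ _) _ => //.
- by move=> n; have [mn _ _] := hX n; exact: measurable_EFin_sqr.
- by move=> n w _; rewrite lee_fin sqr_ge0.
- rewrite limn_einf_lim; apply: lime_le; first exact: is_cvg_einfs.
  apply: nearW => n; apply: le_trans (ereal_inf_lbound _) _.
  + by exists n => //=.
  + by case: (hX n).
Qed.

Lemma L2le_lim (X_ : nat -> Omega -> R) X (c_ : nat -> R) (c : R) :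
  measurable_fun setT X -> 0 <= c ->
  (forall w, X_ ^~ w @ \oo --> X w) -> (forall n, L2le (X_ n) (c_ n)) ->
  c_ @ \oo --> c -> L2le X c.
Proof.
move=> mX c0 cX hX cc; apply: L2le_eps => // e e0.
move/cvgrPdist_le : cc => /(_ _ e0)[N _ hN].
apply: (@L2le_lim0 (fun n => X_ (n + N)%N)) => //.
  by move=> w; have := cX w; rewrite -(cvg_shiftn N).
move=> n; apply: L2le_mono (hX _).
have := hN (n + N)%N (leq_addl _ _); rewrite ler_norml => /andP[]; lra.
Qed.

End L2le.

Section minkowski_integral.
Context {R : realType} {d0 : measure_display} {Omega : measurableType d0}.
Variable P : probability Omega R.
Context {d1 : measure_display} {T1 : measurableType d1}.
Variable m1 : {sigma_finite_measure set T1 -> \bar R}.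

Lemma measurable_Rintegral_param (D : set T1) (f : T1 * Omega -> R) :
  measurable D -> measurable_fun setT f ->
  measurable_fun setT (fun w => \int[m1]_(s in D) f (s, w)).
Proof.
move=> mD mf; pose g z := ((\1_D z.1 * f z)%:E) : \bar R.
have mg : measurable_fun setT g.
  apply/measurable_EFinP/measurable_funM => //.
  by apply: measurableT_comp measurable_fst; exact: measurable_indic.
rewrite (_ : (fun w => _) = fun w => fine (\int[m1]_s g (s, w))%E); last first.
  apply/funext => w; rewrite /Rintegral integral_mkcond; congr fine.
  apply: eq_integral => s _; rewrite /g/= patchE indicE.
  by case: ifP => sD; rewrite /= ?mul1r// mul0r.
apply: measurableT_comp => //.
have -> : (fun w => \int[m1]_s g (s, w))%E =
    (fun w => \int[m1]_s g^\+ (s, w) - \int[m1]_s g^\- (s, w))%E.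
  apply/funext => w; rewrite integralE.
  by under eq_integral do rewrite funepos_comp/=;
     under [X in (_ - X = _)%E]eq_integral do rewrite funeneg_comp/=.
apply: emeasurable_funB.
  by apply: measurable_fun_fubini_tonelli_G => //; exact: measurable_funepos.
by apply: measurable_fun_fubini_tonelli_G => //; exact: measurable_funeneg.
Qed.

Lemma L2le_int (D : set T1) (k c : T1 -> R) (F : T1 * Omega -> R) (K : R) :
  measurable D -> measurable_fun setT k -> measurable_fun setT c ->
  measurable_fun setT F ->
  (forall s, D s -> 0 <= k s) -> (forall s, D s -> 0 < c s) ->
  (forall s, D s -> L2le P (fun w => F (s, w)) (c s)) ->
  0 <= K -> (\int[m1]_(s in D) (k s * c s)%:E <= K%:E)%E ->
  L2le P (fun w => \int[m1]_(s in D) (k s * F (s, w))) K.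
Proof.
move=> mD mk mc mF k0 c0 hF K0 hK.
have mkF : measurable_fun setT (fun z : T1 * Omega => k z.1 * F z).
  by apply: measurable_funM => //; exact: measurableT_comp measurable_fst.
apply: L2le_eps => // e e0; pose L := K + e.
have L0 : 0 < L by rewrite /L; lra.
have mI := measurable_Rintegral_param mD mkF.
split => //; first exact: ltW.
have mFs w : measurable_fun setT (fun s => F (s, w)).
  by apply: measurableT_comp mF _; exact: measurable_pair2.
pose q w s := (k s * F (s, w) ^+ 2 * c s `^ (-1))%:E.
have cV s : D s -> c s `^ (-1) = (c s)^-1.
  by move=> Ds; rewrite powR_inv1// ltW// c0.
have mqw w : measurable_fun setT (q w).
  apply/measurable_EFinP; apply: measurable_funM.
    by apply: measurable_funM => //; exact: measurable_funX.
  exact: (measurableT_comp (measurable_powR (-1)) mc).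
have q0 w s : D s -> (0 <= q w s)%E.
  by move=> Ds; rewrite lee_fin mulr_ge0 ?powR_ge0// mulr_ge0 ?sqr_ge0 ?k0.
pose Q w := (\int[m1]_(s in D) q w s)%E.
have key w : (((\int[m1]_(s in D) (k s * F (s, w))) ^+ 2)%:E <= L%:E * Q w)%E.
  set i := \int[m1]_(s in D) _.
  have Q0 : (0 <= Q w)%E by apply: integral_ge0 => s; exact: q0.
  have [Qfin|] := boolP (Q w \is a fin_num); last first.
    rewrite ge0_fin_numE// -leNgt leye_eq => /eqP ->.
    by rewrite gt0_muley ?lte_fin// leey.
  have bound (l : R) : 0 < l -> `|i| <= 2^-1 * (l * L + fine (Q w) / l).
    move=> l0; rewrite -lee_fin.
    apply: (@le_trans _ _ (\int[m1]_(s in D) (`|k s * F (s, w)|)%:E)%E).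
      have mf : measurable_fun D (fun s => (k s * F (s, w))%:E).
        by apply/measurable_EFinP; apply: measurable_funTS; exact: measurable_funM.
      apply: le_trans (le_abse_integral m1 mD mf).
      rewrite /i /Rintegral; case: (integral _ _ _) => //=; by rewrite normr0 leey.
    apply: (@le_trans _ _ (\int[m1]_(s in D)
        ((2^-1 * l)%:E * (k s * c s)%:E + (2^-1 / l)%:E * q w s))%E).
      apply: ge0_le_integral => //.
      - by apply/measurable_EFinP/measurableT_comp => //; apply: measurable_funTS; exact: measurable_funM.
      - apply: measurable_funTS; apply: emeasurable_funD; apply: measurable_funeM => //.
        by apply/measurable_EFinP; exact: measurable_funM.
      - move=> s Ds; rewrite /q (cV _ Ds) -!EFinM -EFinD lee_fin normrM ger0_norm ?k0//.
        have cs := c0 _ Ds; have ks := k0 _ Ds.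
        rewrite -[F (s, w) ^+ 2]real_normK ?num_real//; set y := `|F (s, w)|.
        rewrite -subr_ge0.
        have -> : 2^-1 * l * (k s * c s) + 2^-1 / l * (k s * y ^+ 2 / c s) - k s * y =
          k s * ((l * c s - y) ^+ 2 / (2 * l * c s)) by field; rewrite !gt_eqF.
        by rewrite mulr_ge0// divr_ge0 ?sqr_ge0// ltW// mulr_gt0// mulr_gt0.
    rewrite ge0_integralD//; last 4 first.
    - by move=> s Ds; rewrite -EFinM lee_fin !mulr_ge0 ?k0 ?(ltW (c0 _ _)) ?invr_ge0// ltW.
    - by apply: measurable_funTS; apply: measurable_funeM; apply/measurable_EFinP; exact: measurable_funM.
    - by move=> s Ds; rewrite mule_ge0// ?q0// lee_fin mulr_ge0// invr_ge0 ltW.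
    - by apply: measurable_funTS; exact: measurable_funeM.
    rewrite !ge0_integralZl//; last 6 first.
    - exact: measurable_funTS.
    - by move=> s; exact: q0.
    - by rewrite lee_fin mulr_ge0// invr_ge0 ltW.
    - by apply: measurable_funTS; apply/measurable_EFinP; exact: measurable_funM.
    - by move=> s Ds; rewrite lee_fin mulr_ge0 ?k0 ?(ltW (c0 _ _)).
    - by rewrite lee_fin mulr_ge0// ltW.
    rewrite mulrDr EFinD; apply: leeD.
      rewrite mulrA [leRHS]EFinM; apply: lee_wpmul2l; first by rewrite lee_fin mulr_ge0// ltW.
      by apply: le_trans hK _; rewrite lee_fin /L; lra.
    by rewrite -/(Q w) -(fineK Qfin) -EFinM lee_fin/= le_eqVlt; apply/orP; left;
      apply/eqP; ring.
  rewrite -(fineK Qfin) -EFinM lee_fin.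
  have [->|i0] := eqVneq i 0; first by rewrite expr0n mulr_ge0 ?fine_ge0// ltW.
  have ai : 0 < `|i| by rewrite normr_gt0.
  have := bound _ (divr_gt0 ai L0).
  have -> : `|i| / L * L + fine (Q w) / (`|i| / L) = `|i| + L * fine (Q w) / `|i|.
    by field; rewrite !gt_eqF.
  move=> h; have : `|i| <= L * fine (Q w) / `|i| by lra.
  by rewrite ler_pdivlMr// -expr2 real_normK ?num_real.
apply: (@le_trans _ _ (\int[P]_w (L%:E * Q w))%E).
  apply: ge0_le_integral => //.
  - by move=> w _; rewrite lee_fin sqr_ge0.
  - exact: measurable_EFin_sqr.
  - apply: measurable_funeM.
    pose h (z : T1 * Omega) := ((\1_D z.1)%:E * q z.2 z.1)%E.
    rewrite (_ : Q = fun w => (\int[m1]_s h (s, w))%E); last first.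
      apply/funext => w; rewrite /Q integral_mkcond; apply: eq_integral => s _.
      by rewrite patchE /h/= indicE; case: ifP => _; rewrite ?mul1e// mul0e.
    apply: measurable_fun_fubini_tonelli_G.
    + apply: emeasurable_funM.
        by apply/measurable_EFinP; apply: measurableT_comp measurable_fst; exact: measurable_indic.
      apply/measurable_EFinP; apply: measurable_funM; last first.
        by apply: (measurableT_comp (measurable_powR (-1))); exact: measurableT_comp measurable_fst.
      apply: measurable_funM; first exact: measurableT_comp measurable_fst.
      by under eq_fun do rewrite -surjective_pairing; exact: measurable_funX.
    + move=> [s w]/=; rewrite /h/= indicE; case: (boolP (s \in D)) => /=; rewrite ?mul0e//.
      by rewrite inE mul1e => /q0.
have mh : measurable_fun setT (fun z : T1 * Omega => ((\1_D z.1)%:E * q z.2 z.1)%E).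
  apply: emeasurable_funM.
    by apply/measurable_EFinP; apply: measurableT_comp measurable_fst; exact: measurable_indic.
  apply/measurable_EFinP; apply: measurable_funM; last first.
    by apply: (measurableT_comp (measurable_powR (-1))); exact: measurableT_comp measurable_fst.
  apply: measurable_funM; first exact: measurableT_comp measurable_fst.
  by under eq_fun do rewrite -surjective_pairing; exact: measurable_funX.
have h0 z : (0 <= ((\1_D z.1)%:E * q z.2 z.1))%E.
  rewrite indicE; case: (boolP (z.1 \in D)) => /=; rewrite ?mul0e//.
  by rewrite inE mul1e => /q0.
have QE w : Q w = (\int[m1]_s ((\1_D s)%:E * q w s))%E.
  rewrite /Q integral_mkcond; apply: eq_integral => s _.
  by rewrite patchE indicE; case: ifP => _; rewrite ?mul1e// mul0e.
rewrite ge0_integralZl//; last 3 first.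
- rewrite (_ : Q = fun w => \int[m1]_s ((\1_D s)%:E * q w s))%E; last exact/funext.
  exact: (measurable_fun_fubini_tonelli_G _ mh h0).
- by move=> w _; apply: integral_ge0 => s; exact: q0.
- by rewrite lee_fin ltW.
rewrite (eq_integral (fun w => \int[m1]_s ((\1_D s)%:E * q w s))%E); last first.
  by move=> w _; rewrite QE.
rewrite -(@fubini_tonelli _ _ _ _ _ m1 P (fun z => (\1_D z.1)%:E * q z.2 z.1)%E)//=.
rewrite expr2 EFinM; apply: lee_wpmul2l; first by rewrite lee_fin ltW.
apply: (@le_trans _ _ (\int[m1]_(s in D) (k s * c s)%:E)%E); last first.
  by apply: le_trans hK _; rewrite lee_fin /L; lra.
rewrite [leRHS]integral_mkcond; apply: ge0_le_integral => //.
- by move=> s _; apply: integral_ge0 => w _; exact: (h0 (s, w)).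
- exact: (measurable_fun_fubini_tonelli_F _ mh h0).
- apply/(measurable_restrictT _ _).1 => //; apply: measurable_funTS.
  by apply/measurable_EFinP; exact: measurable_funM.
move=> s _; rewrite patchE; case: ifP => /= sD; last first.
  by rewrite indicE sD; under eq_integral do rewrite mul0e; rewrite integral0.
have Ds := set_mem sD; rewrite indicE sD.
under eq_integral do rewrite mul1e /q (cV _ Ds) mulrAC EFinM.
have [mFsw _ iF] := hF _ Ds.
rewrite ge0_integralZl//; last 3 first.
- exact: measurable_EFin_sqr.
- by move=> w _; rewrite lee_fin sqr_ge0.
- by rewrite lee_fin divr_ge0 ?k0 ?(ltW (c0 _ _)).
apply: (@le_trans _ _ ((k s / c s)%:E * (c s ^+ 2)%:E)%E).
  by apply: lee_wpmul2l => //; rewrite lee_fin divr_ge0 ?k0 ?(ltW (c0 _ _)).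
rewrite -EFinM lee_fin expr2 mulrA divfK// gt_eqF//; exact: c0.
Qed.

End minkowski_integral.

Section nrm2_theory.
Context {R : realType}.

Definition vnorm (d : nat) (v : 'cV[R]_d) : R := Num.sqrt (nrm2 v).

Lemma nrm2_ge0 d (v : 'cV[R]_d) : 0 <= nrm2 v.
Proof. by apply: sumr_ge0 => i _; exact: sqr_ge0. Qed.

Lemma vnorm_ge0 d (v : 'cV[R]_d) : 0 <= vnorm v.
Proof. exact: sqrtr_ge0. Qed.

Lemma coord_le_vnorm d (v : 'cV[R]_d) i : `|v i 0| <= vnorm v.
Proof.
rewrite -sqrtr_sqr ler_wsqrtr// /nrm2 (bigD1 i)//= lerDl.
by apply: sumr_ge0 => j _; exact: sqr_ge0.
Qed.

Lemma sum_sqr_le_sqr_sum (I : finType) (a : I -> R) : (forall i, 0 <= a i) ->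
  \sum_i a i ^+ 2 <= (\sum_i a i) ^+ 2.
Proof.
move=> a0; rewrite expr2 mulr_suml; apply: ler_sum => i _.
rewrite expr2; apply: ler_wpM2l => //; rewrite (bigD1 i)//= lerDl.
exact: sumr_ge0.
Qed.

Lemma vnorm_le_sum d (v : 'cV[R]_d) : vnorm v <= \sum_(i < d) `|v i 0|.
Proof.
have s0 : 0 <= \sum_(i < d) `|v i 0| by exact: sumr_ge0.
rewrite -[leRHS]ger0_norm// -sqrtr_sqr ler_wsqrtr// /nrm2.
rewrite (eq_bigr (fun i => `|v i 0| ^+ 2)); last first.
  by move=> i _; rewrite real_normK ?num_real.
exact: sum_sqr_le_sqr_sum.
Qed.

End nrm2_theory.

Section measurability.
Context {R : realType}.

Lemma measurable_fun_countable_index d (T : measurableType d) (I : countType)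
    (idx : T -> I) (g : I -> T -> R) :
  (forall i, measurable [set t | idx t = i]) ->
  (forall i, measurable_fun setT (g i)) ->
  measurable_fun setT (fun t => g (idx t) t).
Proof.
move=> midx mg _ A mA; rewrite setTI.
rewrite (_ : _ @^-1` _ = \bigcup_(i in [set: I]) ([set t | idx t = i] `&` (g i @^-1` A))).
  apply: countable_bigcupT_measurable; first exact: countableP.
  by move=> i; apply: measurableI => //; have := mg i measurableT _ mA; rewrite setTI.
apply/seteqP; split => t /=; first by move=> At; exists (idx t).
by move=> [i _ [<-]].
Qed.

Lemma floor_eqE (x : R) (z : int) : (Num.floor x = z) <-> (z%:~R <= x < (z + 1)%:~R).
Proof.
split => [<-|h]; first exact: floor_itv.
exact: floor_def.
Qed.

Lemma measurable_floor_fiber (z : int) :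
  measurable ([set x | Num.floor x = z] : set R).
Proof.
rewrite (_ : [set x | _] = `[z%:~R, (z + 1)%:~R[%classic).
  exact: measurable_itv.
by apply/seteqP; split => x /= => [/floor_eqE|h]; rewrite ?in_itv//; apply/floor_eqE.
Qed.

Lemma floor_approx (x : R) (n : nat) :
  `|x - (Num.floor (x * n.+1%:R))%:~R / n.+1%:R| <= n.+1%:R^-1.
Proof.
have n0 : 0 < (n.+1%:R : R) by rewrite ltr0n.
have /andP[h1 h2] := floor_itv (x * n.+1%:R).
rewrite intrD in h2.
rewrite ger0_norm.
  rewrite lerBlDr -[X in X + _]mul1r -mulrDl ler_pdivlMr// addrC ltW//.
by rewrite subr_ge0 ler_pdivrMr.
Qed.

Lemma cvg_floor_approx (x : R) :
  (fun n : nat => (Num.floor (x * n.+1%:R))%:~R / n.+1%:R) @ \oo --> x.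
Proof.
apply/cvgrPdist_le => e e0; near=> n.
apply: le_trans (floor_approx _ _) _; rewrite ltW//.
by near: n; exact: near_infty_natSinv_lt (PosNum e0).
Unshelve. all: by end_near. Qed.

Lemma measurable_lipschitz_comp d (T : measurableType d) m (f : 'cV[R]_m -> R)
    (L : R) (X : T -> 'cV[R]_m) :
  (forall u v, `|f u - f v| <= L * vnorm (u - v)) ->
  (forall i, measurable_fun setT (fun t => X t i 0)) ->
  measurable_fun setT (fun t => f (X t)).
Proof.
move=> fL mX.
pose idx n (t : T) : {ffun 'I_m -> int} := [ffun i => Num.floor (X t i 0 * n.+1%:R)].
pose v n (z : {ffun 'I_m -> int}) : 'cV[R]_m := \col_i ((z i)%:~R / n.+1%:R).
apply: (@measurable_fun_cvg _ _ _ _ (fun n t => f (v n (idx n t)))).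
  move=> n; apply: (@measurable_fun_countable_index _ _ _ (idx n) (fun z _ => f (v n z))).
    move=> z; rewrite (_ : [set t | _] = \bigcap_(i in [set: 'I_m])
        ((fun t => X t i 0 * n.+1%:R) @^-1` [set x | Num.floor x = z i])).
      rewrite -[X in measurable X]setCK; apply: measurableC; rewrite setC_bigcap.
      apply: countable_bigcupT_measurable => // i; apply: measurableC.
      rewrite -[_ @^-1` _]setTI.
      apply: measurable_funM => //; exact: measurable_floor_fiber.
    apply/seteqP; split => t /=.
      by move=> <- i _ /=; rewrite ffunE.
    by move=> h; apply/ffunP => i; rewrite ffunE; exact: (h i).
  by move=> z; exact: measurable_cst.
move=> t _.
have vX n : vnorm (X t - v n (idx n t)) <= m%:R * n.+1%:R^-1.
  apply: le_trans (vnorm_le_sum _) _.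
  rewrite (_ : m%:R / _ = \sum_(i < m) n.+1%:R^-1); last first.
    by rewrite sumr_const card_ord mulr_natl.
  by apply: ler_sum => i _; rewrite !mxE ffunE; exact: floor_approx.
have c0 : 0 < `|L| * m%:R + 1 by rewrite ltr_wpDl// mulr_ge0.
apply/cvgrPdist_le => e e0; near=> n.
apply: le_trans (fL _ _) _.
apply: le_trans (ler_wpM2r (vnorm_ge0 _) (ler_norm L)) _.
apply: le_trans (ler_wpM2l (normr_ge0 L) (vX n)) _; rewrite mulrA.
apply: (@le_trans _ _ ((`|L| * m%:R + 1) * n.+1%:R^-1)).
  by rewrite ler_wpM2r// lerDl.
rewrite -ler_pdivlMl// mulrC ltW//; near: n.
exact: near_infty_natSinv_lt (PosNum (divr_gt0 e0 c0)).
Unshelve. all: by end_near. Qed.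

Lemma measurable_caratheodory d (Omega : measurableType d) (X : R -> Omega -> R) :
  (forall s, measurable_fun setT (X s)) -> (forall w, continuous (X ^~ w)) ->
  measurable_fun setT (fun z : measurableTypeR R * Omega => X z.1 z.2).
Proof.
move=> mX cX.
pose idx n (z : measurableTypeR R * Omega) : int := Num.floor (z.1 * n.+1%:R : R).
apply: (@measurable_fun_cvg _ _ _ _ (fun n z => X ((idx n z)%:~R / n.+1%:R) z.2)).
  move=> n; apply: (@measurable_fun_countable_index _ _ _ (idx n)
      (fun i z => X (i%:~R / n.+1%:R) z.2)).
    move=> i; rewrite (_ : [set t | _] = fst @^-1`
      ((fun s : measurableTypeR R => s * n.+1%:R : R) @^-1` [set x | Num.floor x = i])) //.
    rewrite -[_ @^-1` _]setTI; apply: measurable_fst => //.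
    rewrite -[_ @^-1` _]setTI.
    have mf : measurable_fun setT (fun s : R => s * n.+1%:R) by exact: measurable_funM.
    exact: (mf measurableT _ (measurable_floor_fiber i)).
  by move=> i; apply: measurableT_comp (mX _) _; exact: measurable_snd.
move=> [s w] _ /=.
apply: (cvg_comp (fun n => (idx n (s, w))%:~R / n.+1%:R) (X ^~ w)); last exact: cX.
exact: cvg_floor_approx.
Qed.

End measurability.

(** * Second moments of Gaussian variables *)

Section density.
Context {R : realType} {d : measure_display} {T : measurableType d}.
Variables (mu nu : {measure set T -> \bar R}) (f : T -> R).
Hypothesis mf : measurable_fun setT f.
Hypothesis f0 : forall x, 0 <= f x.
Hypothesis nuE : forall A, measurable A -> nu A = (\int[mu]_(x in A) (f x)%:E)%E.

Import HBNNSimple.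

Let integral_density_nnsfun (h : {nnsfun T >-> R}) :
  (\int[nu]_x (h x)%:E = \int[mu]_x ((h x)%:E * (f x)%:E))%E.
Proof.
under [LHS]eq_integral do rewrite fimfunE -fsumEFin//.
rewrite [LHS]ge0_integral_fsum//; last 2 first.
- by move=> r; exact/measurable_EFinP/measurableT_comp.
- by move=> n x _; rewrite EFinM nnfun_muleindic_ge0.
under [RHS]eq_integral.
  move=> x xD; rewrite fimfunE -fsumEFin// ge0_mule_fsuml; last first.
    by move=> r; rewrite EFinM nnfun_muleindic_ge0.
  over.
rewrite [RHS]ge0_integral_fsum//; last 2 first.
- move=> r; apply: emeasurable_funM; last exact/measurable_EFinP.
  exact/measurable_EFinP/measurableT_comp.
- move=> n x _; apply: mule_ge0; last by rewrite lee_fin.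
  by rewrite EFinM nnfun_muleindic_ge0.
apply: eq_fsbigr => r; rewrite inE => -[x _ <-].
rewrite !integralZl_indic_nnsfun//=.
have mA : measurable (h @^-1` [set h x]).
  exact: measurable_funPTI.
rewrite integral_indic// setIT nuE// integral_mkcond -ge0_integralZl//; last 3 first.
- by apply/(measurable_restrictT _ _).1 => //; apply: measurable_funTS; exact/measurable_EFinP.
- by move=> y _; rewrite patchE; case: ifP => // _; rewrite lee_fin.
- by rewrite lee_fin.
apply: eq_integral => y _; rewrite patchE indicE.
by case: ifP => _ /=; rewrite ?mulr1// mulr0 mul0e mule0.
Qed.

Lemma integral_density (g : T -> \bar R) : measurable_fun setT g ->
  (forall x, 0 <= g x)%E -> (\int[nu]_x g x = \int[mu]_x (g x * (f x)%:E))%E.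
Proof.
move=> mg g0; pose h := nnsfun_approx measurableT mg.
have nd x : nondecreasing_seq (fun n => (h n x)%:E).
  by move=> m n mn; rewrite lee_fin; exact/lefP/nd_nnsfun_approx.
have hg x : (fun n => (h n x)%:E) @ \oo --> g x by exact: cvg_nnsfun_approx.
transitivity (lim (\int[nu]_x (h n x)%:E @[n --> \oo])%E).
  rewrite -monotone_convergence//=.
  - by apply: eq_integral => x _; apply/esym/cvg_lim => //; exact: hg.
  - by move=> n; exact/measurable_EFinP/measurable_funTS.
  - by move=> n x _; rewrite lee_fin.
transitivity (lim (\int[mu]_x ((h n x)%:E * (f x)%:E) @[n --> \oo])%E).
  by apply: congr_lim; apply/funext => n /=; exact: integral_density_nnsfun.
rewrite -monotone_convergence//=.
- apply: eq_integral => x _; apply/cvg_lim => //.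
  apply: cvgeZr => //; exact: hg.
- move=> n; apply: emeasurable_funM; exact/measurable_EFinP.
- by move=> n x _; rewrite mule_ge0// lee_fin.
- by move=> x _ m n mn; apply: lee_wpmul2r; [rewrite lee_fin|exact: nd].
Qed.

End density.

Section gaussian_moment.
Context {R : realType}.
Local Notation mu := (@lebesgue_measure R).

Definition gauss_m2 : R := fine (\int[mu]_x (x ^+ 2 * normal_pdf 0 1 x)%:E)%E.

Lemma sqr_normal_pdf_le (x : R) :
  x ^+ 2 * normal_pdf 0 1 x <= 4 * normal_peak 1 / normal_peak (Num.sqrt 2)
     * normal_pdf 0 (Num.sqrt 2) x.
Proof.
have s0 : Num.sqrt 2 != 0 :> R by rewrite gt_eqF// sqrtr_gt0.
have p0 : normal_peak (Num.sqrt (2 : R)) != 0 by rewrite gt_eqF// normal_peak_gt0.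
rewrite !normal_pdfE// /normal_fun !subr0 expr1n sqr_sqrtr//; set y := x ^+ 2.
have -> : 4 * normal_peak 1 / normal_peak (Num.sqrt 2) *
    (normal_peak (Num.sqrt 2) * expR (- y / (2 *+ 2))) =
    normal_peak 1 * (4 * expR (- y / (2 *+ 2))) by field.
rewrite mulrCA ler_wpM2l ?normal_peak_ge0//.
have -> : - y / (1 *+ 2) = - (y / 4) + - y / (2 *+ 2) by field.
rewrite expRD mulrA ler_wpM2r ?expR_ge0//.
rewrite expRN ler_pdivrMr ?expR_gt0// -ler_pdivrMl//.
by have := expR_ge1Dx (y / 4); lra.
Qed.

Lemma integral_sqr_normal_lty : (\int[mu]_x (x ^+ 2 * normal_pdf 0 1 x)%:E < +oo)%E.
Proof.
set c := 4 * normal_peak 1 / normal_peak (Num.sqrt (2 : R)).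
have c0 : 0 <= c by rewrite !mulr_ge0 ?invr_ge0 ?normal_peak_ge0.
apply: (@le_lt_trans _ _ (\int[mu]_x (c%:E * (normal_pdf 0 (Num.sqrt 2) x)%:E))%E).
  apply: ge0_le_integral => //.
  - by move=> x _; rewrite lee_fin mulr_ge0 ?sqr_ge0 ?normal_pdf_ge0.
  - apply/measurable_EFinP; apply: measurable_funM => //.
    exact: measurable_normal_pdf.
  - by apply: measurable_funeM; apply/measurable_EFinP; exact: measurable_normal_pdf.
  - by move=> x _; rewrite -EFinM lee_fin; exact: sqr_normal_pdf_le.
rewrite ge0_integralZl//; last 2 first.
- by apply/measurable_EFinP; exact: measurable_normal_pdf.
- by move=> x _; rewrite lee_fin normal_pdf_ge0.
by rewrite integral_normal_pdf mule1 ltry.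
Qed.

Lemma gauss_m2E : (\int[mu]_x (x ^+ 2 * normal_pdf 0 1 x)%:E)%E = gauss_m2%:E.
Proof.
rewrite fineK// ge0_fin_numE ?integral_sqr_normal_lty// integral_ge0// => x _.
by rewrite lee_fin mulr_ge0 ?sqr_ge0 ?normal_pdf_ge0.
Qed.

Lemma gauss_m2_gt0 : 0 < gauss_m2.
Proof.
rewrite -lte_fin -gauss_m2E.
pose c : R := normal_peak 1 * expR (- 2).
have c0 : 0 < c by rewrite mulr_gt0 ?expR_gt0 ?normal_peak_gt0 ?oner_neq0.
apply: (@lt_le_trans _ _ (\int[mu]_(x in `[1%R, 2%R]) c%:E)%E).
  rewrite integral_cst//= lebesgue_measure_itv/= lte_fin ltr1n/= -EFinB -EFinM lte_fin.
  by rewrite mulr_gt0//; lra.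
rewrite integral_mkcond; apply: ge0_le_integral => //.
- by move=> x _; rewrite patchE; case: ifP => // _; rewrite lee_fin ltW.
- by apply/(measurable_restrictT _ _).1.
- apply/measurable_EFinP; apply: measurable_funM => //; exact: measurable_normal_pdf.
move=> x _; rewrite patchE; case: ifP => [|_]; last first.
  by rewrite lee_fin mulr_ge0 ?sqr_ge0 ?normal_pdf_ge0.
rewrite inE/= in_itv/= => /andP[x1 x2]; rewrite lee_fin normal_pdfE ?oner_neq0//.
rewrite /c mulrCA ler_wpM2l ?normal_peak_ge0// /normal_fun subr0 expr1n.
rewrite -[leLHS]mul1r ler_pM ?expR_ge0//; first by rewrite expr2; nra.
by rewrite ler_expR expr2; nra.
Qed.

Lemma integral_sqr_normal (s : R) : 0 < s ->
  (\int[mu]_x (x ^+ 2 * normal_pdf 0 s x)%:E = (s ^+ 2 * gauss_m2)%:E)%E.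
Proof.
move=> s0.
pose F (x : R^o) : R^o := s * x.
have F'E : F^`()%classic = cst s.
  by apply/funext => x; rewrite /F derive1E deriveZ//= derive_id scaler1.
rewrite (@increasing_ge0_integration_by_substitutionT _ F
    (fun x => x ^+ 2 * normal_pdf 0 s x)).
- rewrite EFinM -gauss_m2E -ge0_integralZl//; last 3 first.
  + apply/measurable_EFinP; apply: measurable_funM => //; exact: measurable_normal_pdf.
  + by move=> x _; rewrite lee_fin mulr_ge0 ?sqr_ge0 ?normal_pdf_ge0.
  + by rewrite lee_fin sqr_ge0.
  apply: eq_integral => x _; rewrite F'E !fctE /F -EFinM; congr EFin.
  rewrite !normal_pdfE ?oner_neq0 ?gt_eqF//.
  rewrite /normal_fun /normal_peak !subr0 !expr1n exprMn mul1r.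
  have -> : - (s ^+ 2 * x ^+ 2) / (s ^+ 2 *+ 2) = - x ^+ 2 / (1 *+ 2).
    by field; rewrite gt_eqF.
  rewrite -mulrnAr sqrtrM ?sqr_ge0// sqrtr_sqr gtr0_norm//.
  have p0 : Num.sqrt (pi *+ 2) != 0 :> R.
    by rewrite gt_eqF// sqrtr_gt0 mulrn_wgt0// pi_gt0.
  by field; rewrite p0 gt_eqF.
- by move=> x y xy; rewrite /F ltr_pM2l.
- by rewrite F'E => ?; exact: cvg_cst.
- by rewrite F'E; exact: is_cvg_cst.
- by rewrite F'E; exact: is_cvg_cst.
- by move=> x; rewrite /F; exact: derivableZ.
- by apply/gt0_cvgMrNy => //; exact: cvg_id.
- by apply/gt0_cvgMry => //; exact: cvg_id.
- move=> x; apply: cvgM; first exact: sqr_continuous.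
  by apply: continuous_normal_pdf; rewrite gt_eqF.
- by move=> x; rewrite mulr_ge0 ?sqr_ge0 ?normal_pdf_ge0.
Qed.

Context {d0 : measure_display} {Omega : measurableType d0}.
Variable P : probability Omega R.

Lemma centered_gaussian_sqr (X : Omega -> R) (v : R) : 0 <= v ->
  centered_gaussian P X v -> (\int[P]_w ((X w) ^+ 2)%:E = (v * gauss_m2)%:E)%E.
Proof.
move=> v0 [mX]; have [->|vn0] := eqVneq v 0.
  move=> PX; rewrite mul0r -[RHS](integral0 P setT).
  apply: ge0_ae_eq_integral => //.
  - exact: measurable_EFin_sqr.
  - by move=> w _; rewrite lee_fin sqr_ge0.
  have mA : measurable [set w | X w = 0].
    by rewrite -[X in measurable X]setTI; apply: (mX measurableT [set 0]); exact: measurable_set1.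
  exists (~` [set w | X w = 0]); split.
  - exact: measurableC.
  - by have := probability_setC P mA; rewrite PX subee.
  - move=> w /=; apply: contra_not => Xw _; rewrite Xw expr0n//.
move=> PX; have v1 : 0 < v by rewrite lt_neqAle eq_sym vn0.
have s0 : 0 < Num.sqrt v by rewrite sqrtr_gt0.
rewrite -[v in RHS]sqr_sqrtr// -integral_sqr_normal//.
pose g (y : measurableTypeR R) := ((y : R) ^+ 2)%:E.
have mg : measurable_fun setT g by apply/measurable_EFinP.
pose X' : Omega -> measurableTypeR R := X.
have mX' : measurable_fun setT X' := mX.
transitivity (\int[pushforward P X']_y g y)%E.
  by rewrite ge0_integral_pushforward// => y _; rewrite lee_fin sqr_ge0.
transitivity (\int[normal_prob 0 (Num.sqrt v)]_y g y)%E.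
  by apply: eq_measure_integral => A mA _; exact: PX.
rewrite (@integral_density _ _ _ mu _ (normal_pdf 0 (Num.sqrt v)))//.
- exact: measurable_normal_pdf.
- by move=> x; exact: normal_pdf_ge0.
- by move=> y; rewrite lee_fin sqr_ge0.
Qed.

End gaussian_moment.

Section abs_powR_convexity.
Context {R : realType}.
Implicit Types p x y t : R.

Lemma powR_ge_affine x p : 0 <= x -> 1 <= p -> 1 + p * (x - 1) <= x `^ p.
Proof.
move=> x0 p1; have p0 : 0 < p by lra.
have := @powR_le_affine R (x `^ p) p^-1 (powR_ge0 _ _).
rewrite -powRrM divff ?gt_eqF// powRr1// => /(_ _)/wrap[].
  by rewrite invr_gt0 p0 invf_le1.
move=> h; have : p * (x - 1) <= p * (p^-1 * (x `^ p - 1)) by rewrite ler_pM2l//; lra.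
by rewrite mulVKf ?gt_eqF//; lra.
Qed.

Lemma abs_powR_tangent p y : 1 <= p -> exists s, forall x,
  `|y| `^ p + s * (x - y) <= `|x| `^ p.
Proof.
move=> p1; have p0 : 0 < p by lra.
wlog y0 : y / 0 <= y.
  move=> W; have [/W//|yneg] := leP 0 y.
  have /W[s hs] : 0 <= - y by lra.
  exists (- s) => x; have := hs (- x); rewrite !normrN => h; apply: le_trans h.
  by rewrite lerD2l; lra.
have [y00|yn0] := eqVneq y 0.
  exists 0 => x; rewrite y00 normr0 powR0 ?gt_eqF// mul0r addr0; exact: powR_ge0.
have y1 : 0 < y by rewrite lt_neqAle eq_sym yn0.
exists (p * y `^ (p - 1)) => x; rewrite (gtr0_norm y1).
apply: (@le_trans _ _ (y `^ p + p * y `^ (p - 1) * (`|x| - y))).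
  by rewrite lerD2l ler_wpM2l ?mulr_ge0 ?powR_ge0 ?(ltW p0)// lerD2r ler_norm.
rewrite (powR_scale1 p y1 (normr_ge0 x)) powRB1E//.
have -> : y `^ p + p * (y `^ p / y) * (`|x| - y) = y `^ p * (1 + p * (`|x| / y - 1)).
  by field.
rewrite ler_wpM2l ?powR_ge0//; apply: powR_ge_affine => //.
by rewrite divr_ge0// ltW.
Qed.

Lemma abs_powR_convex p t x y : 1 <= p -> 0 <= t <= 1 ->
  `|t * x + (1 - t) * y| `^ p <= t * `|x| `^ p + (1 - t) * `|y| `^ p.
Proof.
move=> p1 /andP[t0 t1]; have [s hs] := abs_powR_tangent (t * x + (1 - t) * y) p1.
have hx := hs x; have hy := hs y.
have : t * (`|t * x + (1 - t) * y| `^ p + s * (x - (t * x + (1 - t) * y))) +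
  (1 - t) * (`|t * x + (1 - t) * y| `^ p + s * (y - (t * x + (1 - t) * y))) <=
  t * `|x| `^ p + (1 - t) * `|y| `^ p.
  by apply: lerD; apply: ler_wpM2l => //; lra.
by apply: le_trans; rewrite le_eqVlt; apply/orP; left; apply/eqP; ring.
Qed.

Lemma abs_powR_majorize p x1 x2 y1 y2 : 1 <= p -> y1 + y2 = x1 + x2 ->
  x2 <= y1 <= x1 -> `|y1| `^ p + `|y2| `^ p <= `|x1| `^ p + `|x2| `^ p.
Proof.
move=> p1 e /andP[h1 h2].
have [x12|x12] := eqVneq x1 x2.
  have -> : y1 = x1 by apply/eqP; rewrite eq_le h2 x12.
  by have -> : y2 = x2 by lra.
have x0 : 0 < x1 - x2 by rewrite subr_gt0 lt_neqAle eq_sym x12 (le_trans h1).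
pose t := (y1 - x2) / (x1 - x2).
have t01 : 0 <= t <= 1.
  apply/andP; split; first by rewrite divr_ge0 ?(ltW x0)// subr_ge0.
  by rewrite ler_pdivrMr// mul1r lerD2r.
have e1 : y1 = t * x1 + (1 - t) * x2.
  by rewrite /t; field; rewrite gt_eqF.
have e2 : y2 = (1 - t) * x1 + (1 - (1 - t)) * x2 by rewrite (_ : y2 = x1 + x2 - y1); lra.
rewrite {1}e1 e2; apply: le_trans (lerD (abs_powR_convex _ _ p1 t01)
   (abs_powR_convex _ _ p1 _)) _; first by lra.
by rewrite le_eqVlt; apply/orP; left; apply/eqP; ring.
Qed.

End abs_powR_convexity.

Section inner_product.
Context {R : realType} {d0 : measure_display} {Omega : measurableType d0}.
Variable P : probability Omega R.
Implicit Types X Y Z : Omega -> R.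

Definition ip X Y : R := \int[P]_w (X w * Y w).

Definition L2 X := exists c, L2le P X c.

Lemma L2_integrable X Y : L2 X -> L2 Y -> P.-integrable setT (EFin \o (fun w => X w * Y w)).
Proof.
move=> [a [mX a0 hX]] [b [mY b0 hY]]; apply/integrableP; split.
  by apply/measurable_EFinP; exact: measurable_funM.
apply: (@le_lt_trans _ _ (\int[P]_w ((X w ^+ 2)%:E + (Y w ^+ 2)%:E))%E).
  apply: ge0_le_integral => //.
  - by apply: measurableT_comp => //; apply/measurable_EFinP; exact: measurable_funM.
  - by apply: emeasurable_funD; exact: measurable_EFin_sqr.
  - move=> w _; rewrite -EFinD lee_fin normrM.
    rewrite -[X w ^+ 2]real_normK ?num_real// -[Y w ^+ 2]real_normK ?num_real//.
    by have := sqr_ge0 (`|X w| - `|Y w|); have := sqr_ge0 (`|X w| + `|Y w|);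
      rewrite !expr2; nra.
rewrite ge0_integralD//; last 4 first.
- by move=> w _; rewrite lee_fin sqr_ge0.
- exact: measurable_EFin_sqr.
- by move=> w _; rewrite lee_fin sqr_ge0.
- exact: measurable_EFin_sqr.
by apply: le_lt_trans (leeD hX hY) _; rewrite -EFinD ltry.
Qed.

Lemma ipC X Y : ip X Y = ip Y X.
Proof. by apply: eq_Rintegral => w _; rewrite mulrC. Qed.

Lemma ipDl X Y Z : L2 X -> L2 Y -> L2 Z ->
  ip (fun w => X w + Y w) Z = ip X Z + ip Y Z.
Proof.
move=> hX hY hZ; rewrite /ip -RintegralD//; last 2 first.
- exact: L2_integrable.
- exact: L2_integrable.
by apply: eq_Rintegral => w _; rewrite mulrDl.
Qed.

Lemma ipZl k X Y : L2 X -> L2 Y -> ip (fun w => k * X w) Y = k * ip X Y.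
Proof.
move=> hX hY; rewrite /ip -RintegralZl//; last exact: L2_integrable.
by apply: eq_Rintegral => w _; rewrite mulrA.
Qed.

Lemma L2D X Y : L2 X -> L2 Y -> L2 (fun w => X w + Y w).
Proof. by move=> [a hX] [b hY]; exists (a + b); exact: L2leD. Qed.

Lemma L2Z k X : L2 X -> L2 (fun w => k * X w).
Proof. by move=> [a hX]; exists (`|k| * a); exact: L2leZ. Qed.

Lemma L2N X : L2 X -> L2 (fun w => - X w).
Proof. by move=> [a hX]; exists a; exact: L2leN. Qed.

Lemma L2B X Y : L2 X -> L2 Y -> L2 (fun w => X w - Y w).
Proof. by move=> hX hY; apply: L2D => //; exact: L2N. Qed.

Lemma ipNl X Y : L2 X -> L2 Y -> ip (fun w => - X w) Y = - ip X Y.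
Proof.
move=> hX hY; rewrite -mulN1r -ipZl//.
by apply: eq_Rintegral => w _; rewrite mulN1r.
Qed.

Lemma ipBl X Y Z : L2 X -> L2 Y -> L2 Z ->
  ip (fun w => X w - Y w) Z = ip X Z - ip Y Z.
Proof. by move=> hX hY hZ; rewrite ipDl ?ipNl//; exact: L2N. Qed.

Lemma ipBr X Y Z : L2 X -> L2 Y -> L2 Z ->
  ip Z (fun w => X w - Y w) = ip Z X - ip Z Y.
Proof. by move=> hX hY hZ; rewrite ipC ipBl// ipC (ipC Y). Qed.

Lemma ipDr X Y Z : L2 X -> L2 Y -> L2 Z ->
  ip Z (fun w => X w + Y w) = ip Z X + ip Z Y.
Proof. by move=> hX hY hZ; rewrite ipC ipDl// ipC (ipC Y). Qed.

Lemma L2_sum (I : Type) (r : seq I) (X : I -> Omega -> R) :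
  (forall i, L2 (X i)) -> L2 (fun w => \sum_(i <- r) X i w).
Proof.
move=> hX; elim: r => [|i r IH].
  by under eq_fun do rewrite big_nil; exists 0; exact: L2le0.
by under eq_fun do rewrite big_cons; exact: L2D.
Qed.

Lemma ip_suml (I : Type) (r : seq I) (X : I -> Omega -> R) Z :
  (forall i, L2 (X i)) -> L2 Z ->
  ip (fun w => \sum_(i <- r) X i w) Z = \sum_(i <- r) ip (X i) Z.
Proof.
move=> hX hZ; elim: r => [|i r IH].
  rewrite big_nil /ip; under eq_Rintegral do rewrite big_nil mul0r.
  by rewrite /Rintegral integral0.
rewrite big_cons -IH -ipDl//; last exact: L2_sum.
by apply: eq_Rintegral => w _; rewrite big_cons.
Qed.

Lemma ip_sqrE X : L2 X -> (\int[P]_w ((X w) ^+ 2)%:E)%E = (ip X X)%:E.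
Proof.
move=> hX; rewrite /ip /Rintegral fineK; last first.
  by apply: integrable_fin_num => //; exact: L2_integrable.
by apply: eq_integral => w _; rewrite expr2.
Qed.

Lemma ip_sqr_le X c : L2le P X c -> ip X X <= c ^+ 2.
Proof.
move=> hX; rewrite -lee_fin -ip_sqrE; last by exists c.
by case: hX.
Qed.

Lemma ip_sqr_ge0 X : 0 <= ip X X.
Proof. by apply: Rintegral_ge0 => w _; rewrite -expr2 sqr_ge0. Qed.

Lemma L2le_ip X : L2 X -> L2le P X (Num.sqrt (ip X X)).
Proof.
move=> hX; split; first by case: hX => c [].
  exact: sqrtr_ge0.
by rewrite ip_sqrE// sqr_sqrtr// ip_sqr_ge0.
Qed.

Lemma ip_norm_le X Y a b : L2le P X a -> L2le P Y b -> `|ip X Y| <= a * b.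
Proof.
move=> hX hY; have LX : L2 X by exists a.
have LY : L2 Y by exists b.
have a0 := L2le_ge0 hX; have b0 := L2le_ge0 hY.
apply/ler_addgt0Pr => e e0.
pose A := a + e / (a + b + e + 1); pose B := b + e / (a + b + e + 1).
have s0 : 0 < a + b + e + 1 by lra.
set u := e / _ in A B.
have u0 : 0 < u by rewrite /u divr_gt0.
have u1 : u <= 1 by rewrite /u ler_pdivrMr// mul1r; lra.
have ue : u * (a + b + e + 1) = e by rewrite /u divfK// gt_eqF.
have A0 : 0 < A by rewrite /A; lra.
have B0 : 0 < B by rewrite /B; lra.
have hXA : ip X X <= A ^+ 2 by apply: ip_sqr_le; apply: L2le_mono hX; rewrite /A; lra.
have hYB : ip Y Y <= B ^+ 2 by apply: ip_sqr_le; apply: L2le_mono hY; rewrite /B; lra.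
apply: (@le_trans _ _ (A * B)); last by rewrite /A /B; nra.
have key (s : R) : s ^+ 2 = 1 -> s * ip X Y <= A * B.
  move=> s1.
  have := ip_sqr_ge0 (fun w => B * X w - (s * A) * Y w).
  rewrite ipBl; [|exact: L2Z|exact: L2Z|by apply: L2B; exact: L2Z].
  rewrite !ipZl//; [|by apply: L2B; exact: L2Z|by apply: L2B; exact: L2Z].
  rewrite !ipBr//; try exact: L2Z.
  rewrite ![ip _ (fun w => _ * _)]ipC !ipZl// [ip Y X]ipC => h.
  have e1 : 0 <= B ^+ 2 * ip X X + (s ^+ 2) * A ^+ 2 * ip Y Y - 2 * (A * B) * (s * ip X Y).
    by apply: le_trans h _; rewrite le_eqVlt; apply/orP; left; apply/eqP; ring.
  rewrite s1 mul1r in e1.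
  have AB : 0 < A * B by rewrite mulr_gt0.
  rewrite -(ler_pM2l (x := 2 * (A * B))); last by lra.
  have e2 : B ^+ 2 * ip X X <= B ^+ 2 * A ^+ 2 by rewrite ler_wpM2l ?sqr_ge0.
  have e3 : A ^+ 2 * ip Y Y <= A ^+ 2 * B ^+ 2 by rewrite ler_wpM2l ?sqr_ge0.
  have -> : 2 * (A * B) * (A * B) = A ^+ 2 * B ^+ 2 + B ^+ 2 * A ^+ 2 by ring.
  lra.
rewrite ler_norml; apply/andP; split.
  by have := key (-1); rewrite expr2 mulrNN mul1r => /(_ erefl); lra.
by have := key 1; rewrite expr1n mul1r => /(_ erefl).
Qed.

Definition cvgL2 (X_ : nat -> Omega -> R) X :=
  forall e, 0 < e -> \forall n \near \oo, L2le P (fun w => X w - X_ n w) e.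

Lemma ip_cvgl (X_ : nat -> Omega -> R) X Y : (forall n, L2 (X_ n)) -> L2 X -> L2 Y ->
  cvgL2 X_ X -> (fun n => ip (X_ n) Y) @ \oo --> ip X Y.
Proof.
move=> hn hX hY cX; have [b hb] := hY; have b0 := L2le_ge0 hb.
apply/cvgrPdist_le => e e0.
have b1 : 0 < b + 1 by lra.
have := cX _ (divr_gt0 e0 b1); apply: filterS => n hXn.
rewrite -ipBl//; apply: le_trans (ip_norm_le hXn hb) _.
rewrite mulrAC ler_pdivrMr// ler_wpM2l ?(ltW e0)//; lra.
Qed.

Lemma ip_cvgr (X_ : nat -> Omega -> R) X Y : (forall n, L2 (X_ n)) -> L2 X -> L2 Y ->
  cvgL2 X_ X -> (fun n => ip Y (X_ n)) @ \oo --> ip Y X.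
Proof.
move=> hn hX hY cX; rewrite ipC; under eq_fun do rewrite ipC; exact: ip_cvgl.
Qed.

Lemma cvgL2_L2 (X_ : nat -> Omega -> R) X : (forall n, L2 (X_ n)) -> cvgL2 X_ X -> L2 X.
Proof.
move=> hn /(_ 1 ltr01)[N _ hN]; have hd := hN N (leqnn _).
have [c hc] := hn N; exists (1 + c).
rewrite (_ : X = fun w => (X w - X_ N w) + X_ N w); last first.
  by apply/funext => w; rewrite subrK.
exact: L2leD.
Qed.

Lemma cvgL2B (X_ Y_ : nat -> Omega -> R) X Y : cvgL2 X_ X -> cvgL2 Y_ Y ->
  cvgL2 (fun n w => X_ n w - Y_ n w) (fun w => X w - Y w).
Proof.
move=> cX cY e e0; have e2 : 0 < e / 2 by rewrite divr_gt0.
near=> n.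
have h1 : L2le P (fun w => X w - X_ n w) (e / 2) by near: n; exact: cX.
have h2 : L2le P (fun w => Y w - Y_ n w) (e / 2) by near: n; exact: cY.
have := L2leB h1 h2; rewrite -splitr.
by congr (L2le _ _ _); apply/funext => w; ring.
Unshelve. all: by end_near. Qed.

Lemma L2le_cvgL2 (X_ : nat -> Omega -> R) X c : measurable_fun setT X ->
  0 <= c -> cvgL2 X_ X -> (forall n, L2le P (X_ n) c) -> L2le P X c.
Proof.
move=> mX c0 cX hn; apply: L2le_cvg => // e /cX[N _ hN].
by exists (X_ N); split; [exact: hn|exact: hN N (leqnn _)].
Qed.

End inner_product.

(** * Fractional Brownian increments and the Riemann-Liouville noise *)

Section increment_covariance.
Context {R : realType}.
Variable H : R.

Definition icov4 (a b a' b' : R) : R :=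
  (`|b - a'| `^ (2 * H) + `|a - b'| `^ (2 * H)
   - `|a - a'| `^ (2 * H) - `|b - b'| `^ (2 * H)) / 2.

Lemma icov4E a b a' b' : fbm_cov H b b' - fbm_cov H b a' - fbm_cov H a b' + fbm_cov H a a'
  = icov4 a b a' b'.
Proof. by rewrite /fbm_cov /icov4; field. Qed.

Lemma icov4_ge0 a b a' b' : 1 <= 2 * H -> a <= b -> a' <= b' -> 0 <= icov4 a b a' b'.
Proof.
move=> H1 ab ab'; rewrite /icov4 divr_ge0// -addrA -opprD subr_ge0.
by apply: abs_powR_majorize => //; lra.
Qed.

Lemma icov4C a b a' b' : icov4 a b a' b' = icov4 a' b' a b.
Proof.
rewrite /icov4 [`|b - a'|]distrC [`|a - b'|]distrC [`|a - a'|]distrC [`|b - b'|]distrC.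
by rewrite [X in (X - _ - _) / 2]addrC.
Qed.

Lemma icov4_diag a b : 0 < H -> a <= b -> icov4 a b a b = (b - a) `^ (2 * H).
Proof.
move=> H0 ab; rewrite /icov4 !subrr normr0 powR0 ?gt_eqF ?mulr_gt0//.
by rewrite (distrC a b) ger0_norm ?subr_ge0//; field.
Qed.

Definition icov (r r' : seq (R * R * R)) : R :=
  \sum_(x <- r) \sum_(y <- r') x.1.1 * y.1.1 * icov4 x.1.2 x.2 y.1.2 y.2.

Definition igood (x : R * R * R) := (0 <= x.1.1) && (0 <= x.1.2 <= x.2).

Lemma icov_ge0 r r' : 1 <= 2 * H -> all igood r -> all igood r' -> 0 <= icov r r'.
Proof.
move=> H1 /allP gr /allP gr'; rewrite /icov big_seq; apply: sumr_ge0 => x /gr.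
move=> /andP[x0 /andP[_ xx]]; rewrite big_seq; apply: sumr_ge0 => y /gr'.
move=> /andP[y0 /andP[_ yy]]; apply: mulr_ge0; first exact: mulr_ge0.
exact: icov4_ge0.
Qed.

Lemma icovC r r' : icov r r' = icov r' r.
Proof.
rewrite /icov exchange_big; apply: eq_bigr => x _; apply: eq_bigr => y _ /=.
by rewrite icov4C (mulrC y.1.1).
Qed.

Lemma icov_catl r1 r2 r' : icov (r1 ++ r2) r' = icov r1 r' + icov r2 r'.
Proof. by rewrite /icov big_cat. Qed.

Lemma icov_catr r1 r2 r' : icov r' (r1 ++ r2) = icov r' r1 + icov r' r2.
Proof. by rewrite icovC icov_catl !(icovC _ r'). Qed.

End increment_covariance.

Section fbm_moments.
Context {R : realType} {d0 : measure_display} {Omega : measurableType d0}.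
Variable P : probability Omega R.
Variables (H : R) (B : R -> Omega -> R).
Hypothesis H12 : 1 / 2 < H < 1.
Hypothesis B0 : forall w, B 0 w = 0.
Hypothesis Bgauss : forall (m : nat) (ts c : 'I_m -> R), (forall l, 0 <= ts l) ->
  centered_gaussian P (fun w => \sum_(l < m) c l * B (ts l) w)
    (\sum_(l < m) \sum_(l' < m) c l * c l' * fbm_cov H (ts l) (ts l')).

Let H0 : 0 < H. Proof. by case/andP: H12; lra. Qed.
Let H1 : 1 <= 2 * H. Proof. by case/andP: H12; lra. Qed.

Definition icomb (r : seq (R * R * R)) (w : Omega) : R :=
  \sum_(x <- r) x.1.1 * (B x.2 w - B x.1.2 w).

Lemma icomb_cat r r' w : icomb (r ++ r') w = icomb r w + icomb r' w.
Proof. by rewrite /icomb big_cat. Qed.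

Lemma icomb_gaussian r : all igood r -> centered_gaussian P (icomb r) (icov H r r).
Proof.
move=> /allP gr; pose n := size r; pose t i : R * R * R := tnth (in_tuple r) i.
pose ts (l : 'I_(n + n)) : R :=
  match fintype.split l with inl j => (t j).2 | inr j => (t j).1.2 end.
pose c (l : 'I_(n + n)) : R :=
  match fintype.split l with inl j => (t j).1.1 | inr j => - (t j).1.1 end.
have tr j : t j \in r by exact: mem_tnth.
have ts0 l : 0 <= ts l.
  rewrite /ts; case: (fintype.split l) => j; have /andP[_ /andP[h1 h2]] := gr _ (tr j) => //.
  exact: le_trans h2.
have := Bgauss c ts0; congr (centered_gaussian _ _ _).
  apply/funext => w; rewrite big_split_ord/= /icomb [RHS]big_tnth -big_split/=.
  apply: eq_bigr => j _.
  rewrite /c /ts !(unsplitK (inl _)) !(unsplitK (inr _)).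
  by rewrite /t; ring.
rewrite big_split_ord/= /icov [RHS]big_tnth -big_split/=; apply: eq_bigr => i _.
rewrite !big_split_ord/= [in RHS]big_tnth -!big_split/=; apply: eq_bigr => j _.
rewrite /c /ts !(unsplitK (inl _)) !(unsplitK (inr _)) -icov4E /t.
by ring.
Qed.

Lemma icomb_sqr r : all igood r ->
  (\int[P]_w ((icomb r w) ^+ 2)%:E = (icov H r r * gauss_m2)%:E)%E.
Proof.
move=> gr; apply: centered_gaussian_sqr; first exact: icov_ge0.
exact: icomb_gaussian.
Qed.

Lemma icomb_L2le r : all igood r ->
  L2le P (icomb r) (Num.sqrt (icov H r r * gauss_m2)).
Proof.
move=> gr; have v0 : 0 <= icov H r r * gauss_m2.
  by rewrite mulr_ge0 ?icov_ge0// ltW// gauss_m2_gt0.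
split; first by case: (icomb_gaussian gr).
  exact: sqrtr_ge0.
by rewrite icomb_sqr// sqr_sqrtr.
Qed.

Lemma icomb_L2 r : all igood r -> L2 P (icomb r).
Proof. by move=> gr; eexists; exact: icomb_L2le gr. Qed.

Lemma ip_icomb r r' : all igood r -> all igood r' ->
  ip P (icomb r) (icomb r') = icov H r r' * gauss_m2.
Proof.
move=> gr gr'.
have sq s : all igood s -> ip P (icomb s) (icomb s) = icov H s s * gauss_m2.
  by move=> gs; apply/EFin_inj; rewrite -ip_sqrE ?icomb_sqr//; exact: icomb_L2.
have := sq (r ++ r'); rewrite all_cat gr gr' => /(_ isT).
rewrite (_ : icomb (r ++ r') = fun w => icomb r w + icomb r' w); last first.
  by apply/funext => w; rewrite icomb_cat.
have L := icomb_L2 gr; have L' := icomb_L2 gr'.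
rewrite ipDl ?ipDr//; [|exact: L2D].
rewrite (sq _ gr) (sq _ gr') (ipC P (icomb r') (icomb r)).
rewrite icov_catl !icov_catr (icovC H r' r); lra.
Qed.

Lemma fbm_incr_L2le a b : 0 <= a <= b ->
  L2le P (fun w => B b w - B a w) (Num.sqrt gauss_m2 * (b - a) `^ H).
Proof.
move=> /andP[a0 ab].
have g : all igood [:: (1, a, b)] by rewrite /= /igood/= ler01 a0 ab.
have := icomb_L2le g; rewrite /icov !big_seq1/= !mul1r icov4_diag//.
rewrite mulrC sqrtrM ?(ltW gauss_m2_gt0)// mulrC (_ : Num.sqrt ((b - a) `^ (2 * H)) = (b - a) `^ H).
  rewrite mulrC; congr (L2le _ _ _); apply/funext => w.
  by rewrite /icomb big_seq1/= mul1r.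
by rewrite -powR12_sqrt ?powR_ge0// -powRrM; congr (_ `^ _); field.
Qed.

Lemma fbm_L2 a : 0 <= a -> L2 P (B a).
Proof.
move=> a0; have := @fbm_incr_L2le 0 a; rewrite lexx a0 => /(_ isT) h; eexists.
by move: h; congr (L2le _ _ _); apply/funext => w; rewrite B0 subr0.
Qed.

Section grid.
Variable eta : R.
Hypothesis eta0 : 0 <= eta.

Definition dB (j : nat) (w : Omega) : R := B (j.+1%:R * eta) w - B (j%:R * eta) w.

Lemma dB_L2 j : L2 P (dB j).
Proof. by apply: L2B; apply: fbm_L2; rewrite mulr_ge0. Qed.

Lemma abel_identity (g p : nat -> R) m :
  \sum_(i < m) g i * (p i.+1 - p i) =
  g m * p m - g 0%N * p 0%N + \sum_(i < m) (g i - g i.+1) * p i.+1.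
Proof.
elim: m => [|m IH]; first by rewrite !big_ord0; ring.
by rewrite !big_ord_recr/= IH; ring.
Qed.

(* Summation by parts turns the sum into a nonnegative combination of the
   increments [B (a eta) - B ((a - p) eta)], whose norms are explicit. *)
Lemma grid_sum_L2le (g : nat -> R) (a m : nat) : (m <= a)%N ->
  (forall i, 0 <= g i) -> (forall i, g i.+1 <= g i) ->
  L2le P (fun w => \sum_(i < m) g i * dB (a - i.+1) w)
    (Num.sqrt gauss_m2 * eta `^ H * \sum_(i < m) g i * (i.+1%:R `^ H - i%:R `^ H)).
Proof.
move=> ma g0 gd; pose p i w := B (a%:R * eta) w - B ((a - i)%:R * eta) w.
pose s := Num.sqrt (@gauss_m2 R).
have s0 : 0 <= s by exact: sqrtr_ge0.
have hp i : (i <= a)%N -> L2le P (p i) (s * eta `^ H * i%:R `^ H).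
  move=> ia; have := @fbm_incr_L2le ((a - i)%:R * eta) (a%:R * eta).
  rewrite (_ : a%:R * eta - (a - i)%:R * eta = i%:R * eta); last first.
    by rewrite natrB//; ring.
  rewrite powRM// -mulrA [i%:R `^ H * _]mulrC; apply.
  by rewrite mulr_ge0// ler_wpM2r// ler_nat leq_subr.
rewrite (abel_identity g (fun i => i%:R `^ H)) powR0 ?gt_eqF// mulr0 subr0.
have -> : (fun w => \sum_(i < m) g i * dB (a - i.+1) w) =
    fun w => g m * p m w + \sum_(i < m) (g i - g i.+1) * p i.+1 w.
  apply/funext => w; have := abel_identity g (p ^~ w) m.
  rewrite [p 0%N w](_ : _ = 0) ?mulr0 ?subr0; last by rewrite /p subn0 subrr.
  move=> <-; apply: eq_bigr => i _; congr (_ * _); rewrite /p /dB.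
  rewrite -[(a - i.+1).+1]subSn ?subSS; first by ring.
  exact: leq_trans ma.
rewrite mulrDr mulr_sumr; apply: L2leD.
  have := L2leZ (g m) (hp _ ma); rewrite ger0_norm//.
  by congr (L2le _ _ _); rewrite /s; ring.
apply: L2le_sum => i _; have := L2leZ (g i - g i.+1) (hp i.+1 (leq_trans (ltn_ord i) ma)).
by rewrite ger0_norm ?subr_ge0//; congr (L2le _ _ _); rewrite /s; ring.
Qed.

End grid.

End fbm_moments.

Section fractional_noise.
Context {R : realType} {d0 : measure_display} {Omega : measurableType d0}.
Variable P : probability Omega R.
Variables (H alpha kap T : R) (B G : R -> Omega -> R).
Hypothesis H12 : 1 / 2 < H < 1.
Hypothesis a01 : 0 < alpha < 1.
Hypothesis kap0 : 0 <= kap.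
Hypothesis T0 : 0 < T.
Hypothesis B0 : forall w, B 0 w = 0.
Hypothesis Bgauss : forall (m : nat) (ts c : 'I_m -> R), (forall l, 0 <= ts l) ->
  centered_gaussian P (fun w => \sum_(l < m) c l * B (ts l) w)
    (\sum_(l < m) \sum_(l' < m) c l * c l' * fbm_cov H (ts l) (ts l')).

Definition Gsum (t : R) (n : nat) (w : Omega) : R :=
  kap * \sum_(j < n) (t - t * j%:R / n%:R) `^ (alpha - 1) *
    (B (t * j.+1%:R / n%:R) w - B (t * j%:R / n%:R) w).

Hypothesis mG : forall t, 0 <= t <= T -> measurable_fun setT (G t).
Hypothesis cG : forall t, 0 <= t <= T -> cvgL2 P (Gsum t) (G t).

Let H0 : 0 < H. Proof. by case/andP: H12; lra. Qed.
Let H1 : 1 <= 2 * H. Proof. by case/andP: H12; lra. Qed.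
Let Hle : 0 < H <= 1. Proof. by case/andP: H12; lra. Qed.
Let an1 : alpha - 1 != 0. Proof. by case/andP: a01 => _ h; rewrite lt_eqF// subr_lt0. Qed.

Local Notation theta := (alpha + H - 1).

Definition Xg (N : nat) (eta : R) (w : Omega) : R :=
  kap * \sum_(i < N) (i.+1%:R * eta) `^ (alpha - 1) * dB B eta (N - i.+1) w.

Lemma Xg_L2 N eta : 0 <= eta -> L2 P (Xg N eta).
Proof.
move=> e0; apply: L2Z; apply: L2_sum => i; apply: L2Z.
exact: (dB_L2 H12 B0 Bgauss).
Qed.

Lemma Gsum_Xg (t : R) (N : nat) : (0 < N)%N -> Gsum t N = Xg N (t / N%:R).
Proof.
move=> N0; have NR : N%:R != 0 :> R by rewrite pnatr_eq0 -lt0n.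
apply/funext => w; rewrite /Gsum /Xg; congr (_ * _).
rewrite (reindex_inj rev_ord_inj)/=; apply: eq_bigr => i _.
rewrite /dB; set m := (N - i.+1)%N.
have hm : (m%:R : R) = N%:R - i.+1%:R by rewrite natrB.
congr (_ `^ _ * (B _ w - B _ w)).
- by rewrite hm; field.
- by rewrite mulrAC mulrC.
- by rewrite mulrAC mulrC.
Qed.

Lemma Xg_cvg (n : nat) (u : R) : 0 <= u -> n%:R * u <= T ->
  cvgL2 P (fun k => Xg (n * k.+1) (u / k.+1%:R)) (G (n%:R * u)).
Proof.
move=> u0 nuT e e0; have [n0|n0] := posnP n.
  have := cG (t := 0); rewrite lexx ltW// => /(_ isT e e0)[N _ hN].
  apply: nearW => k; rewrite n0 mul0n mul0r; have := hN N (leqnn _).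
  congr (L2le _ _ _); apply/funext => w; congr (_ - _).
  rewrite /Gsum /Xg big_ord0; congr (_ * _); apply: big1 => j _.
  by rewrite !mul0r subrr powR0// mul0r.
have nuT' : 0 <= n%:R * u <= T by rewrite mulr_ge0.
have [N _ hN] := cG nuT' e0; exists N => // k /= Nk.
have := hN (n * k.+1)%N; rewrite Gsum_Xg ?muln_gt0 ?n0//.
rewrite (_ : n%:R * u / (n * k.+1)%:R = u / k.+1%:R); last first.
  have nR : n%:R != 0 :> R by rewrite pnatr_eq0 -lt0n.
  have : k.+1%:R != 0 :> R by rewrite pnatr_eq0.
  by rewrite natrM; move: (k.+1%:R) => K KR; field; rewrite nR KR.
by apply; rewrite /= (leq_trans Nk)// (leq_trans (leqnSn k))// leq_pmull.
Qed.

Lemma XgB_L2le (M L : nat) (eta : R) : 0 < eta -> 0 < theta < 1 -> (0 < L)%N ->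
  L2le P (fun w => Xg (M + L) eta w - Xg M eta w)
    (kap * (Num.sqrt gauss_m2 * ((L%:R * eta) `^ theta *
        (theta^-1 + (theta^-1 + (1 - theta)^-1))))).
Proof.
move=> e0 ht L0.
pose g1 i : R := i.+1%:R `^ (alpha - 1).
pose g2 i : R := i.+1%:R `^ (alpha - 1) - (i.+1 + L)%:R `^ (alpha - 1).
have a1 : alpha < 1 by case/andP: a01.
have g1d i : g1 i.+1 <= g1 i.
  by apply: ler_powRN; rewrite ?ltr0n ?ler_nat//=; lra.
have g2_0 i : 0 <= g2 i.
  by rewrite /g2 natrD; apply: powR_kernel_diff_ge0; rewrite ?ltr0n ?ler0n.
have g2d i : g2 i.+1 <= g2 i.
  have f (x : R) : 0 < x -> x `^ (alpha - 1) - (x + L%:R) `^ (alpha - 1) =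
      x `^ (alpha - 1) * (1 - (1 + L%:R / x) `^ (alpha - 1)).
    move=> x0; rewrite (powR_scale1 (alpha - 1) x0 (y := x + L%:R)); last first.
      by rewrite addr_ge0// ltW.
    by rewrite mulrDl divff ?gt_eqF//; ring.
  have x0 : 0 < (i.+1%:R : R) by rewrite ltr0n.
  have y0 : 0 < (i.+2%:R : R) by rewrite ltr0n.
  rewrite /g2 !natrD !f//; apply: ler_pM; rewrite ?powR_ge0//.
  - have e1 : 1 `^ (alpha - 1) = 1 :> R by rewrite powR1.
    rewrite subr_ge0 -[leRHS]e1; apply: ler_powRN; last lra.
    by rewrite ltr01 lerDl divr_ge0// ltW.
  - exact: g1d.
  - rewrite lerD2l lerN2; apply: ler_powRN; last lra.
    rewrite ltr_pwDl ?divr_ge0 ?(ltW y0)//= lerD2l ler_wpM2l ?ler0n//.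
    by rewrite lef_pV2 ?posrE// ler_nat.
have sH := @grid_sum_L2le _ _ _ P H B H12 Bgauss eta (ltW e0).
have h1 := sH g1 (M + L)%N L (leq_addl _ _) (fun i => powR_ge0 _ _) g1d.
have h2 := sH g2 M M (leqnn _) g2_0 g2d.
have E : (fun w => Xg (M + L) eta w - Xg M eta w) =
    fun w => kap * eta `^ (alpha - 1) * ((\sum_(i < L) g1 i * dB B eta (M + L - i.+1) w) -
      \sum_(i < M) g2 i * dB B eta (M - i.+1) w).
  apply/funext => w; rewrite /Xg addnC big_split_ord/= -mulrBr -mulrA; congr (_ * _).
  rewrite -addrA mulrBr -sumrB; congr (_ + _).
    rewrite mulr_sumr; apply: eq_bigr => i _.
    by rewrite powRM ?ler0n ?(ltW e0)// /g1; ring.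
  rewrite mulr_sumr -sumrN; apply: eq_bigr => i _.
  rewrite !powRM ?ler0n ?(ltW e0)// /g2.
  have -> : (L + M - (L + i).+1 = M - i.+1)%N by rewrite -addnS subnDl.
  by rewrite [(L + i).+1](_ : _ = i.+1 + L)%N; [ring|rewrite addSn addnC].
rewrite E; have := L2leZ (kap * eta `^ (alpha - 1)) (L2leB h1 h2).
apply: L2le_mono.
rewrite ger0_norm ?mulr_ge0 ?powR_ge0// -mulrDr.
have -> : kap * eta `^ (alpha - 1) * (Num.sqrt gauss_m2 * eta `^ H *
   (\sum_(i < L) g1 i * (i.+1%:R `^ H - i%:R `^ H) +
    \sum_(i < M) g2 i * (i.+1%:R `^ H - i%:R `^ H))) =
  kap * (Num.sqrt gauss_m2 * ((eta `^ (alpha - 1) * eta `^ H) *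
   (\sum_(i < L) g1 i * (i.+1%:R `^ H - i%:R `^ H) +
    \sum_(i < M) g2 i * (i.+1%:R `^ H - i%:R `^ H)))) by ring.
apply: ler_wpM2l => //; apply: ler_wpM2l; first exact: sqrtr_ge0.
rewrite -powR_split// (_ : alpha - 1 + H = theta); last by ring.
rewrite powRM ?ler0n ?(ltW e0)// [L%:R `^ _ * _]mulrC -mulrA ler_wpM2l ?powR_ge0//.
rewrite mulrDr; apply: lerD.
  by apply: sum_powR_weight => //; case/andP: ht => -> /ltW.
have -> : 1 - theta = 2 - alpha - H by ring.
exact: sum_powR_diff_weight.
Qed.

Definition CG : R := kap * (Num.sqrt gauss_m2 * (theta^-1 + (theta^-1 + (1 - theta)^-1))).

Lemma CG_ge0 : 0 < theta < 1 -> 0 <= CG.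
Proof.
move=> /andP[t0 t1]; rewrite mulr_ge0// mulr_ge0 ?sqrtr_ge0//.
by rewrite !addr_ge0// invr_ge0; lra.
Qed.

Lemma G_holder_grid (n m : nat) (u : R) : 0 < theta < 1 -> 0 < u -> (m <= n)%N ->
  n%:R * u <= T ->
  L2le P (fun w => G (n%:R * u) w - G (m%:R * u) w) (CG * (n%:R * u - m%:R * u) `^ theta).
Proof.
move=> ht u0 mn nT.
have mT : m%:R * u <= T by apply: le_trans nT; rewrite ler_pM2r// ler_nat.
have c0 : 0 <= CG * (n%:R * u - m%:R * u) `^ theta.
  by rewrite mulr_ge0 ?powR_ge0// CG_ge0.
apply: (L2le_cvgL2 _ c0 (cvgL2B (Xg_cvg (ltW u0) nT) (Xg_cvg (ltW u0) mT))).
  by apply: measurable_funB; apply: mG; rewrite mulr_ge0 ?(ltW u0).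
move=> k; have k0 : 0 < u / k.+1%:R by rewrite divr_gt0// ltr0n.
move: mn; rewrite leq_eqVlt => /predU1P[->|mn].
  rewrite subrr powR0 ?mulr0; last by case/andP: ht => h _; rewrite gt_eqF.
  by under eq_fun do rewrite subrr; exact: L2le0.
have L0 : (0 < (n - m) * k.+1)%N by rewrite muln_gt0 subn_gt0 mn.
have := @XgB_L2le (m * k.+1) _ _ k0 ht L0.
rewrite -mulnDl subnKC ?(ltnW mn)//.
have -> : ((n - m) * k.+1)%:R * (u / k.+1%:R) = n%:R * u - m%:R * u.
  have : k.+1%:R != 0 :> R by rewrite pnatr_eq0.
  rewrite natrM natrB ?(ltnW mn)//; move: (k.+1%:R) => K KR; by field.
by congr (L2le _ _ _); rewrite /CG; ring.
Qed.

Definition rX (N : nat) (eta : R) : seq (R * R * R) :=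
  [seq ((i.+1%:R * eta) `^ (alpha - 1), (N - i.+1)%:R * eta, (N - i.+1).+1%:R * eta)
     | i : 'I_N <- index_enum 'I_N].

Lemma rX_good N eta : 0 <= eta -> all igood (rX N eta).
Proof.
move=> e0; apply/allP => _ /mapP[i _ ->]; rewrite /igood/= powR_ge0/= mulr_ge0//=.
by rewrite ler_wpM2r// ler_nat.
Qed.

Lemma Xg_icomb N eta w : Xg N eta w = kap * icomb B (rX N eta) w.
Proof. by rewrite /Xg /icomb big_map. Qed.

Lemma icov4_scale (c a b a' b' : R) : 0 <= c ->
  icov4 H (c * a) (c * b) (c * a') (c * b') = c `^ (2 * H) * icov4 H a b a' b'.
Proof.
move=> c0; rewrite /icov4 -!mulrBr !normrM (ger0_norm c0) !powRM//.
by ring.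
Qed.

Lemma icov_rX_scale N eta : 0 < eta ->
  icov H (rX N eta) (rX N eta) = eta `^ (2 * theta) * icov H (rX N 1) (rX N 1).
Proof.
move=> e0; rewrite /icov !big_map mulr_sumr; apply: eq_bigr => i _.
rewrite !big_map mulr_sumr; apply: eq_bigr => j _ /=.
rewrite !mulr1 !(mulrC _ eta) icov4_scale ?(ltW e0)// !powRM ?(ltW e0)//.
have -> : 2 * theta = (alpha - 1) + (alpha - 1) + 2 * H by ring.
by rewrite !powR_split//; ring.
Qed.

Lemma icov_rX_ge1 N : (0 < N)%N -> 1 <= icov H (rX N 1) (rX N 1).
Proof.
case: N => // N _; rewrite /icov big_map (bigD1 ord0)//=.
rewrite -[leLHS]addr0; apply: lerD.
  rewrite big_map (bigD1 ord0)//= -[leLHS]addr0; apply: lerD.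
    rewrite !mulr1 powR1 !mul1r subSS subn0 icov4_diag ?ler_nat//.
    rewrite (_ : N.+1%:R - N%:R = 1); last by rewrite -natr1; ring.
    by rewrite powR1.
  apply: sumr_ge0 => j _; rewrite !mulr1.
  apply: mulr_ge0; first by rewrite mulr_ge0 ?powR_ge0.
  by apply: icov4_ge0; rewrite // ler_nat.
apply: sumr_ge0 => i _; rewrite big_map; apply: sumr_ge0 => j _ /=.
rewrite !mulr1.
  apply: mulr_ge0; first by rewrite mulr_ge0 ?powR_ge0.
by apply: icov4_ge0; rewrite // ler_nat.
Qed.

Lemma ip_Gsum t N : 0 < t -> (0 < N)%N -> ip P (Gsum t N) (Gsum t N) =
  kap ^+ 2 * ((t / N%:R) `^ (2 * theta) * icov H (rX N 1) (rX N 1)) * gauss_m2.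
Proof.
move=> t0 N0; have e0 : 0 < t / N%:R by rewrite divr_gt0// ltr0n.
have g := rX_good N (ltW e0); have L := icomb_L2 H12 Bgauss g.
rewrite Gsum_Xg// (_ : Xg N (t / N%:R) = fun w => kap * icomb B (rX N (t / N%:R)) w); last first.
  by apply/funext => w; exact: Xg_icomb.
rewrite ipZl//; last exact: L2Z.
rewrite ipC ipZl// (ip_icomb H12 Bgauss)// icov_rX_scale//; ring.
Qed.

Lemma Gsum_L2 t N : 0 <= t -> (0 < N)%N -> L2 P (Gsum t N).
Proof. by move=> t0 N0; rewrite Gsum_Xg//; apply: Xg_L2; rewrite divr_ge0. Qed.

Lemma Gsum_bounded t : 0 <= t <= T -> exists c N, forall n, (N <= n)%N -> (0 < n)%N ->
  L2le P (Gsum t n) c.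
Proof.
move=> tT; have [N _ hN] := cG tT ltr01; have t0 : 0 <= t by case/andP: tT.
have [c hc] := Gsum_L2 t0 (ltn0Sn N).
exists (c + 1 + 1), N => n Nn n0; have h1 := hN _ Nn; have h2 := hN _ (leqnSn N).
have := L2leB (L2leD hc h2) h1.
by congr (L2le _ _ _); apply/funext => w; ring.
Qed.

Lemma theta_ge0 : 0 < kap -> 0 <= theta.
Proof.
move=> k0; rewrite leNgt; apply/negP => th0.
have [|c [N hN]] := @Gsum_bounded T; first by rewrite ltW//=.
pose K := kap ^+ 2 * T `^ (2 * theta) * gauss_m2.
have K0 : 0 < K by rewrite !mulr_gt0 ?powR_gt0 ?gauss_m2_gt0 ?exprn_gt0.
have q0 : 0 < - (2 * theta) by lra.
have bnd n : (N <= n)%N -> (0 < n)%N -> K * n%:R `^ (- (2 * theta)) <= c ^+ 2.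
  move=> Nn n0; apply: le_trans (ip_sqr_le (hN _ Nn n0)); rewrite ip_Gsum//.
  have nR : 0 < (n%:R : R) by rewrite ltr0n.
  rewrite powRM ?invr_ge0 ?ler0n ?(ltW T0)// -[n%:R^-1]powR_inv1 ?ler0n// -powRrM.
  rewrite mulN1r (_ : K * _ = kap ^+ 2 * (T `^ (2 * theta) * n%:R `^ (- (2 * theta)) * 1) * gauss_m2); last by rewrite /K; ring.
  have m20 : 0 <= @gauss_m2 R by rewrite ltW// gauss_m2_gt0.
  rewrite ler_wpM2r// ler_wpM2l ?sqr_ge0// ler_wpM2l ?icov_rX_ge1//.
  by rewrite mulr_ge0 ?powR_ge0.
pose z := ((c ^+ 2 + K) / K) `^ (- (2 * theta))^-1.
pose n := (maxn N (Num.bound z)).+1.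
have zn : z <= n%:R.
  apply: le_trans (ltW (archi_boundP _)) _; first exact: powR_ge0.
  by rewrite ler_nat /n (leq_trans (leq_maxr N _))// leqnSn.
have cK : 0 <= (c ^+ 2 + K) / K by rewrite divr_ge0 ?addr_ge0 ?sqr_ge0 ?(ltW K0).
have := bnd n; rewrite /n leqW ?leq_maxl// => /(_ isT isT); apply/negP; rewrite -ltNge.
apply: (@lt_le_trans _ _ (K * z `^ (- (2 * theta)))).
  rewrite /z -powRrM mulVf ?gt_eqF// powRr1// mulrCA divff ?gt_eqF//; lra.
by rewrite ler_wpM2l ?(ltW K0)// ge0_ler_powR ?nnegrE ?powR_ge0 ?(ltW q0).
Qed.

Lemma G_bounded_theta0 : theta = 0 -> exists c, 0 <= c /\
  forall t, 0 <= t <= T -> L2le P (G t) c.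
Proof.
move=> th0; have [|c [N hN]] := @Gsum_bounded T; first by rewrite ltW//=.
have hc := hN _ (leqnSn N) (ltn0Sn N); have c0 := L2le_ge0 hc.
exists c; split => // t tT; have := cG tT.
have bnd n : (N <= n)%N -> (0 < n)%N -> L2le P (Gsum t n) c.
  move=> Nn n0; have [t0|tn0] := eqVneq t 0.
    apply: (L2le_mono c0); rewrite (_ : Gsum t n = fun=> 0); first exact: L2le0.
    apply/funext => w; rewrite /Gsum t0 big1 ?mulr0// => j _.
    by rewrite !mul0r subrr powR0// mul0r.
  have t0 : 0 < t by case/andP: tT => h _; rewrite lt_neqAle eq_sym tn0.
  have [m0 _ i0] := hN _ Nn n0; have L := Gsum_L2 (ltW t0) n0.
  split => //; first by case: L => ? [].
  have LT := Gsum_L2 (ltW T0) n0.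
  rewrite ip_sqrE// ip_Gsum// th0 mulr0 powRr0 in i0.
  by rewrite ip_sqrE// ip_Gsum// th0 mulr0 powRr0.
move=> cv; apply: (L2le_cvg (mG tT) c0) => e /cv[N' _ hN'].
exists (Gsum t (maxn N N').+1); split.
  by apply: bnd => //; rewrite leqW// leq_maxl.
by apply: hN'; rewrite /= leqW// leq_maxr.
Qed.

End fractional_noise.

(** * Negative correlation of the noise increments *)

Section kernel_difference.
Context {R : realType}.
Variables (a h : R).
Hypothesis a01 : 0 < a < 1.
Hypothesis h0 : 0 <= h.
Implicit Types x y : R.

Definition kdiff (x : R) : R := x `^ (a - 1) - (x + h) `^ (a - 1).

Let v (x : R) : R := 1 - (x / (x + h)) `^ (1 - a).

Local Ltac slra := move: (a01) (h0) => /andP[? ?] ?; lra.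

Let kdiffE x : 0 < x -> kdiff x = x `^ (a - 1) * v x.
Proof.
move=> x0; have xh : 0 < x + h by slra.
rewrite /kdiff (powR_scale1 (a - 1) x0 (ltW xh)) /v mulrBr mulr1; congr (_ - _ * _).
rewrite -[x / (x + h)]invf_div -[((x + h) / x)^-1]powR_inv1 ?divr_ge0 ?(ltW x0) ?(ltW xh)//.
by rewrite -powRrM; congr (_ `^ _); ring.
Qed.

Let v_ge0 x : 0 < x -> 0 <= v x.
Proof.
move=> x0; have xh : 0 < x + h by slra.
have e1 : 1 `^ (1 - a) = 1 :> R by rewrite powR1.
rewrite /v subr_ge0 -[leRHS]e1 ge0_ler_powR ?nnegrE ?divr_ge0 ?(ltW x0) ?(ltW xh)//.
  by slra.
by rewrite ler_pdivrMr// mul1r lerDl.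
Qed.

Let v_noninc x y : 0 < x <= y -> v y <= v x.
Proof.
move=> /andP[x0 xy]; have y0 := lt_le_trans x0 xy.
have xh : 0 < x + h by slra. have yh : 0 < y + h by slra.
rewrite /v lerD2l lerN2 ge0_ler_powR ?nnegrE ?divr_ge0 ?(ltW x0) ?(ltW xh) ?(ltW y0) ?(ltW yh)//.
  by slra.
rewrite ler_pdivrMr// mulrAC ler_pdivlMr// !mulrDr [x * y]mulrC lerD2l.
by rewrite ler_wpM2r.
Qed.

Let v_convex x : 0 < x -> 2 * v (x + 1) <= v x + v (x + 2).
Proof.
move=> x0; pose z y : R := y / (y + h).
have z0 y : 0 < y -> 0 < z y by move=> y0; rewrite divr_gt0//; slra.
have x1 : 0 < x + 1 by slra. have x2 : 0 < x + 2 by slra.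
have hq : 0 < 1 - a <= 1 by slra.
have t y : 0 < y -> z y `^ (1 - a) <=
    z (x + 1) `^ (1 - a) * (1 + (1 - a) * (z y / z (x + 1) - 1)).
  move=> y0; rewrite (powR_scale1 (1 - a) (z0 _ x1) (ltW (z0 _ y0))).
  rewrite ler_wpM2l ?powR_ge0//; apply: powR_le_affine => //.
  by rewrite divr_ge0// ltW// z0.
have zc : z x + z (x + 2) <= 2 * z (x + 1).
  have s0 : 0 < x + h by slra. have s1 : 0 < x + 1 + h by slra.
  have s2 : 0 < x + 2 + h by slra.
  rewrite -subr_ge0 /z (_ : _ - _ = 2 * h / ((x + h) * ((x + 1 + h) * (x + 2 + h)))).
    by rewrite !mulr_ge0// invr_ge0 !mulr_ge0// ltW.
  by field; rewrite !gt_eqF.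
have := lerD (t _ x0) (t _ x2); rewrite -mulrDr.
set Z := z (x + 1) `^ (1 - a) => hh.
have Z0 : 0 <= Z by exact: powR_ge0.
have : Z * (1 + (1 - a) * (z x / z (x + 1) - 1) + (1 + (1 - a) * (z (x + 2) / z (x + 1) - 1))) <= Z * 2.
  apply: ler_wpM2l => //.
  have -> : 1 + (1 - a) * (z x / z (x + 1) - 1) + (1 + (1 - a) * (z (x + 2) / z (x + 1) - 1))
    = 2 + (1 - a) * ((z x + z (x + 2)) / z (x + 1) - 2) by ring.
  rewrite gerDl; apply: mulr_ge0_le0; first by slra.
  by rewrite subr_le0 ler_pdivrMr// z0.
move=> h2; rewrite /v -/(z x) -/(z (x + 2)) -/(z (x + 1)) -/Z; slra.
Qed.

Let u_noninc x y : 0 < x <= y -> y `^ (a - 1) <= x `^ (a - 1).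
Proof. by move=> xy; apply: ler_powRN => //; slra. Qed.

Let u_convex x : 0 < x -> 2 * (x + 1) `^ (a - 1) <= x `^ (a - 1) + (x + 2) `^ (a - 1).
Proof.
move=> x0; have x1 : 0 < x + 1 by slra. have x2 : 0 < x + 2 by slra.
have q0 : 0 <= 1 - a by slra.
have t y : 0 < y -> (x + 1) `^ (a - 1) * (1 - (1 - a) * (y / (x + 1) - 1)) <= y `^ (a - 1).
  move=> y0; rewrite (powR_scale1 (a - 1) x1 (ltW y0)) ler_wpM2l ?powR_ge0//.
  by rewrite (_ : a - 1 = - (1 - a)); [apply: powRN_ge_affine => //; exact: divr_gt0|ring].
have := lerD (t _ x0) (t _ x2); apply: le_trans; rewrite -mulrDr.
rewrite le_eqVlt; apply/orP; left; apply/eqP; field; by rewrite gt_eqF.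
Qed.

Lemma kdiff_ge0 x : 0 < x -> 0 <= kdiff x.
Proof. by move=> x0; rewrite kdiffE// mulr_ge0 ?powR_ge0 ?v_ge0. Qed.

Lemma kdiff_noninc x y : 0 < x <= y -> kdiff y <= kdiff x.
Proof.
move=> /[dup] xy /andP[x0 xy']; have y0 := lt_le_trans x0 xy'.
by rewrite !kdiffE//; apply: ler_pM; rewrite ?powR_ge0 ?v_ge0 ?u_noninc ?v_noninc.
Qed.

Lemma kdiff_convex x : 0 < x -> 2 * kdiff (x + 1) <= kdiff x + kdiff (x + 2).
Proof.
move=> x0; have x1 : 0 < x + 1 by slra. have x2 : 0 < x + 2 by slra.
rewrite !kdiffE//.
have cu := u_convex x0; have cv := v_convex x0.
have mu : (x + 2) `^ (a - 1) <= x `^ (a - 1) by apply: u_noninc; slra.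
have mv : v (x + 2) <= v x by apply: v_noninc; slra.
have p1 : 0 <= (x + 1) `^ (a - 1) by exact: powR_ge0.
have q1 := v_ge0 x1; have q0 := v_ge0 x0; have q2 := v_ge0 x2.
have p0 : 0 <= x `^ (a - 1) by exact: powR_ge0.
have p2 : 0 <= (x + 2) `^ (a - 1) by exact: powR_ge0.
move: (x `^ _) ((x + 1) `^ _) ((x + 2) `^ _) (v x) (v (x + 1)) (v (x + 2))
  cu cv mu mv p1 q1 q0 q2 p0 p2 => U0 U1 U2 V0 V1 V2 cu cv mu mv p1 q1 q0 q2 p0 p2.
have c1 : 0 <= (U0 - U2) * (V0 - V2) by rewrite mulr_ge0// subr_ge0.
have c2 : (2 * U1) * (2 * V1) <= (U0 + U2) * (V0 + V2).
  by apply: ler_pM => //; rewrite mulr_ge0.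
nra.
Qed.

End kernel_difference.

Section discrete_convexity.
Context {R : realType}.
Variables (r rho : nat -> R) (N : nat).
Hypothesis r0 : forall y, (y < N)%N -> 0 <= r y.
Hypothesis rinc : forall y, (y.+1 < N)%N -> r y <= r y.+1.
Hypothesis rcvx : forall y, (y.+2 < N)%N -> r y.+1 - r y <= r y.+2 - r y.+1.
Hypothesis rho0 : forall j, 0 <= rho j.
Hypothesis rhoinc : forall j, rho j <= rho j.+1.

Definition dconv (M : nat) : R := \sum_(j < M) r (M - j.+1)%N * rho j.

Lemma dconvS M : dconv M.+1 - dconv M =
  r 0%N * rho M + \sum_(j < M) (r (M - j)%N - r (M - j.+1)%N) * rho j.
Proof.
rewrite /dconv big_ord_recr/= subnn addrAC addrC; congr (_ + _).
rewrite -sumrB; apply: eq_bigr => j _; rewrite subSS mulrBl//.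
Qed.

Lemma dconv_inc M : (M < N)%N -> 0 <= dconv M.+1 - dconv M.
Proof.
move=> MN; rewrite dconvS addr_ge0 ?mulr_ge0 ?r0 ?(leq_ltn_trans _ MN)//.
apply: sumr_ge0 => j _; rewrite mulr_ge0// subr_ge0.
rewrite -(subnSK (ltn_ord j)); apply: rinc.
by rewrite subnSK// (leq_ltn_trans _ MN)// leq_subr.
Qed.

Lemma dconv_convex M : (M.+1 < N)%N ->
  dconv M.+1 - dconv M <= dconv M.+2 - dconv M.+1.
Proof.
move=> MN; rewrite !dconvS big_ord_recr/= subSnn subnn addrA addrAC.
have N0 : (0 < N)%N by exact: leq_ltn_trans MN.
apply: lerD.
  rewrite -[leLHS]addr0; apply: lerD; first by rewrite ler_wpM2l// r0.
  by rewrite mulr_ge0// subr_ge0 rinc// (leq_ltn_trans _ MN).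
apply: ler_sum => j _; rewrite ler_wpM2r// subSS subSn ?(ltnW (ltn_ord j))//.
rewrite -(subnSK (ltn_ord j)); apply: rcvx.
by rewrite subnSK// -subSn ?(leq_ltn_trans _ MN)// ?leq_subr// ltnW.
Qed.

End discrete_convexity.

Section power_increments.
Context {R : realType}.
Variable p : R.
Hypothesis p12 : 1 <= p <= 2.

Definition pinc (j : nat) : R := j.+1%:R `^ p - j%:R `^ p.

Lemma pinc_ge0 j : 0 <= pinc j.
Proof.
have p0 : 0 <= p by case/andP: p12; lra.
by rewrite subr_ge0 ge0_ler_powR ?nnegrE ?ler_nat.
Qed.

Lemma pinc_nondec j : pinc j <= pinc j.+1.
Proof.
rewrite /pinc lerBlDr addrAC lerBrDr.
have -> : j.+1%:R `^ p = `|(j.+1%:R : R)| `^ p by rewrite ger0_norm.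
have -> : j.+2%:R `^ p = `|(j.+2%:R : R)| `^ p by rewrite ger0_norm.
have -> : j%:R `^ p = `|(j%:R : R)| `^ p by rewrite ger0_norm.
apply: abs_powR_majorize.
- by case/andP: p12.
- by rewrite -!natr1; ring.
- by rewrite !ler_nat leqnSn leqW.
Qed.

Lemma cvg_pinc : (fun j => j.+1%:R `^ (1 - p) * pinc j) @ \oo --> p.
Proof.
have /andP[p1 p2] := p12.
have bnd j : p * (1 - j.+1%:R^-1) <= j.+1%:R `^ (1 - p) * pinc j <= p.
  have y0 : 0 < (j.+1%:R : R) by rewrite ltr0n.
  have xE : (j%:R : R) / j.+1%:R = 1 - j.+1%:R^-1.
    have -> : (j%:R : R) = j.+1%:R - 1 by rewrite -natr1; ring.
    by rewrite mulrBl divff ?gt_eqF// mul1r.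
  have e : j.+1%:R `^ (1 - p) * pinc j = j.+1%:R * (1 - (j%:R / j.+1%:R) `^ p).
    rewrite /pinc (powR_scale1 p y0 (ler0n R j)) powR_split// powRr1// powRN.
    by field; rewrite gt_eqF// powR_gt0.
  have x0 : 0 <= (j%:R : R) / j.+1%:R by rewrite divr_ge0.
  rewrite e; apply/andP; split; last first.
    have := powR_ge_affine x0 p1.
    have -> : (j%:R : R) / j.+1%:R - 1 = - j.+1%:R^-1 by rewrite xE; ring.
    move=> h.
    have : j.+1%:R * (1 - (j%:R / j.+1%:R) `^ p) <= j.+1%:R * (p * j.+1%:R^-1).
      apply: ler_wpM2l => //; rewrite lerBlDr addrC -lerBlDr.
      by rewrite mulrN in h.
    by rewrite mulrCA divff ?gt_eqF// mulr1.
  (* tangent of [x^p] at [x = j / (j + 1)], evaluated at [1] *)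
  have h : (j%:R / j.+1%:R) * p <= j.+1%:R * (1 - (j%:R / j.+1%:R : R) `^ p).
    have [s0|j0] := posnP j.
      by rewrite s0 !mul0r mulr_ge0// powR0 ?subr0// gt_eqF; lra.
    have x1 : 0 < (j%:R : R) / j.+1%:R by rewrite divr_gt0 ?ltr0n.
    have := @powR_ge_affine R (1 / (j%:R / j.+1%:R)) p.
    have := @powR_scale1 R (j%:R / j.+1%:R) 1 p x1 ler01; rewrite powR1 => E.
    set x := j%:R / j.+1%:R in x0 x1 xE E *; set Z := (1 / x) `^ p in E *.
    move=> /(_ _ p1)/wrap[]; first by rewrite divr_ge0.
    move=> hZ; have xp : 0 < x `^ p by exact: powR_gt0.
    have : x `^ p * (1 + p * (1 / x - 1)) <= 1 by rewrite [leRHS]E ler_pM2l.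
    have -> : 1 + p * (1 / x - 1) = 1 + p * (1 - x) / x by field; rewrite gt_eqF.
    have nx : j.+1%:R = (1 - x)^-1 :> R.
      by rewrite xE opprB addrC subrK invrK.
    have x1' : 0 < 1 - x by rewrite -invr_gt0 -nx.
    move=> hh; rewrite nx [leRHS]mulrC ler_pdivlMr//.
    have xx : x `^ 2 <= x `^ p.
      apply: ger_powR => //; rewrite x1/=; lra.
    rewrite -[2]/(2%:R) powR_mulrn// expr2 in xx.
    have : x * p * (1 - x) <= x `^ p * (p * (1 - x) / x).
      rewrite mulrA ler_pdivlMr// (_ : x * p * (1 - x) * x = x * x * (p * (1 - x))); last by ring.
      by rewrite ler_wpM2r// mulr_ge0//; lra.
    by rewrite mulrDr mulr1 in hh; lra.
  by rewrite mulrC -xE.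
apply: (@squeeze_cvgr _ _ _ _ (fun j => p * (1 - j.+1%:R^-1)) (fun=> p)).
- exact: nearW.
- rewrite -[X in _ --> X]mulr1 -[X in _ * X]subr0.
  apply: cvgM; first exact: cvg_cst.
  apply: cvgB; [exact: cvg_cst|exact: cvg_harmonic].
- exact: cvg_cst.
Qed.

End power_increments.

Lemma seq_cvg_ge0 (R : realType) (u : nat -> R) (l : R) :
  (forall n, 0 <= u n) -> u @ \oo --> l -> 0 <= l.
Proof.
move=> u0 ul; rewrite -(cvg_lim _ ul)//; apply: limr_ge; last exact: nearW.
by apply/cvg_ex; exists l.
Qed.

Lemma seq_cvgB (R : realType) (u v : nat -> R) (a b : R) :
  u @ \oo --> a -> v @ \oo --> b -> (fun n => u n - v n) @ \oo --> a - b.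
Proof. by move=> ? ?; exact: cvgB. Qed.

Section negative_correlation.
Context {R : realType} {d0 : measure_display} {Omega : measurableType d0}.
Variable P : probability Omega R.
Variables (H alpha kap T : R) (B G : R -> Omega -> R).
Hypothesis H12 : 1 / 2 < H < 1.
Hypothesis aE : alpha = 2 - 2 * H.
Hypothesis kap0 : 0 <= kap.
Hypothesis T0 : 0 < T.
Hypothesis B0 : forall w, B 0 w = 0.
Hypothesis Bgauss : forall (m : nat) (ts c : 'I_m -> R), (forall l, 0 <= ts l) ->
  centered_gaussian P (fun w => \sum_(l < m) c l * B (ts l) w)
    (\sum_(l < m) \sum_(l' < m) c l * c l' * fbm_cov H (ts l) (ts l')).
Hypothesis mG : forall t, 0 <= t <= T -> measurable_fun setT (G t).
Hypothesis cG : forall t, 0 <= t <= T -> cvgL2 P (Gsum alpha kap B t) (G t).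

Let a01 : 0 < alpha < 1. Proof. by rewrite aE; case/andP: H12; lra. Qed.
Let p12 : 1 <= 2 * H <= 2. Proof. by case/andP: H12; lra. Qed.
Let H0 : 0 < H. Proof. by case/andP: H12; lra. Qed.

Local Notation X := (Xg alpha kap B).
Local Notation rho := (pinc (2 * H)).
Local Notation m2 := (@gauss_m2 R).

Definition Asum (N : nat) : R := \sum_(i < N) i.+1%:R `^ (alpha - 1) * rho (N - i.+1)%N.

Definition Esum (Q M : nat) : R := \sum_(j < M) (Q + j.+1)%:R `^ (alpha - 1) * rho j.

Lemma icov4_grid (eta : R) (k M : nat) : 0 <= eta ->
  icov4 H (k%:R * eta) (k.+1%:R * eta) 0 (M%:R * eta) =
  eta `^ (2 * H) / 2 * (rho k + (`|k%:R - M%:R| `^ (2 * H) - `|k.+1%:R - M%:R| `^ (2 * H))).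
Proof.
move=> e0; rewrite /icov4 /pinc !subr0 -!mulrBl !normrM (ger0_norm e0) !powRM//.
by rewrite !normr_nat; field.
Qed.

Lemma ip_X_B (Q M : nat) (eta : R) : 0 < eta ->
  ip P (X (Q + M) eta) (B (M%:R * eta)) =
  m2 * kap * (eta / 2) * (Asum (Q + M) - Asum Q + Esum Q M).
Proof.
move=> e0; pose r' : seq (R * R * R) := [:: (1, 0, M%:R * eta)].
have g' : all igood r' by rewrite /= /igood/= ler01 lexx mulr_ge0// ltW.
have g := rX_good alpha (Q + M) (ltW e0).
have -> : B (M%:R * eta) = icomb B r'.
  by apply/funext => w; rewrite /icomb big_seq1/= mul1r B0 subr0.
rewrite (_ : X (Q + M) eta = fun w => kap * icomb B (rX alpha (Q + M) eta) w); last first.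
  by apply/funext => w; exact: Xg_icomb.
rewrite ipZl; [|exact: (icomb_L2 H12 Bgauss)|exact: (icomb_L2 H12 Bgauss)].
rewrite (ip_icomb H12 Bgauss)// /icov big_map.
have e1 : eta `^ (alpha - 1) * eta `^ (2 * H) = eta.
  by rewrite -powR_split// (_ : alpha - 1 + 2 * H = 1) ?powRr1 ?(ltW e0)// aE; ring.
under eq_bigr => i _.
  rewrite big_seq1/= mulr1 icov4_grid ?(ltW e0)// powRM ?(ltW e0)//.
  rewrite (_ : _ * _ * _ = (eta `^ (alpha - 1) * eta `^ (2 * H)) / 2 *
    (i.+1%:R `^ (alpha - 1) * (rho (Q + M - i.+1)%N +
      (`|(Q + M - i.+1)%:R - M%:R| `^ (2 * H) - `|(Q + M - i.+1).+1%:R - M%:R| `^ (2 * H))))); last by ring.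
  rewrite e1.
  over.
rewrite -mulr_sumr.
suff -> : \sum_(i < Q + M) (i.+1%:R `^ (alpha - 1) * (rho (Q + M - i.+1)%N +
      (`|(Q + M - i.+1)%:R - M%:R| `^ (2 * H) - `|(Q + M - i.+1).+1%:R - M%:R| `^ (2 * H))))
   = Asum (Q + M) - Asum Q + Esum Q M by ring.
under eq_bigr do rewrite mulrDr.
rewrite big_split/= -/(Asum _) -addrA; congr (_ + _).
rewrite big_split_ord/=; congr (_ + _).
  rewrite /Asum -sumrN; apply: eq_bigr => i _; rewrite -mulrN; congr (_ * _).
  rewrite /pinc opprB.
  have e : (Q + M - i.+1 = M + (Q - i.+1))%N by rewrite [(Q + M)%N]addnC addnBA.
  have -> : (Q + M - i.+1)%:R - M%:R = (Q - i.+1)%:R :> R by rewrite e natrD; ring.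
  have -> : (Q + M - i.+1).+1%:R - M%:R = (Q - i.+1).+1%:R :> R.
    by rewrite e -!natr1 natrD; ring.
  by rewrite !ger0_norm.
apply: eq_bigr => j _; rewrite -addnS; congr (_ * _); rewrite /pinc subnDl.
have -> : (M - j.+1)%:R - M%:R = - j.+1%:R :> R by rewrite natrB//; ring.
have -> : (M - j.+1).+1%:R - M%:R = - j%:R :> R.
  by rewrite subnSK// natrB ?(ltnW (ltn_ord j))//; ring.
by rewrite !normrN !ger0_norm.
Qed.

Lemma G_L2 t : 0 <= t <= T -> L2 P (G t).
Proof.
move=> tT; have t0 : 0 <= t by case/andP: tT.
have [N _ hN] := cG tT ltr01; have h := hN N.+1 (leqnSn _).
have [c hc] := @Gsum_L2 _ _ _ P H alpha kap B H12 B0 Bgauss t N.+1 t0 isT.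
exists (1 + c); have := L2leD h hc.
by congr (L2le _ _ _); apply/funext => w; rewrite subrK.
Qed.

Let X_L2 N eta : 0 <= eta -> L2 P (X N eta).
Proof. exact: (Xg_L2 alpha kap H12 B0 Bgauss). Qed.

Let B_L2 t : 0 <= t -> L2 P (B t).
Proof. exact: (fbm_L2 H12 B0 Bgauss). Qed.

Let X_cvg n u : 0 <= u -> n%:R * u <= T ->
  cvgL2 P (fun k => X (n * k.+1) (u / k.+1%:R)) (G (n%:R * u)).
Proof. exact: (Xg_cvg a01 T0 cG). Qed.

Lemma cvg_Asum : exists l : R, (fun N => m2 * kap / 2 * Asum N.+1 / N.+1%:R) @ \oo --> l.
Proof.
have TT : 0 <= T <= T by rewrite lexx ltW.
have h1 : (fun N => ip P (Gsum alpha kap B T N.+1) (B T)) @ \oo --> ip P (G T) (B T).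
  apply: ip_cvgl.
  - by move=> n; apply: (Gsum_L2 alpha kap H12 B0 Bgauss) => //; exact: ltW.
  - exact: G_L2.
  - by apply: B_L2; exact: ltW.
  - by move=> e /(cG TT)[N _ hN]; exists N => // n /= Nn; apply: hN; rewrite /= leqW.
have h2 : (fun N => N.+1%:R^-1 * \sum_(j < N.+1) j.+1%:R `^ (alpha - 1) * rho j) @ \oo --> 2 * H.
  have := cesaro (cvg_pinc p12); rewrite /arithmetic_mean /series/=.
  apply: cvg_trans; apply: near_eq_cvg; apply: nearW => N.
  rewrite big_mkord; congr (_ * _); apply: eq_bigr => j _.
  by rewrite aE (_ : 2 - 2 * H - 1 = 1 - 2 * H)//; ring.
exists (ip P (G T) (B T) / T - m2 * kap / 2 * (2 * H)).
have cv : (fun N => ip P (Gsum alpha kap B T N.+1) (B T) / T - m2 * kap / 2 *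
    (N.+1%:R^-1 * \sum_(j < N.+1) j.+1%:R `^ (alpha - 1) * rho j)) @ \oo -->
    ip P (G T) (B T) / T - m2 * kap / 2 * (2 * H).
  apply: cvgB; first by apply: cvgM => //; exact: cvg_cst.
  by apply: cvgM => //; exact: cvg_cst.
apply: cvg_trans cv; apply: near_eq_cvg; apply: nearW => N /=.
have NR : N.+1%:R != 0 :> R by rewrite pnatr_eq0.
have e0 : 0 < T / N.+1%:R by rewrite divr_gt0// ltr0n.
rewrite Gsum_Xg// -[X in ip P _ (B X)](divfK NR T) [_ * N.+1%:R]mulrC.
have := @ip_X_B 0 N.+1 _ e0; rewrite add0n => ->.
rewrite {2}/Asum big_ord0 subr0 /Esum; under [X in _ * (_ + X)]eq_bigr do rewrite add0n.
move: (N.+1%:R) NR (Asum _) (\sum_(j < _) _) => K KR A S.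
by field; rewrite KR gt_eqF.
Qed.

Section grid.
Variables (u : R) (n1 n2 : nat).
Hypothesis u0 : 0 < u.
Hypothesis n12 : (n1 <= n2)%N.
Hypothesis n2T : n2%:R * u <= T.

Let n1T : n1%:R * u <= T.
Proof. by apply: le_trans n2T; rewrite ler_pM2r// ler_nat. Qed.

Definition Wg (m : nat) : R :=
  ip P (G (n1%:R * u)) (B (m%:R * u)) - ip P (G (n2%:R * u)) (B (m%:R * u)).

Definition rk (K y : nat) : R := kdiff alpha ((n2 - n1) * K)%:R (n1 * K - y)%:R.

Let nuT n : n%:R * u <= T -> 0 <= n%:R * u <= T.
Proof. by move=> ->; rewrite mulr_ge0 ?(ltW u0). Qed.

Lemma cvg_Wg m : (m <= n1)%N ->
  (fun k => m2 * kap * u / 2 * (dconv (rk k.+1) rho (m * k.+1) / k.+1%:R)) @ \oo --> Wg m.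
Proof.
move=> mn1; have [l hl] := cvg_Asum.
have mn2 := leq_trans mn1 n12.
have hA n : (fun k => m2 * kap / 2 * Asum (n * k.+1) / k.+1%:R) @ \oo --> n%:R * l.
  have [->|n0] := posnP n.
    rewrite mul0r (_ : (fun k => _) = fun=> 0); first exact: cvg_cst.
    by apply/funext => k; rewrite /Asum mul0n big_ord0 mulr0 mul0r.
  have nR : n%:R != 0 :> R by rewrite pnatr_eq0 -lt0n.
  have hs : (fun k => m2 * kap / 2 * Asum (n * k.+1) / (n * k.+1)%:R) @ \oo --> l.
    move/cvgrPdist_le : hl => hl; apply/cvgrPdist_le => e /hl[N _ hN].
    exists N => // k /= Nk; have := hN (n * k.+1).-1; rewrite prednK ?muln_gt0 ?n0//.
    by apply; rewrite /= -ltnS prednK ?muln_gt0 ?n0// (leq_ltn_trans Nk)// leq_pmull.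
  have cv : (fun k => n%:R * (m2 * kap / 2 * Asum (n * k.+1) / (n * k.+1)%:R)) @ \oo --> n%:R * l.
    by apply: cvgM => //; exact: cvg_cst.
  apply: cvg_trans cv; apply: near_eq_cvg; apply: nearW => k /=.
  have : k.+1%:R != 0 :> R by rewrite pnatr_eq0.
  by rewrite natrM; move: (Asum _) (k.+1%:R) => A K KR; field; rewrite KR nR.
have hX n : n%:R * u <= T ->
  (fun k => ip P (X (n * k.+1) (u / k.+1%:R)) (B (m%:R * u))) @ \oo --> ip P (G (n%:R * u)) (B (m%:R * u)).
  move=> nT; apply: ip_cvgl.
  - by move=> k; apply: X_L2; rewrite divr_ge0// ltW.
  - exact: G_L2 (nuT nT).
  - by apply: B_L2; rewrite mulr_ge0// ltW.
  - by apply: X_cvg => //; exact: ltW.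
have cv : (fun k => ip P (X (n1 * k.+1) (u / k.+1%:R)) (B (m%:R * u)) -
     ip P (X (n2 * k.+1) (u / k.+1%:R)) (B (m%:R * u)) -
   u * (m2 * kap / 2 * Asum (n1 * k.+1) / k.+1%:R -
        m2 * kap / 2 * Asum ((n1 - m) * k.+1) / k.+1%:R -
        (m2 * kap / 2 * Asum (n2 * k.+1) / k.+1%:R -
         m2 * kap / 2 * Asum ((n2 - m) * k.+1) / k.+1%:R))) @ \oo --> Wg m.
  rewrite (_ : Wg m = ip P (G (n1%:R * u)) (B (m%:R * u)) -
     ip P (G (n2%:R * u)) (B (m%:R * u)) -
     u * (n1%:R * l - (n1 - m)%:R * l - (n2%:R * l - (n2 - m)%:R * l))); last first.
    by rewrite /Wg !natrB//; ring.
  apply: cvgB; first by apply: cvgB; exact: hX.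
  apply: cvgM; first exact: cvg_cst.
  by apply: cvgB; apply: cvgB; exact: hA.
apply: cvg_trans cv; apply: near_eq_cvg; apply: nearW => k.
have KR : k.+1%:R != 0 :> R by rewrite pnatr_eq0.
have e0 : 0 < u / k.+1%:R by rewrite divr_gt0// ltr0n.
have hE n : (m <= n)%N -> ip P (X (n * k.+1) (u / k.+1%:R)) (B (m%:R * u)) =
   m2 * kap * (u / k.+1%:R / 2) * (Asum (n * k.+1) - Asum ((n - m) * k.+1) +
     Esum ((n - m) * k.+1) (m * k.+1)).
  move=> mn; have := @ip_X_B ((n - m) * k.+1) (m * k.+1) _ e0.
  rewrite -mulnDl subnK// => <-; congr (ip _ _ (B _)).
  by rewrite natrM; move: (k.+1%:R) KR => K KR; field.
have dE : dconv (rk k.+1) rho (m * k.+1) =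
    Esum ((n1 - m) * k.+1) (m * k.+1) - Esum ((n2 - m) * k.+1) (m * k.+1).
  rewrite /dconv /Esum -sumrB; apply: eq_bigr => j _; rewrite -mulrBl; congr (_ * _).
  have jm : (j.+1 <= m * k.+1)%N by exact: ltn_ord.
  have mK i : (m <= i)%N -> (m * k.+1 <= i * k.+1)%N by move=> mi; rewrite leq_mul2r mi orbT.
  have e1 i : (m <= i)%N -> ((i * k.+1 - (m * k.+1 - j.+1)) = (i - m) * k.+1 + j.+1)%N.
    move=> mi; have := mK _ mi; rewrite mulnBl; clear -jm; lia.
  rewrite /rk /kdiff -natrD e1//; congr (_ - _%:R `^ _).
  by rewrite addnAC -mulnDl; congr ((_ * _ + _)%N); rewrite addnC addnBA// subnK.
rewrite /= !hE// dE.
move: (Asum _) (Asum _) (Asum _) (Asum _) (Esum _ _) (Esum _ _) (k.+1%:R) KR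
  => A1 A2 A3 A4 E1 E2 K KR; by field.
Qed.

Let rk0 K y : (0 < K)%N -> (y < n1 * K)%N -> 0 <= rk K y.
Proof. by move=> K0 yn; apply: kdiff_ge0; rewrite ?ltr0n ?subn_gt0. Qed.

Let rk_inc K y : (0 < K)%N -> (y.+1 < n1 * K)%N -> rk K y <= rk K y.+1.
Proof.
move=> K0 yn; apply: kdiff_noninc => //.
by rewrite ltr0n subn_gt0 yn ler_nat leq_sub2l.
Qed.

Let rk_cvx K y : (0 < K)%N -> (y.+2 < n1 * K)%N ->
  rk K y.+1 - rk K y <= rk K y.+2 - rk K y.+1.
Proof.
move=> K0 yn.
have := @kdiff_convex R alpha ((n2 - n1) * K)%:R a01 (ler0n _ _) (n1 * K - y.+2)%:R.
rewrite ltr0n subn_gt0 yn => /(_ isT); rewrite /rk.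
have -> : (n1 * K - y.+1)%:R = (n1 * K - y.+2)%:R + 1 :> R.
  by rewrite natr1; congr (_%:R); clear -yn; lia.
have -> : (n1 * K - y)%:R = (n1 * K - y.+2)%:R + 2 :> R.
  by rewrite -[2]/(2%:R) -natrD; congr (_%:R); clear -yn; lia.
lra.
Qed.

Let dstep K M : (0 < K)%N -> (M < n1 * K)%N ->
  0 <= dconv (rk K) rho M.+1 - dconv (rk K) rho M.
Proof.
move=> K0; apply: dconv_inc => *; rewrite ?rk0 ?rk_inc ?pinc_ge0//.
Qed.

Let dcvx K M : (0 < K)%N -> (M.+1 < n1 * K)%N ->
  dconv (rk K) rho M.+1 - dconv (rk K) rho M <=
  dconv (rk K) rho M.+2 - dconv (rk K) rho M.+1.
Proof.
move=> K0; apply: dconv_convex => *; rewrite ?rk0 ?rk_inc ?rk_cvx ?pinc_ge0 ?pinc_nondec//.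
Qed.

Lemma Wg_inc m : (m < n1)%N -> 0 <= Wg m.+1 - Wg m.
Proof.
move=> mn; have cv := seq_cvgB (cvg_Wg mn) (cvg_Wg (ltnW mn)).
apply: seq_cvg_ge0 cv => k /=; rewrite -mulrBr -mulrBl.
apply: mulr_ge0; first by rewrite !mulr_ge0 ?(ltW u0)// ltW// gauss_m2_gt0.
rewrite divr_ge0// mulSn addnC.
pose D := dconv (rk k.+1) rho; rewrite -/(D _) -/(D _).
suff h j : (j <= k.+1)%N -> 0 <= D (m * k.+1 + j)%N - D (m * k.+1)%N by exact: h.
elim: j => [|j IH] jk; first by rewrite addn0 subrr.
rewrite addnS -(subrKA (D (m * k.+1 + j)%N)) addr_ge0//.
  apply: dstep => //; rewrite (leq_trans _ (leq_mul mn (leqnn k.+1)))//.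
  by rewrite mulSn addnC ltn_add2r.
by apply: IH; exact: ltnW.
Qed.

Lemma Wg_cvx m : (m.+1 < n1)%N -> Wg m.+1 - Wg m <= Wg m.+2 - Wg m.+1.
Proof.
move=> mn; rewrite -subr_ge0.
have cv1 := seq_cvgB (cvg_Wg mn) (cvg_Wg (ltnW mn)).
have cv2 := seq_cvgB (cvg_Wg (ltnW mn)) (cvg_Wg (ltnW (ltnW mn))).
have cv := seq_cvgB cv1 cv2.
apply: seq_cvg_ge0 cv => k /=; rewrite -!mulrBr -!mulrBl.
apply: mulr_ge0; first by rewrite !mulr_ge0 ?(ltW u0)// ltW// gauss_m2_gt0.
rewrite divr_ge0// subr_ge0.
pose D := dconv (rk k.+1) rho; rewrite -/(D _) -/(D _) -/(D _).
have tel j M : D (M + j)%N - D M = \sum_(i < j) (D (M + i).+1 - D (M + i)%N).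
  elim: j => [|j IH]; first by rewrite big_ord0 addn0 subrr.
  by rewrite big_ord_recr/= -IH addnS addrC subrKA.
have Dn M i : (M + i < n1 * k.+1)%N -> D M.+1 - D M <= D (M + i).+1 - D (M + i)%N.
  elim: i => [|i IH]; first by rewrite addn0.
  rewrite addnS => h; apply: le_trans (IH (ltnW h)) _; exact: dcvx.
have e1 : (m.+1 * k.+1 = m * k.+1 + k.+1)%N by rewrite mulSn addnC.
have e2 : (m.+2 * k.+1 = m * k.+1 + k.+1 + k.+1)%N by rewrite mulSn addnC e1.
rewrite e2 e1 !tel; apply: ler_sum => i _.
have := Dn (m * k.+1 + i)%N k.+1; rewrite addnAC; apply.
rewrite -addnA (leq_trans _ (leq_mul mn (leqnn k.+1)))// e2 -addnA ltn_add2l.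
by rewrite ltn_add2l.
Qed.

Lemma ip_GX_ge0 (M1 M2 : nat) : (M1 <= M2)%N -> (M2 <= n1)%N ->
  0 <= ip P (fun w => G (n1%:R * u) w - G (n2%:R * u) w)
            (fun w => X M2 u w - X M1 u w).
Proof.
move=> M12 M2n; pose Z w := G (n1%:R * u) w - G (n2%:R * u) w.
have LZ : L2 P Z by apply: L2B; apply: G_L2; exact: nuT.
have BL j : L2 P (B (j%:R * u)) by apply: B_L2; rewrite mulr_ge0// ltW.
have dL j : L2 P (dB B u j) by exact: L2B.
have dE j : ip P Z (dB B u j) = Wg j.+1 - Wg j.
  by rewrite ipBr// /Z !ipBl//; exact: G_L2 (nuT _).
have XE M : ip P Z (X M u) = kap * \sum_(i < M) (i.+1%:R * u) `^ (alpha - 1) *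
    (Wg (M - i.+1).+1 - Wg (M - i.+1)%N).
  rewrite ipC ipZl//; last by apply: L2_sum => i; apply: L2Z.
  rewrite ip_suml//; last by move=> i; apply: L2Z.
  by congr (_ * _); apply: eq_bigr => i _; rewrite ipZl// ipC dE.
rewrite ipBr//; [|by apply: X_L2; exact: ltW|by apply: X_L2; exact: ltW].
rewrite !XE -mulrBr mulr_ge0// subr_ge0.
rewrite -(subnKC M12) big_split_ord/= -[leLHS]addr0; apply: lerD; last first.
  apply: sumr_ge0 => i _; rewrite mulr_ge0 ?powR_ge0// Wg_inc//.
  by clear -M12 M2n; have := ltn_ord i; lia.
apply: ler_sum => i _; rewrite ler_wpM2l ?powR_ge0// subnKC//.
have mono a c : (a + c < n1)%N -> Wg a.+1 - Wg a <= Wg (a + c).+1 - Wg (a + c)%N.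
  elim: c => [|c IH]; first by rewrite addn0.
  by rewrite addnS => h; apply: le_trans (IH (ltnW h)) _; exact: Wg_cvx.
have := mono (M1 - i.+1)%N (M2 - M1)%N.
have -> : (M1 - i.+1 + (M2 - M1) = M2 - i.+1)%N by clear -M12; have := ltn_ord i; lia.
apply; clear -M12 M2n; have := ltn_ord i; lia.
Qed.

End grid.

Lemma ip_G_grid_ge0 (u : R) (n1 n2 m1 m2 : nat) : 0 < u -> (m1 <= m2)%N -> (m2 <= n1)%N ->
  (n1 <= n2)%N -> n2%:R * u <= T ->
  0 <= ip P (fun w => G (n1%:R * u) w - G (n2%:R * u) w)
            (fun w => G (m2%:R * u) w - G (m1%:R * u) w).
Proof.
move=> u0 m12 m2n n12 nT.
have lT n : (n <= n2)%N -> n%:R * u <= T.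
  by move=> h; apply: le_trans nT; rewrite ler_pM2r// ler_nat.
have GL n : (n <= n2)%N -> L2 P (G (n%:R * u)).
  by move=> h; apply: G_L2; rewrite lT// mulr_ge0// ltW.
have h2 := leq_trans m2n n12; have h1 := leq_trans m12 h2.
have XL n k : L2 P (X (n * k.+1) (u / k.+1%:R)).
  by apply: X_L2; rewrite divr_ge0// ltW.
have cv : (fun k => ip P (fun w => G (n1%:R * u) w - G (n2%:R * u) w)
    (fun w => X (m2 * k.+1) (u / k.+1%:R) w - X (m1 * k.+1) (u / k.+1%:R) w)) @ \oo -->
  ip P (fun w => G (n1%:R * u) w - G (n2%:R * u) w)
            (fun w => G (m2%:R * u) w - G (m1%:R * u) w).
  apply: ip_cvgr.
  - by move=> k; exact: L2B.
  - by apply: L2B; exact: GL.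
  - by apply: L2B; exact: GL.
  - by apply: cvgL2B; apply: X_cvg; rewrite ?lT// ltW.
apply: seq_cvg_ge0 cv => k.
have e0 : 0 < u / k.+1%:R by rewrite divr_gt0// ltr0n.
have eE n : (n * k.+1)%:R * (u / k.+1%:R) = n%:R * u.
  have : k.+1%:R != 0 :> R by rewrite pnatr_eq0.
  by rewrite natrM; move: (k.+1%:R) => K KR; field.
have := @ip_GX_ge0 (u / k.+1%:R) (n1 * k.+1) (n2 * k.+1) e0.
rewrite !eE leq_mul2r n12 orbT => /(_ isT nT (m1 * k.+1)%N (m2 * k.+1)%N).
by rewrite !leq_mul2r m12 m2n !orbT; exact.
Qed.

End negative_correlation.

(** * The fractional kernel and fractional integrals *)

Section power_integrals.
Context {R : realType}.
Local Notation mu := (@lebesgue_measure R).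
Implicit Types (a b p t : R).

Lemma ge0_FTC_open (f F : R -> R) a b : a < b ->
  measurable_fun setT f ->
  (forall x, a < x < b -> 0 <= f x) ->
  (forall x, a < x < b -> {for x, continuous f}) ->
  (forall x, a < x < b -> is_derive x 1 F (f x)) ->
  (fun n : nat => F (a + (b - a) / n.+3%:R)) @ \oo --> F a ->
  (fun n : nat => F (b - (b - a) / n.+3%:R)) @ \oo --> F b ->
  (\int[mu]_(x in `[a, b]) (f x)%:E = (F b - F a)%:E)%E.
Proof.
move=> ab mf f0 cf dF Fa Fb.
pose e n : R := (b - a) / n.+3%:R.
have ba : 0 < b - a by rewrite subr_gt0.
have e0 n : 0 < e n by rewrite divr_gt0// ltr0n.
have e2 n : a + e n < b - e n.
  have : e n * 3 <= b - a by rewrite mulrAC ler_pdivrMr ?ltr0n// ler_pM2l// ler_nat.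
  have := e0 n; lra.
have ed m n : (m <= n)%N -> e n <= e m.
  by move=> mn; rewrite /e ler_pM2l// lef_pV2 ?posrE ?ltr0n// ler_nat !ltnS.
pose A n : set (measurableTypeR R) := `[a + e n, b - e n]%classic.
have UA : `]a, b[%classic = \bigcup_n A n.
  apply/seteqP; split => x /=.
    rewrite in_itv/= => /andP[ax xb].
    pose d := Num.min (x - a) (b - x).
    have d0 : 0 < d by rewrite /d lt_min !subr_gt0 ax xb.
    pose n := Num.bound ((b - a) / d).
    have en : e n <= d.
      rewrite /e ler_pdivrMr ?ltr0n// -ler_pdivrMl// mulrC.
      apply: le_trans (ltW (archi_boundP _)) _; first by rewrite divr_ge0// ltW.
      by rewrite ler_nat -addn3 leq_addr.
    have d1 : d <= x - a by rewrite /d ge_min lexx.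
    have d2 : d <= b - x by rewrite /d ge_min lexx orbT.
    by exists n => //; rewrite /A/= in_itv/=; apply/andP; split; lra.
  move=> [n _]; rewrite /A/= in_itv/= => /andP[h1 h2]; rewrite in_itv/=.
  by have en := e0 n; apply/andP; split; lra.
have inA n x : A n x -> a < x < b.
  rewrite /A/= in_itv/= => /andP[h1 h2]; have := e0 n.
  by move=> ?; apply/andP; split; lra.
rewrite -integral_itv_obnd_cbnd; last exact/measurable_EFinP/measurable_funTS.
rewrite -integral_itv_bndo_bndc; last exact/measurable_EFinP/measurable_funTS.
rewrite UA.
have c1 := @ge0_nondecreasing_set_cvg_integral _ _ R A (EFin \o f) mu.
have {}c1 : (fun n => \int[mu]_(x in A n) (f x)%:E)%E @ \oo -->
    (\int[mu]_(x in \bigcup_n A n) (f x)%:E)%E.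
  apply: c1.
  - move=> m n mn; apply/subsetPset => x; rewrite /A/= !in_itv/= => /andP[h1 h2].
    by have emn := ed _ _ mn; apply/andP; split; lra.
  - by move=> n; exact: measurable_itv.
  - by move=> n; exact/measurable_EFinP/measurable_funTS.
  - by move=> n x /inA/f0; rewrite lee_fin.
have c2 : (fun n => \int[mu]_(x in A n) (f x)%:E)%E @ \oo --> (F b - F a)%:E.
  rewrite (_ : (fun n => _) = (fun n => (F (b - e n) - F (a + e n))%:E)).
    by apply: cvg_EFin; [exact: nearW|exact: cvgB].
  apply/funext => n; rewrite EFinB; apply: continuous_FTC2 => //.
  - apply: continuous_in_subspaceT => x; rewrite inE => /(inA n); exact: cf.
  - have cF x : A n x -> {for x, continuous F}.
      move=> /inA/dF h; apply: differentiable_continuous; apply/derivable1_diffP.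
      exact: ex_derive.
    split.
    + move=> x; rewrite in_itv/= => /andP[h1 h2].
      have /dF h : a < x < b by apply: (inA n); rewrite /A/= in_itv/= !ltW.
      exact: ex_derive.
    + apply: cvg_at_right_filter; apply: cF; rewrite /A/= in_itv/= lexx ltW//.
    + apply: cvg_at_left_filter; apply: cF; rewrite /A/= in_itv/= lexx ltW//.
  - move=> x; rewrite in_itv/= => /andP[h1 h2]; rewrite derive1E.
    have /dF h : a < x < b by apply: (inA n); rewrite /A/= in_itv/= !ltW.
    exact: derive_val.
exact: (cvg_unique _ c1 c2).
Qed.

Lemma powR_continuous_gt0 p (x : R) : 0 < x -> {for x, continuous (@powR R ^~ p)}.
Proof.
move=> x0; apply: differentiable_continuous; apply/derivable1_diffP.
exact: (@ex_derive _ _ _ _ _ _ _ (is_derive1_powR p x0)).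
Qed.

Lemma seq_powR_cvg (u : nat -> R) (l p : R) : u @ \oo --> l -> (forall n, 0 < u n) ->
  0 <= l -> 0 < p \/ 0 < l -> (fun n => u n `^ p) @ \oo --> l `^ p.
Proof.
move=> ul u0; rewrite le_eqVlt => /predU1P[l0|l0] pl.
  have p0 : 0 < p by case: pl => //; rewrite -l0 ltxx.
  rewrite -l0 powR0 ?gt_eqF//; rewrite -l0 in ul.
  have /cvg_at_rightP h := powR_cvg0 p0.
  exact: (h u).
have h := @powR_continuous_gt0 p l l0.
exact: (@cvg_comp _ _ _ u (@powR R ^~ p) _ _ _ ul h).
Qed.

Lemma cvg_divn3 (c : R) : (fun n : nat => c / n.+3%:R) @ \oo --> 0.
Proof.
rewrite -[X in _ --> X](mulr0 c); apply: cvgM; first exact: cvg_cst.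
have := @cvg_harmonic R; rewrite -(cvg_shiftn 2) => h.
apply: cvg_trans h; apply: near_eq_cvg; apply: nearW => n.
by rewrite /harmonic/= addn2.
Qed.

Lemma integral_powR_rev t a b p : a <= b -> b <= t -> p != 0 -> 0 < p \/ b < t ->
  (\int[mu]_(s in `[a, b]) ((t - s) `^ (p - 1))%:E = (((t - a) `^ p - (t - b) `^ p) / p)%:E)%E.
Proof.
rewrite le_eqVlt => /predU1P[->|ab] bt p0 pbt.
  by rewrite subrr mul0r set_itv1 integral_set1.
pose F s : R := - ((t - s) `^ p / p).
have -> : ((t - a) `^ p - (t - b) `^ p) / p = F b - F a by rewrite /F; ring.
have seqcv (c s : R) : (forall n : nat, 0 < t - (s + c / n.+3%:R)) -> 0 <= t - s ->
    0 < p \/ 0 < t - s ->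
    (fun n : nat => F (s + c / n.+3%:R)) @ \oo --> F s.
  move=> h1 h2 h3; rewrite /F; apply: cvgN; apply: cvgM; last exact: cvg_cst.
  apply: seq_powR_cvg => //; rewrite -[X in _ --> X](subr0 (t - s)).
  under eq_fun do rewrite opprD addrA.
  by apply: cvgB; [exact: cvg_cst|exact: cvg_divn3].
have n3 n : (b - a) / n.+3%:R < b - a.
  rewrite ltr_pdivrMr ?ltr0n// ltr_pMr ?subr_gt0// ltr1n//.
have n0 n : 0 < (b - a) / n.+3%:R by rewrite divr_gt0 ?subr_gt0// ltr0n.
apply: ge0_FTC_open => //.
- by apply: (measurableT_comp (measurable_powR _)); exact: measurable_funB.
- by move=> x _; exact: powR_ge0.
- move=> x /andP[ax xb]; apply: (@continuous_comp _ _ _ (fun s => t - s) (@powR R ^~ (p - 1))).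
    by apply: cvgB; [exact: cvg_cst|exact: cvg_id].
  by apply: powR_continuous_gt0; lra.
- move=> x /andP[ax xb]; have tx : 0 < t - x by lra.
  have d1 : is_derive x 1 (fun s => t - s) (-1 : R).
    rewrite -[X in is_derive _ _ _ X]sub0r.
    exact: is_deriveB.
  have d2 := @is_derive1_comp _ (@powR R ^~ p) (fun s => t - s) x _ _ (is_derive1_powR p tx) d1.
  have d3 := is_deriveZ (- p^-1) d2.
  rewrite (_ : F = (- p^-1 \*: (fun s => (t - s) `^ p))); last first.
    by apply/funext => s; rewrite /F/= /GRing.scale/=; ring.
  apply: (is_derive_eq d3); rewrite /GRing.scale/=; by field.
- apply: seqcv; [|lra|right; lra].
  by move=> n; move: (n3 n); move: (_ / _) => z; lra.
- have := @seqcv (- (b - a)) b; rewrite (_ : (fun n : nat => F (b - _)) = (fun n : nat => F (b + - (b - a) / n.+3%:R))).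
    apply; [|lra|by case: pbt; [left|right; lra]].
    by move=> n; rewrite mulNr; move: (n0 n); move: (_ / _) => z; lra.
  by apply/funext => n; rewrite mulNr.
Qed.

Lemma integral_powR0 t p : 0 <= t -> 0 < p ->
  (\int[mu]_(s in `[0%R, t]) (s `^ (p - 1))%:E = (t `^ p / p)%:E)%E.
Proof.
rewrite le_eqVlt => /predU1P[<-|t0] p0.
  by rewrite powR0 ?gt_eqF// mul0r set_itv1 integral_set1.
pose F s : R := s `^ p / p.
have -> : t `^ p / p = F t - F 0 by rewrite /F powR0 ?gt_eqF//; ring.
have n3 n : (t - 0) / n.+3%:R < t.
  by rewrite subr0 ltr_pdivrMr ?ltr0n// ltr_pMr// ltr1n.
have n0 n : 0 < (t - 0) / n.+3%:R by rewrite divr_gt0 ?subr_gt0// ltr0n.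
apply: ge0_FTC_open => //.
- by move=> x _; exact: powR_ge0.
- by move=> x /andP[x0 _]; exact: powR_continuous_gt0.
- move=> x /andP[x0 xt]; have d2 := is_derive1_powR p x0.
  have d3 := is_deriveZ p^-1 d2.
  rewrite (_ : F = (p^-1 \*: (@powR R ^~ p))); last first.
    by apply/funext => s; rewrite /F/= /GRing.scale/=; ring.
  by apply: (is_derive_eq d3); rewrite /GRing.scale/= mulKf ?gt_eqF.
- rewrite /F; apply: cvgM; last exact: cvg_cst.
  apply: seq_powR_cvg => //; [|by move=> n; rewrite add0r|by left].
  by under eq_fun do rewrite add0r; exact: cvg_divn3.
- rewrite /F; apply: cvgM; last exact: cvg_cst.
  apply: seq_powR_cvg => //; [|by move=> n; rewrite subr_gt0|exact: ltW|by left].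
  rewrite -[X in _ --> X](subr0 t); apply: cvgB; [exact: cvg_cst|exact: cvg_divn3].
Qed.

End power_integrals.

Section kernel.
Context {R : realType}.
Variable alpha : R.
Hypothesis a01 : 0 < alpha < 1.
Local Notation mu := (@lebesgue_measure R).

Definition kern (t s : R) : R := (t - s) `^ (alpha - 1).

Lemma measurable_kern t : measurable_fun setT (kern t).
Proof. by apply: (measurableT_comp (measurable_powR _)); exact: measurable_funB. Qed.

Lemma kern_ge0 t s : 0 <= kern t s.
Proof. exact: powR_ge0. Qed.

Let a0 : 0 < alpha. Proof. by case/andP: a01. Qed.
Let a1 : alpha < 1. Proof. by case/andP: a01. Qed.

Lemma integral_kern t a b : a <= b -> b <= t ->
  (\int[mu]_(s in `[a, b]) (kern t s)%:E = (((t - a) `^ alpha - (t - b) `^ alpha) / alpha)%:E)%E.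
Proof. by move=> ab bt; apply: integral_powR_rev => //; [rewrite gt_eqF|left]. Qed.

Lemma kern_diff_ge0 s h r : r < s -> 0 <= h -> 0 <= kern s r - kern (s + h) r.
Proof.
move=> rs h0; rewrite /kern addrAC.
by apply: powR_kernel_diff_ge0; rewrite ?subr_gt0.
Qed.

(* Both [y^(a-1) - (y+h)^(a-1)] and [y^(rho-1) - (y+h)^(rho-1)] are comparable
   to a power of [y] times [h / (y + h)]; the second one integrates exactly. *)
Lemma kern_diff_le s h r (beta : R) : r < s -> 0 <= h -> 0 <= beta -> alpha + beta < 1 ->
  (kern s r - kern (s + h) r) * (s - r) `^ beta <=
  (1 - (alpha + beta))^-1 *
    ((s - r) `^ (alpha + beta - 1) - (s + h - r) `^ (alpha + beta - 1)).
Proof.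
move=> rs h0 b0 ab1; rewrite /kern; have -> : s + h - r = (s - r) + h by ring.
have y0 : 0 < s - r by rewrite subr_gt0.
move: (s - r) y0 => y y0; set rho := alpha + beta.
have r0 : 0 < 1 - rho by rewrite subr_gt0.
have yh : 0 < y + h by lra.
have yh1 : 0 <= y / (y + h) by rewrite divr_ge0// ltW.
apply: (@le_trans _ _ (y `^ (rho - 1) * (h / (y + h)))).
  rewrite (_ : rho - 1 = (alpha - 1) + beta); last by rewrite /rho; ring.
  rewrite (powR_split (alpha - 1) beta)// mulrAC ler_wpM2r ?powR_ge0//.
  exact: powR_kernel_diff_le.
rewrite -ler_pdivrMl ?invr_gt0// invrK.
rewrite (powR_scale1 (rho - 1) y0 (ltW yh)) -[X in _ <= X - _]mulr1 -mulrBr mulrCA.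
rewrite ler_wpM2l ?powR_ge0//.
have -> : ((y + h) / y) `^ (rho - 1) = (y / (y + h)) `^ (1 - rho).
  rewrite -[y / (y + h)]invf_div -[((y + h) / y)^-1]powR_inv1 ?divr_ge0 ?(ltW y0) ?(ltW yh)//.
  by rewrite -powRrM; congr (_ `^ _); ring.
have := @powR_le_affine R (y / (y + h)) (1 - rho) yh1.
have -> : h / (y + h) = 1 - y / (y + h) by field; rewrite gt_eqF.
have rho0 : 0 <= rho by rewrite /rho addr_ge0// ltW.
move=> /(_ _)/wrap[]; first by apply/andP; split; lra.
by lra.
Qed.

Lemma integral_kern_diff (s h beta : R) : 0 <= s -> 0 <= h -> 0 <= beta -> alpha + beta < 1 ->
  (\int[mu]_(r in `[0%R, s[) ((kern s r - kern (s + h) r) * (s - r) `^ beta)%:E <=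
   (h `^ (alpha + beta) / ((alpha + beta) * (1 - (alpha + beta))))%:E)%E.
Proof.
move=> s0 h0 b0 ab1; set rho := alpha + beta.
have rho0 : 0 < rho by rewrite /rho ltr_wpDr.
have r0 : 0 < 1 - rho by rewrite subr_gt0.
pose f r : R := (s - r) `^ (rho - 1) - (s + h - r) `^ (rho - 1).
have mp t : measurable_fun setT (fun r : R => (t - r) `^ (rho - 1)).
  by apply: (measurableT_comp (measurable_powR _)); exact: measurable_funB.
have mf : measurable_fun setT f by exact: measurable_funB.
have f0 r : r < s -> 0 <= f r.
  move=> rs; rewrite /f (_ : s + h - r = s - r + h); last by ring.
  by apply: powR_kernel_diff_ge0; rewrite ?subr_gt0.
have intf : (\int[mu]_(r in `[0%R, s[) (f r)%:E <= (h `^ rho / rho)%:E)%E.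
  have e1 : (\int[mu]_(r in `[0%R, s[) ((s - r) `^ (rho - 1))%:E = (s `^ rho / rho)%:E)%E.
    rewrite integral_itv_bndo_bndc; last exact/measurable_EFinP/measurable_funTS.
    rewrite integral_powR_rev//; [|by rewrite gt_eqF|by left].
    by rewrite subr0 subrr [0 `^ _]powR0 ?gt_eqF// subr0.
  have e2 : (\int[mu]_(r in `[0%R, s[) ((s + h - r) `^ (rho - 1))%:E =
      (((s + h) `^ rho - h `^ rho) / rho)%:E)%E.
    rewrite integral_itv_bndo_bndc; last exact/measurable_EFinP/measurable_funTS.
    rewrite integral_powR_rev//; [|by rewrite lerDl|by rewrite gt_eqF|by left].
    by rewrite subr0 (_ : s + h - s = h); last by ring.
  have e3 : (\int[mu]_(r in `[0%R, s[) (f r)%:E +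
     \int[mu]_(r in `[0%R, s[) ((s + h - r) `^ (rho - 1))%:E =
     \int[mu]_(r in `[0%R, s[) ((s - r) `^ (rho - 1))%:E)%E.
    rewrite -ge0_integralD//.
    - by apply: eq_integral => r _; rewrite -EFinD /f subrK.
    - by move=> r /=; rewrite in_itv/= => /andP[_ /f0]; rewrite lee_fin.
    - exact/measurable_EFinP/measurable_funTS.
    - by move=> r _; rewrite lee_fin powR_ge0.
    - by apply/measurable_EFinP; apply: measurable_funTS; exact: mp.
  rewrite e2 e1 in e3.
  have -> : (\int[mu]_(r in `[0%R, s[) (f r)%:E = (s `^ rho / rho - ((s + h) `^ rho - h `^ rho) / rho)%:E)%E.
    by rewrite EFinB -e3 addeK.
  rewrite lee_fin -mulrBl ler_pM2r ?invr_gt0//.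
  have : s `^ rho <= (s + h) `^ rho.
    by apply: ge0_ler_powR; rewrite ?nnegrE ?(ltW rho0) ?lerDl ?addr_ge0.
  lra.
apply: (@le_trans _ _ ((1 - rho)^-1%:E * \int[mu]_(r in `[0%R, s[) (f r)%:E)%E).
  rewrite -ge0_integralZl//; last 3 first.
  - exact/measurable_EFinP/measurable_funTS.
  - by move=> r /=; rewrite in_itv/= => /andP[_ /f0]; rewrite lee_fin.
  - by rewrite lee_fin invr_ge0 ltW.
  apply: ge0_le_integral => //.
  - move=> r /=; rewrite in_itv/= => /andP[_ rs].
    by rewrite lee_fin mulr_ge0 ?powR_ge0// kern_diff_ge0.
  - apply/measurable_EFinP/measurable_funTS; apply: measurable_funM.
      by apply: measurable_funB; exact: measurable_kern.
    by apply: (measurableT_comp (measurable_powR _)); exact: measurable_funB.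
  - by apply: measurable_funeM; exact/measurable_EFinP/measurable_funTS.
  - move=> r /=; rewrite in_itv/= => /andP[_ rs]; rewrite -EFinM lee_fin.
    exact: kern_diff_le.
apply: le_trans (lee_wpmul2l _ intf) _; first by rewrite lee_fin invr_ge0 ltW.
rewrite -EFinM lee_fin le_eqVlt; apply/orP; left; apply/eqP.
by field; rewrite !gt_eqF.
Qed.

End kernel.

Section fractional_integral.
Context {R : realType} {d0 : measure_display} {Omega : measurableType d0}.
Variable P : probability Omega R.
Variable alpha : R.
Hypothesis a01 : 0 < alpha < 1.
Local Notation mu := (@lebesgue_measure R).
Local Notation kern := (kern alpha).

Let a0 : 0 < alpha. Proof. by case/andP: a01. Qed.
Let a1 : alpha < 1. Proof. by case/andP: a01. Qed.

Lemma kern_integrable (t a b : R) (f : R -> R) (M : R) : b <= t ->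
  measurable_fun setT f -> (forall s, `|f s| <= M) ->
  mu.-integrable `[a, b] (EFin \o (fun s => kern t s * f s)).
Proof.
move=> bt mf fM; have [ab|ba] := leP a b; last first.
  by rewrite set_itv_ge ?bnd_simp -?ltNge//; exact: integrable_set0.
have M0 : 0 <= M by exact: le_trans (fM 0).
apply/integrableP; split.
  apply/measurable_EFinP; apply: measurable_funTS; apply: measurable_funM => //.
  exact: measurable_kern.
apply: (@le_lt_trans _ _ (\int[mu]_(s in `[a, b]) (M%:E * (kern t s)%:E))%E).
  apply: ge0_le_integral => //.
  - apply: measurableT_comp => //; apply/measurable_EFinP; apply: measurable_funTS.
    apply: measurable_funM => //; exact: measurable_kern.
  - apply: measurable_funeM; apply/measurable_EFinP; apply: measurable_funTS.
    exact: measurable_kern.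
  - move=> s _; rewrite -EFinM lee_fin normrM ger0_norm ?kern_ge0// mulrC.
    by rewrite ler_wpM2r ?kern_ge0.
rewrite ge0_integralZl//.
- by rewrite integral_kern// -EFinM ltry.
- by apply/measurable_EFinP; apply: measurable_funTS; exact: measurable_kern.
- by move=> s _; rewrite lee_fin kern_ge0.
Qed.

Section process.
Variable F : measurableTypeR R * Omega -> R.
Hypothesis mF : measurable_fun setT F.
Hypothesis Fbnd : forall w, exists M, forall s, `|F (s, w)| <= M.

Definition fint (t : R) (w : Omega) : R := \int[mu]_(s in `[0, t]) (kern t s * F (s, w)).

Let mFw w : measurable_fun setT (fun s : R => F (s, w)).
Proof. exact: (measurableT_comp mF (measurable_pair2 w)). Qed.

Lemma process_integrable (t a b : R) w : b <= t ->
  mu.-integrable `[a, b] (EFin \o (fun s => kern t s * F (s, w))).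
Proof. by move=> bt; have [M hM] := Fbnd w; apply: kern_integrable hM. Qed.

Lemma measurable_process_integral (t : R) (D : set (measurableTypeR R)) : measurable D ->
  measurable_fun setT (fun w => \int[mu]_(s in D) (kern t s * F (s, w))).
Proof.
move=> mD.
have mkF : measurable_fun setT (fun z : measurableTypeR R * Omega => kern t z.1 * F z).
  apply: measurable_funM => //.
  exact: (measurableT_comp (measurable_kern alpha t) measurable_fst).
exact: (@measurable_Rintegral_param _ _ _ _ _ mu D _ mD mkF).
Qed.

Lemma fint_measurable t : measurable_fun setT (fint t).
Proof. exact: measurable_process_integral. Qed.

Lemma kern_process_L2le (t a b : R) (c : R -> R) (K : R) :
  measurable_fun setT c -> (forall s, a <= s <= b -> 0 < c s) ->
  (forall s, a <= s <= b -> L2le P (fun w => F (s, w)) (c s)) -> 0 <= K ->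
  (\int[mu]_(s in `[a, b]) (kern t s * c s)%:E <= K%:E)%E ->
  L2le P (fun w => \int[mu]_(s in `[a, b]) (kern t s * F (s, w))) K.
Proof.
move=> mc c0 hF K0 hK.
apply: (@L2le_int _ _ _ P _ _ mu `[a, b]%classic (kern t) c F K) => //.
- exact: measurable_kern.
- by move=> s _; exact: kern_ge0.
Qed.

Lemma kern_process_L2le_cst (t a b c : R) : a <= b -> b <= t -> 0 <= c ->
  (forall s, a <= s <= b -> L2le P (fun w => F (s, w)) c) ->
  L2le P (fun w => \int[mu]_(s in `[a, b]) (kern t s * F (s, w)))
    (c * (((t - a) `^ alpha - (t - b) `^ alpha) / alpha)).
Proof.
move=> ab bt c0 hF.
have k0 : 0 <= ((t - a) `^ alpha - (t - b) `^ alpha) / alpha.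
  rewrite divr_ge0 ?(ltW a0)// subr_ge0 ge0_ler_powR ?nnegrE ?(ltW a0)//; lra.
apply: L2le_eps; first exact: mulr_ge0.
move=> e e0; set K := (_ / alpha) in k0 *.
pose c' := c + e / (K + 1).
have K1 : 0 < K + 1 by lra.
have c'0 : 0 < c' by rewrite ltr_wpDl// divr_gt0.
apply: (@L2le_mono _ _ _ _ _ (c' * K)).
  rewrite /c' mulrDl lerD2l mulrAC ler_pdivrMr// ler_pM2l//; lra.
apply: (kern_process_L2le (c := fun=> c')).
- exact: measurable_cst.
- by [].
- by move=> s sab; apply: L2le_mono (hF _ sab); rewrite /c' lerDl divr_ge0// ltW.
- by rewrite mulr_ge0// ltW.
under eq_integral do rewrite mulrC EFinM.
rewrite ge0_integralZl//; first by rewrite integral_kern.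
- by apply/measurable_EFinP; apply: measurable_funTS; exact: measurable_kern.
- by move=> s _; rewrite lee_fin kern_ge0.
- by rewrite lee_fin ltW.
Qed.

Lemma fint_diff (s t : R) w : 0 <= s <= t ->
  fint t w - fint s w = \int[mu]_(r in `[s, t]) (kern t r * F (r, w)) -
    \int[mu]_(r in `[0, s[) ((kern s r - kern t r) * F (r, w)).
Proof.
move=> /andP[s0 st].
have it := @process_integrable t 0 t w (lexx t).
have is' := @process_integrable s 0 s w (lexx s).
have its := @process_integrable t 0 s w st.
have e1 := @Rintegral_itvB R (fun r => kern t r * F (r, w)) (BLeft 0) (BRight t) s it.
rewrite !bnd_simp in e1; have {}e1 := e1 s0 st.
have its' : mu.-integrable `]s, t] (EFin \o (fun r => kern t r * F (r, w))).
  by apply: integrableS it => //; apply: subset_itvr; rewrite bnd_simp.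
rewrite Rintegral_itv_obnd_cbnd// in e1.
have sub : `[0, s[%classic `<=` `[0, s]%classic by apply: subset_itvl; rewrite bnd_simp.
have h1 : mu.-integrable `[0, s[ (EFin \o (fun r => kern t r * F (r, w))).
  by apply: integrableS its.
have h2 : mu.-integrable `[0, s[ (EFin \o (fun r => kern s r * F (r, w))).
  by apply: integrableS is'.
have e2 : \int[mu]_(r in `[0, s[) ((kern s r - kern t r) * F (r, w)) =
   fint s w - \int[mu]_(r in `[0, s]) (kern t r * F (r, w)).
  under eq_Rintegral do rewrite mulrBl.
  by rewrite RintegralB// !Rintegral_itv_bndo_bndc.
rewrite e2 -e1 /fint; move: (Rintegral _ _ _) (Rintegral _ _ _) (Rintegral _ _ _) => x y z.
by rewrite opprB addrA subrK.
Qed.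

Definition Cfrac (rho : R) : R := (rho * (1 - rho))^-1 + alpha^-1.

Lemma kern_diff_process_L2le (s t beta c : R) :
  0 <= s <= t -> 0 <= beta -> alpha + beta < 1 -> 0 < c ->
  (forall r, 0 <= r < s -> L2le P (fun w => F (r, w)) (c * (s - r) `^ beta)) ->
  L2le P (fun w => \int[mu]_(r in `[0, s[) ((kern s r - kern t r) * F (r, w)))
    (c * ((t - s) `^ (alpha + beta) / ((alpha + beta) * (1 - (alpha + beta))))).
Proof.
move=> /andP[s0 st] b0 ab1 c0 hF.
have r0 : 0 < alpha + beta by rewrite ltr_wpDr.
have h0 : 0 <= t - s by rewrite subr_ge0.
have e : s + (t - s) = t by rewrite addrC subrK.
have kd r : r < s -> 0 <= kern s r - kern t r.
  by move=> rs; rewrite -e; exact: kern_diff_ge0.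
apply: (@L2le_int _ _ _ P _ _ mu `[0, s[%classic (fun r => kern s r - kern t r)
   (fun r => c * (s - r) `^ beta) F).
- exact: measurable_itv.
- by apply: measurable_funB; exact: measurable_kern.
- apply: measurable_funM => //.
  by apply: (measurableT_comp (measurable_powR _)); exact: measurable_funB.
- by [].
- by move=> r /=; rewrite in_itv/= => /andP[_ rs]; exact: kd.
- move=> r /=; rewrite in_itv/= => /andP[_ rs].
  by rewrite mulr_gt0// powR_gt0// subr_gt0.
- by move=> r /=; rewrite in_itv/=; exact: hF.
- by rewrite mulr_ge0 ?(ltW c0)// divr_ge0 ?powR_ge0// mulr_ge0 ?(ltW r0)// subr_ge0 ltW.
under eq_integral do rewrite mulrCA EFinM.
rewrite ge0_integralZl//; last 3 first.
- apply/measurable_EFinP; apply: measurable_funTS; apply: measurable_funM.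
    by apply: measurable_funB; exact: measurable_kern.
  by apply: (measurableT_comp (measurable_powR _)); exact: measurable_funB.
- move=> r /=; rewrite in_itv/= => /andP[_ rs].
  by rewrite lee_fin mulr_ge0 ?powR_ge0// kd.
- by rewrite lee_fin ltW.
rewrite EFinM; apply: lee_wpmul2l; first by rewrite lee_fin ltW.
by rewrite -{1}e; exact: integral_kern_diff.
Qed.

Lemma fint_holder_at (s t beta c : R) : 0 <= s <= t -> 0 <= beta ->
  alpha + beta < 1 -> 0 < c ->
  (forall r, 0 <= r <= t -> L2le P (fun w => F (r, w)) (c * `|r - s| `^ beta)) ->
  L2le P (fun w => fint t w - fint s w)
    (c * (Cfrac (alpha + beta) * (t - s) `^ (alpha + beta))).
Proof.
move=> /[dup] st /andP[s0 st'] b0 ab1 c0 hF; have h0 : 0 <= t - s by rewrite subr_ge0.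
have b1 : L2le P (fun w => \int[mu]_(r in `[0, s[) ((kern s r - kern t r) * F (r, w)))
    (c * ((t - s) `^ (alpha + beta) / ((alpha + beta) * (1 - (alpha + beta))))).
  apply: kern_diff_process_L2le => // r /andP[r0 rs].
  have := hF r; rewrite r0 (le_trans (ltW rs))// => /(_ isT).
  by rewrite ltr0_norm ?subr_lt0// opprB.
have b2 : L2le P (fun w => \int[mu]_(r in `[s, t]) (kern t r * F (r, w)))
    (c * ((t - s) `^ (alpha + beta) / alpha)).
  have := @kern_process_L2le_cst t s t (c * (t - s) `^ beta) st' (lexx t).
  rewrite subrr [0 `^ _]powR0 ?gt_eqF// subr0 => hh.
  have {}hh := hh (mulr_ge0 (ltW c0) (powR_ge0 _ _)).
  apply: L2le_mono (hh _).
    rewrite -mulrA ler_wpM2l ?(ltW c0)// mulrA ler_wpM2r ?invr_ge0 ?(ltW a0)//.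
    have [->|n0] := eqVneq (t - s) 0.
      by rewrite [0 `^ alpha]powR0 ?gt_eqF// mulr0 powR_ge0.
    by rewrite -powR_split ?[beta + alpha]addrC// lt_neqAle eq_sym n0.
  move=> r /andP[sr rt]; apply: L2le_mono (hF r _); last by rewrite rt (le_trans s0).
  rewrite ler_wpM2l ?(ltW c0)// ge0_ler_powR ?nnegrE//.
  by rewrite ger0_norm ?subr_ge0// lerD2r.
have := L2leB b2 b1; congr (L2le _ _ _).
  by apply/funext => w; rewrite fint_diff.
by rewrite [LHS]addrC -2!mulrDr /Cfrac [in RHS](mulrC _ ((t - s) `^ _)).
Qed.

Lemma fint_holder (s t c : R) : 0 <= s <= t -> 0 < c ->
  (forall r, 0 <= r <= t -> L2le P (fun w => F (r, w)) c) ->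
  L2le P (fun w => fint t w - fint s w) (c * (Cfrac alpha * (t - s) `^ alpha)).
Proof.
move=> st c0 hF; have := @fint_holder_at s t 0 c st (lexx 0); rewrite addr0; apply => //.
by move=> r rt; rewrite powRr0 mulr1; exact: hF.
Qed.

End process.

Lemma fint_holder_centered (F : measurableTypeR R * Omega -> R) (s t beta c c' : R) :
  measurable_fun setT F -> (forall w, exists M, forall r, `|F (r, w)| <= M) ->
  0 <= s <= t -> 0 <= beta -> alpha + beta < 1 -> 0 < c ->
  (forall r, 0 <= r <= t -> L2le P (fun w => F (r, w) - F (s, w)) (c * `|r - s| `^ beta)) ->
  L2le P (fun w => F (s, w)) c' ->
  L2le P (fun w => fint F t w - fint F s w)
    (c * (Cfrac (alpha + beta) * (t - s) `^ (alpha + beta)) +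
     c' * ((t `^ alpha - s `^ alpha) / alpha)).
Proof.
move=> mF Fbnd /[dup] st /andP[s0 st'] b0 ab1 c0 hF hFs.
have mFs : measurable_fun setT (fun w => F (s, w)) by case: hFs.
pose F' (z : measurableTypeR R * Omega) := F z - F (s, z.2).
have mF' : measurable_fun setT F'.
  by apply: measurable_funB => //; exact: measurableT_comp mFs measurable_snd.
have F'bnd w : exists M, forall r, `|F' (r, w)| <= M.
  have [M hM] := Fbnd w; exists (M + M) => r.
  by apply: le_trans (ler_normB _ _) _; apply: lerD.
have h1 := fint_holder_at mF' F'bnd st b0 ab1 c0 hF.
have fE r w : 0 <= r -> fint F' r w = fint F r w - r `^ alpha / alpha * F (s, w).
  move=> r0; rewrite /fint /F'/=.
  under eq_Rintegral do rewrite mulrBr.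
  have ik : mu.-integrable `[0, r] (EFin \o kern r).
    have := @kern_integrable r 0 r (cst 1) 1 (lexx r) (measurable_cst _).
    rewrite (_ : (fun u => kern r u * cst 1 u) = kern r); last first.
      by apply/funext => u; rewrite /= mulr1.
    by apply => u; rewrite normr1.
  rewrite RintegralB//; last 2 first.
  - exact: process_integrable.
  - apply: (@kern_integrable r 0 r (cst (F (s, w))) `|F (s, w)|) => //.
  rewrite RintegralZr//; congr (_ - _ * _).
  by rewrite /Rintegral integral_kern// subrr powR0 ?gt_eqF// !subr0.
have k0 : 0 <= (t `^ alpha - s `^ alpha) / alpha.
  rewrite divr_ge0 ?(ltW a0)// subr_ge0 ge0_ler_powR ?nnegrE ?(ltW a0)//.
  exact: le_trans st'.
have := L2leD h1 (L2leZ ((t `^ alpha - s `^ alpha) / alpha) hFs).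
rewrite ger0_norm// [_ * c']mulrC; congr (L2le _ _ _).
apply/funext => w; rewrite !fE//; last exact: le_trans st'.
move: (fint F t w) (fint F s w) => x y; ring.
Qed.

Lemma integral_kern_expR (t lam : R) : 0 <= t -> 0 < lam ->
  (\int[mu]_(s in `[0%R, t]) (kern t s * expR (lam * s))%:E <=
   (expR (lam * t) * (lam `^ (- (alpha / 2)) * (t `^ (alpha / 2) / (alpha / 2))))%:E)%E.
Proof.
move=> t0 l0; have q0 : 0 < alpha / 2 by rewrite divr_gt0.
have mq : measurable_fun setT (fun s : R => (t - s) `^ (alpha / 2 - 1)).
  by apply: (measurableT_comp (measurable_powR _)); exact: measurable_funB.
apply: (@le_trans _ _ (\int[mu]_(s in `[0%R, t]) ((expR (lam * t) * lam `^ (- (alpha / 2)))%:E *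
   ((t - s) `^ (alpha / 2 - 1))%:E)%E)%E); last first.
  rewrite ge0_integralZl//.
  - rewrite integral_powR_rev ?gt_eqF//; last by left.
    by rewrite subrr subr0 [0 `^ _]powR0 ?gt_eqF// subr0 -EFinM mulrA.
  - by apply/measurable_EFinP; exact: measurable_funTS.
  - by move=> s _; rewrite lee_fin powR_ge0.
  - by rewrite lee_fin mulr_ge0 ?powR_ge0 ?expR_ge0.
apply: ge0_le_integral => //.
- by move=> s _; rewrite lee_fin mulr_ge0 ?kern_ge0 ?expR_ge0.
- apply/measurable_EFinP; apply: measurable_funTS; apply: measurable_funM.
    exact: measurable_kern.
  by apply: measurableT_comp => //; exact: measurable_funM.
- by apply: measurable_funeM; apply/measurable_EFinP; exact: measurable_funTS.
move=> s /=; rewrite in_itv/= => /andP[s0]; rewrite -EFinM lee_fin le_eqVlt => /predU1P[->|st].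
  by rewrite /kern subrr powR0 ?subr_eq0 ?lt_eqF// mul0r mulr_ge0 ?powR_ge0// mulr_ge0 ?powR_ge0 ?expR_ge0.
have ts : 0 < t - s by rewrite subr_gt0.
have -> : lam * s = lam * t + - (lam * (t - s)) by ring.
rewrite expRD mulrCA -mulrA ler_wpM2l ?expR_ge0//.
have h := @expRN_le_powR R (lam * (t - s)) (alpha / 2) _ _.
apply: le_trans (ler_wpM2l (kern_ge0 _ _ _) (h _ _)) _.
- by rewrite mulr_gt0.
- by rewrite ltW//=; move: (a1); lra.
rewrite powRM ?(ltW l0) ?(ltW ts)// mulrCA ler_wpM2l ?powR_ge0// /kern -powR_split//.
by rewrite (_ : alpha - 1 + - (alpha / 2) = alpha / 2 - 1)//; field.
Qed.

End fractional_integral.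

(* A pathwise estimate is an [L2le] estimate for the Dirac measure at the path. *)
Lemma fint_path_holder {R : realType} d0 (Omega : measurableType d0) (alpha : R)
    (F : measurableTypeR R * Omega -> R) (s t c : R) w : 0 < alpha < 1 ->
  measurable_fun setT F -> (forall w, exists M, forall r, `|F (r, w)| <= M) ->
  0 <= s <= t -> 0 < c -> (forall r, 0 <= r <= t -> `|F (r, w)| <= c) ->
  `|fint alpha F t w - fint alpha F s w| <= c * (Cfrac alpha alpha * (t - s) `^ alpha).
Proof.
move=> a01 mF Fbnd st c0 hF.
have hd (r : R) : 0 <= r <= t -> L2le (\d_w : probability Omega R) (fun w => F (r, w)) c.
  move=> rt; split; [exact: (measurableT_comp mF (measurable_pair1 r))|exact: ltW|].
  rewrite integral_dirac//.
    rewrite diracT mul1e lee_fin -real_normK ?num_real// lerXn2r ?nnegrE//; first exact: ltW.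
    exact: hF.
  by apply: measurable_EFin_sqr; exact: (measurableT_comp mF (measurable_pair1 r)).
have [m1 c1] := fint_holder a01 mF Fbnd st c0 hd.
rewrite integral_dirac//; last exact: measurable_EFin_sqr.
rewrite diracT mul1e lee_fin => h.
by rewrite -(@ler_pXn2r _ 2) ?nnegrE// real_normK ?num_real.
Qed.

(** * The exact solution *)

Section clamp.
Context {R : realType}.
Variable T : R.
Hypothesis T0 : 0 < T.

Definition clamp (s : R) : R := Num.max 0 (Num.min s T).

Lemma clamp_itv s : 0 <= clamp s <= T.
Proof. by rewrite /clamp le_max lexx/= ge_max (ltW T0) ge_min lexx orbT. Qed.

Lemma clamp_id s : 0 <= s <= T -> clamp s = s.
Proof. by move=> /andP[s0 sT]; rewrite /clamp (min_idPl sT) (max_idPr s0). Qed.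

Lemma clamp_lip s r : `|clamp s - clamp r| <= `|s - r|.
Proof.
wlog sr : s r / s <= r.
  move=> h; have [/h//|/ltW/h] := leP s r.
  by rewrite distrC [`|r - s|]distrC.
rewrite [leRHS]distrC [leRHS]ger0_norm ?subr_ge0// ler_norml /clamp.
have T0' := T0; case: (leP s T) => h1; case: (leP r T) => h2.
all: rewrite ?(max_idPr (ltW T0)); case: (leP 0 s) => h3; case: (leP 0 r) => h4.
all: by apply/andP; split; lra.
Qed.

Lemma clamp_continuous : continuous clamp.
Proof.
move=> s; apply/cvgrPdist_lt => e e0; exists e => //= r.
exact: le_lt_trans (clamp_lip _ _).
Qed.

Lemma within_comp_clamp (f : R -> R) :
  {within [set t | 0 <= t <= T], continuous f} -> continuous (f \o clamp).
Proof.
move=> /subspace_continuousP cf s.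
apply: (@cvg_comp _ _ _ clamp f _ (within [set t | 0 <= t <= T] (nbhs (clamp s)))).
  move=> A; rewrite /within/= => hA.
  have h := @clamp_continuous s _ hA.
  apply: (@filterS _ (nbhs s) _ _ _ _ h) => r; apply.
  exact: clamp_itv.
by apply: cf; exact: clamp_itv.
Qed.

Lemma comp_clamp_bounded (f : R -> R) : continuous (f \o clamp) ->
  exists M, forall s, `|f (clamp s)| <= M.
Proof.
move=> cf.
have cn : {within `[0, T], continuous (fun s => `|f (clamp s)|)}.
  apply: continuous_subspaceT => s; exact: (cvg_norm (cf s)).
have [c _ hc] := EVT_max (ltW T0) cn.
exists `|f (clamp c)| => s.
have := hc (clamp s); rewrite in_itv/= clamp_itv => /(_ isT).
by rewrite (clamp_id (clamp_itv s)).
Qed.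

End clamp.

Section solution_paths.
Context {R : realType} {d0 : measure_display} {Omega : measurableType d0}.
Variables (T alpha g L : R) (d : nat) (b : 'cV[R]_d -> 'cV[R]_d).
Variables (x0 : Omega -> 'cV[R]_d) (x : R -> Omega -> 'cV[R]_d).
Hypotheses (T0 : 0 < T) (a01 : 0 < alpha < 1) (L0 : 0 <= L).
Hypothesis bL : forall u v, vnorm (b u - b v) <= L * vnorm (u - v).
Hypothesis mx0 : forall i, measurable_fun setT (fun w => x0 w i 0).
Hypothesis mx : forall t i, measurable_fun setT (fun w => x t w i 0).
Hypothesis cx : forall w i,
  {within [set t : R | 0 <= t <= T], continuous (fun t => x t w i 0)}.
Local Notation mu := (@lebesgue_measure R).

Definition xc (s : R) (w : Omega) : 'cV[R]_d := x (clamp T s) w.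

Lemma xc_id s w : 0 <= s <= T -> xc s w = x s w.
Proof. by move=> sT; rewrite /xc clamp_id. Qed.

Lemma xc_continuous w i : continuous (fun s => xc s w i 0).
Proof. have h := @within_comp_clamp _ _ T0 (fun t => x t w i 0) (@cx w i).
move=> s; exact: (h s). Qed.

Lemma xc_measurable s i : measurable_fun setT (fun w => xc s w i 0).
Proof. exact: mx. Qed.

Lemma xc_bounded w : exists M, forall s, vnorm (xc s w) <= M.
Proof.
have h i := @comp_clamp_bounded _ _ T0 (fun t => x t w i 0) (@xc_continuous w i).
have [M hM] := choice h; exists (\sum_i M i) => s.
by apply: le_trans (vnorm_le_sum _) _; apply: ler_sum => i _; exact: hM.
Qed.

Definition bx i (z : measurableTypeR R * Omega) : R := b (xc z.1 z.2) i 0.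

Lemma b_coord_lip i u v : `|b u i 0 - b v i 0| <= L * vnorm (u - v).
Proof.
apply: le_trans (bL u v); rewrite (le_trans _ (coord_le_vnorm _ i))// !mxE//.
Qed.

Lemma bx_measurable i : measurable_fun setT (bx i).
Proof.
apply: (measurable_lipschitz_comp (f := fun v => b v i 0)); first exact: b_coord_lip.
by move=> j; apply: (measurable_caratheodory (X := fun s w => xc s w j 0)) => //;
  [move=> s; exact: xc_measurable|move=> w; exact: xc_continuous].
Qed.

Lemma b_coord_growth i v : `|b v i 0| <= vnorm (b 0) + L * vnorm v.
Proof.
have h := b_coord_lip i v 0; rewrite subr0 in h.
rewrite -[b v i 0](subrK (b 0 i 0)) addrC; apply: le_trans (ler_normD _ _) _.
by apply: lerD => //; exact: coord_le_vnorm.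
Qed.

Lemma bx_bounded i w : exists M, forall s, `|bx i (s, w)| <= M.
Proof.
have [M hM] := xc_bounded w; exists (vnorm (b 0) + L * M) => s.
apply: le_trans (b_coord_growth _ _) _; rewrite lerD2l.
by apply: ler_wpM2l => //; exact: hM.
Qed.

Lemma RL_driftE t w i : 0 <= t <= T ->
  RL_drift alpha b x t w i 0 = (Gammaf alpha)^-1 * fint alpha (bx i) t w.
Proof.
move=> /andP[t0 tT]; rewrite mxE; congr (_ * _); rewrite /fint.
rewrite (_ : [set s | _] = `[0, t]%classic); last first.
  by apply/seteqP; split => s /=; rewrite in_itv.
apply: eq_Rintegral => s; rewrite inE/= in_itv/= => /andP[s0 st].
by rewrite /kern /bx/= xc_id// s0 (le_trans st).
Qed.

(* The noise read off from the solution: it equals [G] almost surely at each time,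
   but it is defined, and continuous in time, on every path. *)
Definition Gt i (t : R) (w : Omega) : R :=
  xc t w i 0 - x0 w i 0 - g * fint alpha (bx i) t w.

Lemma Gt_measurable i t : measurable_fun setT (Gt i t).
Proof.
apply: measurable_funB; first by apply: measurable_funB => //; exact: xc_measurable.
apply: measurable_funM => //; apply: fint_measurable => //.
exact: bx_measurable.
Qed.

Lemma fint_seq_cvg i w (s_ : nat -> R) (s : R) : (forall n, 0 <= s_ n <= s) ->
  s_ @ \oo --> s -> (fun n => fint alpha (bx i) (s_ n) w) @ \oo --> fint alpha (bx i) s w.
Proof.
move=> hs cs; have [M hM] := bx_bounded i w.
have M1 : 0 < `|M| + 1 by rewrite ltr_wpDl.
have bnd n : `|fint alpha (bx i) s w - fint alpha (bx i) (s_ n) w| <=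
    (`|M| + 1) * (Cfrac alpha alpha * (s - s_ n) `^ alpha).
  apply: fint_path_holder => //; [exact: bx_measurable|exact: bx_bounded|].
  by move=> r _; apply: le_trans (hM r) _; rewrite (le_trans (ler_norm M))// lerDl.
apply/cvgrPdist_le => e e0.
have Cf : 0 < Cfrac alpha alpha.
  have [a0 a1] := andP a01.
  by rewrite addr_gt0 ?invr_gt0// mulr_gt0// subr_gt0.
pose e' := (e / ((`|M| + 1) * Cfrac alpha alpha)) `^ alpha^-1.
have a0 : 0 < alpha by case/andP: a01.
have e'0 : 0 < e' by rewrite powR_gt0// divr_gt0// mulr_gt0.
move/cvgrPdist_le : cs => /(_ _ e'0); apply: filterS => n hn.
apply: le_trans (bnd n) _.
have s0 : 0 <= s - s_ n by rewrite subr_ge0; case/andP: (hs n).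
rewrite ger0_norm// in hn.
rewrite mulrA mulrC -ler_pdivlMr ?mulr_gt0//.
apply: (@le_trans _ _ (e' `^ alpha)); first by rewrite ge0_ler_powR ?nnegrE// ltW.
by rewrite /e' -powRrM mulVf ?gt_eqF// powRr1// divr_ge0 ?(ltW e0)// mulr_ge0// ltW.
Qed.

Lemma Gt_seq_cvg i w (s_ : nat -> R) (s : R) : (forall n, 0 <= s_ n <= s) ->
  s_ @ \oo --> s -> (fun n => Gt i (s_ n) w) @ \oo --> Gt i s w.
Proof.
move=> hs cs; apply: cvgB.
  apply: cvgB; last exact: cvg_cst.
  exact: (@cvg_comp _ _ _ s_ (fun t => xc t w i 0) _ _ _ cs (@xc_continuous w i s)).
by apply: cvgM; [exact: cvg_cst|exact: fint_seq_cvg].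
Qed.

End solution_paths.

Section time_grid.
Context {R : realType}.
Variable T : R.
Hypothesis T0 : 0 < T.

Definition tgrid (k : nat) (s : R) : nat := `|Num.floor (s / T * k.+1%:R)|%N.

Lemma tgrid_le k s : 0 <= s -> 0 <= (tgrid k s)%:R * (T / k.+1%:R) <= s.
Proof.
move=> s0; have k0 : 0 < (k.+1%:R : R) by rewrite ltr0n.
have f0 : 0 <= Num.floor (s / T * k.+1%:R).
  by rewrite floor_ge0 mulr_ge0// divr_ge0// ltW.
rewrite mulr_ge0 ?divr_ge0 ?(ltW T0) ?(ltW k0)//= /tgrid natr_absz ger0_norm//.
rewrite mulrA ler_pdivrMr// -ler_pdivlMr//.
by apply: le_trans (floor_le_tmp _) _; rewrite mulrAC.
Qed.

Lemma tgrid_ge k s : 0 <= s -> s - T / k.+1%:R <= (tgrid k s)%:R * (T / k.+1%:R).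
Proof.
move=> s0; have k0 : 0 < (k.+1%:R : R) by rewrite ltr0n.
have f0 : 0 <= Num.floor (s / T * k.+1%:R).
  by rewrite floor_ge0 mulr_ge0// divr_ge0// ltW.
have /andP[_ h] := floor_itv (s / T * k.+1%:R); rewrite intrD in h.
rewrite /tgrid natr_absz ger0_norm// lerBlDr -[X in _ + X]mul1r -mulrDl.
by rewrite mulrA ler_pdivlMr// -ler_pdivrMr// mulrAC ltW.
Qed.

Lemma tgrid_mono k s t : 0 <= s -> s <= t -> (tgrid k s <= tgrid k t)%N.
Proof.
move=> s0 st; have k0 : 0 < (k.+1%:R : R) by rewrite ltr0n.
have h : Num.floor (s / T * k.+1%:R) <= Num.floor (t / T * k.+1%:R).
  by apply: le_floor; rewrite ler_pM2r// ler_pM2r// invr_gt0.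
have f0 : 0 <= Num.floor (s / T * k.+1%:R).
  by rewrite floor_ge0 mulr_ge0// divr_ge0// ltW.
by rewrite /tgrid -lez_nat !gez0_abs// (le_trans f0).
Qed.

Lemma tgrid_cvg s : 0 <= s -> (fun k => (tgrid k s)%:R * (T / k.+1%:R)) @ \oo --> s.
Proof.
move=> s0; apply: (@squeeze_cvgr _ _ _ _ (fun k => s - T / k.+1%:R) (fun=> s)).
- by apply: nearW => k; rewrite tgrid_ge//=; case/andP: (tgrid_le k s0).
- rewrite -[X in _ --> X]subr0; apply: cvgB; first exact: cvg_cst.
  rewrite -[X in _ --> X](mulr0 T); apply: cvgM; first exact: cvg_cst.
  exact: cvg_harmonic.
- exact: cvg_cst.
Qed.

End time_grid.

Section weighted_norms.
Context {R : realType} {d0 : measure_display} {Omega : measurableType d0}.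
Variable P : probability Omega R.

Lemma L2le_cst (c : R) : 0 <= c -> L2le P (fun=> c) c.
Proof. move=> c0; split => //; have -> : (\int[P]_w (c ^+ 2)%:E = (c ^+ 2)%:E)%E; last by [].
by rewrite -[RHS]mule1 -(probability_setT P); exact: integral_cst. Qed.

Lemma exists_rate (c q : R) : 0 <= c -> 0 < q -> exists lam, 0 < lam /\ c * lam `^ (- q) <= 2^-1.
Proof.
move=> c0 q0; exists ((2 * c + 1) `^ q^-1); have c1 : 0 < 2 * c + 1 by lra.
split; first exact: powR_gt0.
rewrite -powRrM mulrN mulVf ?gt_eqF// powRN powRr1 ?(ltW c1)//.
by rewrite ler_pdivrMr//; lra.
Qed.

Lemma fint_L2le_exp (alpha : R) (F : measurableTypeR R * Omega -> R) (t lam C : R) :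
  0 < alpha < 1 -> measurable_fun setT F -> 0 <= t -> 0 < lam -> 0 < C ->
  (forall s, 0 <= s <= t -> L2le P (fun w => F (s, w)) (C * expR (lam * s))) ->
  L2le P (fint alpha F t)
    (C * (expR (lam * t) * (lam `^ (- (alpha / 2)) * (t `^ (alpha / 2) / (alpha / 2))))).
Proof.
move=> a01 mF t0 l0 C0 hF; have a0 : 0 < alpha by case/andP: a01.
have me : measurable_fun setT (fun s : R => expR (lam * s)).
  by apply: measurableT_comp => //; exact: measurable_funM.
apply: (@kern_process_L2le _ _ _ P alpha F mF t 0 t (fun s => C * expR (lam * s))) => //.
- exact: measurable_funM.
- by move=> s _; rewrite mulr_gt0 ?expR_gt0.
- rewrite mulr_ge0 ?(ltW C0)// mulr_ge0 ?expR_ge0// mulr_ge0 ?powR_ge0//.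
  by rewrite divr_ge0 ?powR_ge0// divr_ge0// ltW.
under eq_integral do rewrite mulrCA EFinM.
rewrite ge0_integralZl//.
- rewrite [leRHS]EFinM; apply: lee_wpmul2l; first by rewrite lee_fin ltW.
  exact: integral_kern_expR.
- apply/measurable_EFinP; apply: measurable_funTS; apply: measurable_funM => //.
  exact: measurable_kern.
- by move=> s _; rewrite lee_fin mulr_ge0 ?kern_ge0 ?expR_ge0.
- by rewrite lee_fin ltW.
Qed.

End weighted_norms.

Section moments.
Context {R : realType} {d0 : measure_display} {Omega : measurableType d0}.
Variable P : probability Omega R.
Variables (T alpha g L : R) (d : nat) (b : 'cV[R]_d -> 'cV[R]_d).
Variables (x0 : Omega -> 'cV[R]_d) (x : R -> Omega -> 'cV[R]_d).
Hypotheses (T0 : 0 < T) (a01 : 0 < alpha < 1) (L0 : 0 <= L) (g0 : 0 <= g).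
Hypothesis bL : forall u v, vnorm (b u - b v) <= L * vnorm (u - v).
Hypothesis mx0 : forall i, measurable_fun setT (fun w => x0 w i 0).
Hypothesis mx : forall t i, measurable_fun setT (fun w => x t w i 0).
Hypothesis cx : forall w i,
  {within [set t : R | 0 <= t <= T], continuous (fun t => x t w i 0)}.
Variable A : R.
Hypothesis x0A : forall i, L2le P (fun w => x0 w i 0) A.
Hypothesis GtA : forall i t, 0 <= t <= T -> L2le P (Gt T alpha g b x0 x i t) A.
Local Notation xc := (xc T x).
Local Notation bx := (bx T b x).
Local Notation Gt := (Gt T alpha g b x0 x).

Let a0 : 0 < alpha. Proof. by case/andP: a01. Qed.

(* On this event the solution is bounded by [m], so that the contraction argument for
   the moments starts from a finite bound; countably many times suffice by continuity. *)
Definition tame (m : R) : set Omega :=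
  \bigcap_p \bigcap_q [set w | \sum_(i < d) `|xc (p%:R / q.+1%:R) w i 0| <= m].

Lemma tame_measurable m : measurable (tame m).
Proof.
apply: bigcapT_measurable => p; apply: bigcapT_measurable => q.
have mS : measurable_fun setT (fun w => \sum_(i < d) `|xc (p%:R / q.+1%:R) w i 0|).
  apply: measurable_sum => i; apply: measurableT_comp => //; exact: mx.
have := mS measurableT _ (measurable_itv `]-oo, m]).
by rewrite setTI; congr measurable; apply/seteqP; split => w /=; rewrite in_itv.
Qed.

Lemma tame_le m w i s : tame m w -> `|xc s w i 0| <= m.
Proof.
move=> hw.
pose u := clamp T s; have u0 : 0 <= u by case/andP: (clamp_itv T0 s).
have -> : xc s w i 0 = xc u w i 0 by rewrite /xc (clamp_id (clamp_itv T0 s)).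
pose s_ (n : nat) : R := (Num.floor (u * n.+1%:R))%:~R / n.+1%:R.
have cs : s_ @ \oo --> u by exact: cvg_floor_approx.
have cu : (fun n : nat => `|xc (s_ n) w i 0|) @ \oo --> `|xc u w i 0|.
  apply: cvg_norm.
  exact: (@cvg_comp _ _ _ s_ (fun t => xc t w i 0) _ _ _ cs (@xc_continuous _ _ _ _ _ _ T0 cx w i u)).
rewrite -(cvg_lim _ cu)//; apply: limr_le; first exact: cvgP cu.
apply: nearW => n /=.
have f0 : 0 <= Num.floor (u * n.+1%:R) by rewrite floor_ge0 mulr_ge0.
have := hw `|Num.floor (u * n.+1%:R)|%N I n I.
rewrite /= natr_absz ger0_norm// -/(s_ n); apply: le_trans.
by rewrite (bigD1 i)//= lerDl sumr_ge0.
Qed.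

Lemma tame_eventually w : exists m : nat, forall n, (m <= n)%N -> tame n%:R w.
Proof.
have [M hM] := xc_bounded T0 cx w.
exists `|Num.ceil (M *+ d)|%N => n mn p _ q _ /=.
apply: (@le_trans _ _ (\sum_(i < d) M)).
  apply: ler_sum => i _; exact: le_trans (coord_le_vnorm _ _) (hM _).
rewrite sumr_const card_ord.
apply: le_trans (ceil_ge _) _; apply: (@le_trans _ _ (`|Num.ceil (M *+ d)|%N)%:R); last by rewrite ler_nat.
by rewrite natr_absz ler_int ler_norm.
Qed.

Lemma tame_bx_L2le m i s K : 0 <= K ->
  (forall j, L2le P (fun w => \1_(tame m) w * xc s w j 0) K) ->
  L2le P (fun w => \1_(tame m) w * bx i (s, w)) (vnorm (b 0) + L * (d%:R * K)).
Proof.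
move=> K0 h.
have hS : L2le P (fun w => \sum_(j < d) `|\1_(tame m) w * xc s w j 0|) (d%:R * K).
  rewrite mulr_natl -[in X in _ *+ X](card_ord d) -sumr_const.
  by apply: L2le_sum => j _; exact: L2le_norm.
have := L2leD (L2le_cst P (vnorm_ge0 (b 0))) (L2leZ L hS); rewrite ger0_norm//.
apply: L2le_dom.
  apply: measurable_funM; first by apply: measurable_indic; exact: tame_measurable.
  apply: (measurableT_comp (bx_measurable T0 bL mx cx i) (measurable_pair1 s)).
move=> w; rewrite [leRHS]ger0_norm; last first.
  by rewrite addr_ge0 ?vnorm_ge0// mulr_ge0// sumr_ge0.
rewrite indicE; case: (w \in tame m); last first.
  by rewrite mul0r normr0 addr_ge0 ?vnorm_ge0// mulr_ge0// sumr_ge0.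
rewrite mul1r; under eq_bigr do rewrite mul1r.
apply: le_trans (b_coord_growth bL _ _) _; rewrite lerD2l.
by apply: ler_wpM2l => //; exact: vnorm_le_sum.
Qed.

Lemma fint_tame m i t w : fint alpha (fun z => \1_(tame m) z.2 * bx i z) t w =
  \1_(tame m) w * fint alpha (bx i) t w.
Proof.
rewrite /fint/=; under eq_Rintegral do rewrite mulrCA.
rewrite RintegralZl//.
apply: process_integrable => //; first exact: bx_measurable mx cx _.
exact: (bx_bounded T0 L0 bL cx).
Qed.

Let rho lam := lam `^ (- (alpha / 2)) * (T `^ (alpha / 2) / (alpha / 2)).

Lemma tame_contract m lam K : 0 < lam -> 0 <= K -> g * (L * d%:R) * rho lam <= 2^-1 ->
  (forall t i, 0 <= t <= T -> L2le P (fun w => \1_(tame m) w * xc t w i 0) (K * expR (lam * t))) ->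
  forall t i, 0 <= t <= T -> L2le P (fun w => \1_(tame m) w * xc t w i 0)
    ((A + A + g * (vnorm (b 0) + 1) * rho lam + K / 2) * expR (lam * t)).
Proof.
move=> l0 K0 hl hK t i /[dup] tT /andP[t0 tT'].
have rho0 : 0 <= rho lam.
  by rewrite mulr_ge0 ?powR_ge0// divr_ge0 ?powR_ge0// divr_ge0// ltW.
pose C := vnorm (b 0) + 1 + L * (d%:R * K).
have C0 : 0 < C by rewrite /C ltr_wpDr ?mulr_ge0// ltr_wpDl ?vnorm_ge0.
have e1 s : 0 <= s -> 1 <= expR (lam * s).
  by move=> s0; rewrite -expR0 ler_expR mulr_ge0// ltW.
pose FA z := \1_(tame m) z.2 * bx i z.
have mI : measurable_fun setT (\1_(tame m) : Omega -> R).
  by apply: measurable_indic; exact: tame_measurable.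
have mFA : measurable_fun setT FA.
  apply: measurable_funM; first exact: measurableT_comp mI measurable_snd.
  exact: bx_measurable mx cx _.
have hF := @fint_L2le_exp _ _ _ P alpha FA t lam C a01 mFA t0 l0 C0.
have {}hF : L2le P (fint alpha FA t) (C * (expR (lam * t) * rho lam)).
  apply: L2le_mono (hF _).
    apply: ler_wpM2l; first exact: ltW.
    apply: ler_wpM2l; first exact: expR_ge0.
    apply: ler_wpM2l; first exact: powR_ge0.
    rewrite ler_pM2r ?invr_gt0 ?divr_gt0//.
    by rewrite ge0_ler_powR ?nnegrE ?(ltW T0)// divr_ge0// ltW.
  move=> s /andP[s0 st].
  have sT : 0 <= s <= T by rewrite s0 (le_trans st).
  have := @tame_bx_L2le m i s (K * expR (lam * s)).
  move=> /(_ (mulr_ge0 K0 (expR_ge0 _)) (fun j => hK s j sT)); apply: L2le_mono.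
  rewrite /C mulrDl; apply: lerD; last by rewrite -!mulrA lexx.
  apply: (@le_trans _ _ (vnorm (b 0) + 1)); first by rewrite lerDl.
  by rewrite ler_peMr ?e1// addr_ge0 ?vnorm_ge0.
have dom (Y : Omega -> R) c : L2le P Y c -> L2le P (fun w => \1_(tame m) w * Y w) c.
  move=> hY; have mY := L2le_measurable hY; apply: L2le_dom hY; first exact: measurable_funM.
  move=> w; rewrite normrM indicE; case: (w \in tame m); first by rewrite normr1 mul1r.
  by rewrite normr0 mul0r.
have := L2leD (L2leD (dom _ _ (x0A i)) (dom _ _ (GtA i tT))) (L2leZ g hF).
rewrite ger0_norm// => h.
have A0 : 0 <= A by exact: L2le_ge0 (x0A i).
have et := e1 t t0.
apply: (@L2le_mono _ _ _ _ _ (A + A + g * (C * (expR (lam * t) * rho lam)))).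
  rewrite /C; move: (rho lam) rho0 hl (expR (lam * t)) et (vnorm (b 0)) (vnorm_ge0 (b 0)) => r r0 hl e et B B0.
  have h1 : A + A <= (A + A) * e by rewrite ler_peMr// addr_ge0.
  have h2 : g * (L * d%:R) * r * (K * e) <= 2^-1 * (K * e).
    by apply: ler_wpM2r => //; rewrite mulr_ge0// (le_trans ler01).
  have -> : g * ((B + 1 + L * (d%:R * K)) * (e * r)) =
    g * (B + 1) * r * e + g * (L * d%:R) * r * (K * e) by ring.
  have -> : (A + A + g * (B + 1) * r + K / 2) * e =
    (A + A) * e + (g * (B + 1) * r * e + 2^-1 * (K * e)) by ring.
  by apply: lerD => //; rewrite lerD2l.
move: h; congr (L2le _ _ _); apply/funext => w.
rewrite fint_tame /Gt; move: (fint _ _ _ _) (\1_(tame m) w) => f e; ring.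
Qed.

Lemma tame_iter m lam n : 0 <= m -> 0 < lam -> g * (L * d%:R) * rho lam <= 2^-1 ->
  forall t i, 0 <= t <= T -> L2le P (fun w => \1_(tame m) w * xc t w i 0)
    ((2 * (A + A + g * (vnorm (b 0) + 1) * rho lam) + m * 2^-1 ^+ n) * expR (lam * t)).
Proof.
move=> m0 l0 hl.
have rho0 : 0 <= rho lam.
  by rewrite mulr_ge0 ?powR_ge0// divr_ge0 ?powR_ge0// divr_ge0// ltW.
have A1 (i : 'I_d) : 0 <= A + A + g * (vnorm (b 0) + 1) * rho lam.
  have A0 : 0 <= A by exact: L2le_ge0 (x0A i).
  by rewrite !addr_ge0// mulr_ge0// mulr_ge0// addr_ge0 ?vnorm_ge0.
elim: n => [|n IH] t i tT.
  have c0 : 0 <= (2 * (A + A + g * (vnorm (b 0) + 1) * rho lam) + m * 2^-1 ^+ 0) * expR (lam * t).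
    by rewrite mulr_ge0 ?expR_ge0// addr_ge0 ?mulr_ge0 ?A1// exprn_ge0.
  apply: (@L2le_dom _ _ _ P _ (fun=> m) _); last 2 first.
  - move=> w; rewrite [leRHS]ger0_norm// indicE; have [|] := boolP (w \in tame m); last first.
      by rewrite mul0r normr0.
    by rewrite inE mul1r; exact: tame_le.
  - apply: L2le_mono (L2le_cst P m0); rewrite expr0 mulr1.
    have e1 : 1 <= expR (lam * t).
      by rewrite -expR0 ler_expR mulr_ge0 ?(ltW l0)//; case/andP: tT.
    apply: (@le_trans _ _ (m * 1)); first by rewrite mulr1.
    by apply: ler_pM => //; rewrite lerDr mulr_ge0// A1.
  - by apply: measurable_funM => //; [apply: measurable_indic; exact: tame_measurable|exact: mx].
have K0 : 0 <= 2 * (A + A + g * (vnorm (b 0) + 1) * rho lam) + m * 2^-1 ^+ n.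
  by rewrite addr_ge0 ?mulr_ge0 ?A1// exprn_ge0.
apply: L2le_mono (tame_contract l0 K0 hl IH i tT).
rewrite ler_wpM2r ?expR_ge0// exprS.
by rewrite le_eqVlt; apply/orP; left; apply/eqP; field.
Qed.

Lemma xc_moment : exists Mx, 0 < Mx /\
  forall t i, 0 <= t <= T -> L2le P (fun w => xc t w i 0) Mx.
Proof.
have c0 : 0 <= g * (L * d%:R) * (T `^ (alpha / 2) / (alpha / 2)).
  apply: mulr_ge0; first by rewrite !mulr_ge0.
  by rewrite divr_ge0 ?powR_ge0// divr_ge0// ltW.
have [lam [l0 hl]] := exists_rate c0 (divr_gt0 a0 (ltr0n _ 2)).
have {}hl : g * (L * d%:R) * rho lam <= 2^-1 by rewrite /rho mulrCA mulrC.
pose A1 := A + A + g * (vnorm (b 0) + 1) * rho lam.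
exists (2 * `|A1| * expR (lam * T) + 1); split.
  by rewrite ltr_wpDl// mulr_ge0 ?expR_ge0// mulr_ge0.
move=> t i /[dup] tT /andP[t0 tT'].
have rho0 : 0 <= rho lam.
  by rewrite mulr_ge0 ?powR_ge0// divr_ge0 ?powR_ge0// divr_ge0// ltW.
have A0 : 0 <= A1.
  have A0 : 0 <= A by exact: L2le_ge0 (x0A i).
  by rewrite !addr_ge0// mulr_ge0// mulr_ge0// addr_ge0 ?vnorm_ge0.
apply: (@L2le_mono _ _ _ _ _ (2 * A1 * expR (lam * t))).
  rewrite ger0_norm// -[leLHS]addr0; apply: lerD => //.
  by rewrite ler_wpM2l ?mulr_ge0// ler_expR ler_pM2l.
apply: (@L2le_lim0 _ _ _ _ (fun m w => \1_(tame m%:R) w * xc t w i 0)).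
- exact: mx.
- move=> w; have [m hm] := tame_eventually w.
  apply: cvg_near_cst; near=> n; rewrite indicE mem_set ?mul1r//.
  by apply: hm; near: n; exact: nbhs_infty_ge.
move=> m; apply: (@L2le_lim _ _ _ _ (fun _ w => \1_(tame m%:R) w * xc t w i 0) _
   (fun n => (2 * A1 + m%:R * 2^-1 ^+ n) * expR (lam * t))).
- by apply: measurable_funM => //; [apply: measurable_indic; exact: tame_measurable|exact: mx].
- by rewrite mulr_ge0 ?expR_ge0// mulr_ge0.
- by move=> w; exact: cvg_cst.
- by move=> n; exact: tame_iter.
apply: cvgM; last exact: cvg_cst.
rewrite -[X in _ --> X]addr0; apply: cvgD; first exact: cvg_cst.
by apply: (@cvg_geometric R); rewrite ger0_norm//; lra.
Unshelve. all: by end_near. Qed.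

End moments.

Section solution_holder.
Context {R : realType} {d0 : measure_display} {Omega : measurableType d0}.
Variable P : probability Omega R.
Variables (T alpha g L : R) (d : nat) (b : 'cV[R]_d -> 'cV[R]_d).
Variables (x0 : Omega -> 'cV[R]_d) (x G : R -> Omega -> 'cV[R]_d).
Hypotheses (T0 : 0 < T) (a01 : 0 < alpha < 1) (L0 : 0 <= L) (g0 : 0 <= g).
Hypothesis bL : forall u v, vnorm (b u - b v) <= L * vnorm (u - v).
Hypothesis mx0 : forall i, measurable_fun setT (fun w => x0 w i 0).
Hypothesis mx : forall t i, measurable_fun setT (fun w => x t w i 0).
Hypothesis cx : forall w i,
  {within [set t : R | 0 <= t <= T], continuous (fun t => x t w i 0)}.
Variables (theta CG A : R).
Hypotheses (th0 : 0 <= theta <= alpha) (CG0 : 0 <= CG).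
Hypothesis x0A : forall i, L2le P (fun w => x0 w i 0) A.
Hypothesis G0A : forall i, L2le P (fun w => G 0 w i 0) A.
Hypothesis Ggrid : forall i (m n : nat) u, 0 < u -> (m <= n)%N -> n%:R * u <= T ->
  L2le P (fun w => G (n%:R * u) w i 0 - G (m%:R * u) w i 0)
    (CG * (n%:R * u - m%:R * u) `^ theta).
Hypothesis GtG : forall i t, 0 <= t <= T ->
  {ae P, forall w, Gt T alpha g b x0 x i t w = G t w i 0}.
Local Notation xc := (xc T x).
Local Notation bx := (bx T b x).
Local Notation Gt := (Gt T alpha g b x0 x).

Let a0 : 0 < alpha. Proof. by case/andP: a01. Qed.
Let mGt i t : measurable_fun setT (Gt i t).
Proof. by apply: Gt_measurable => //; exact: bL. Qed.

Lemma Gt_grid_L2le i (m n : nat) u : 0 < u -> (m <= n)%N -> n%:R * u <= T ->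
  L2le P (fun w => Gt i (n%:R * u) w - Gt i (m%:R * u) w)
    (CG * (n%:R * u - m%:R * u) `^ theta).
Proof.
move=> u0 mn nT.
have mT : m%:R * u <= T by apply: le_trans nT; rewrite ler_pM2r// ler_nat.
apply: L2le_ae (Ggrid i u0 mn nT); first exact: measurable_funB.
have := @GtG i (n%:R * u); have := @GtG i (m%:R * u).
rewrite nT mT !mulr_ge0// ?(ltW u0)// => /(_ isT) h1 /(_ isT) h2.
by apply: filterS2 h1 h2 => w -> ->.
Qed.

Lemma Gt_holder i s t : 0 <= s -> s <= t -> t <= T ->
  L2le P (fun w => Gt i t w - Gt i s w) (CG * (t - s) `^ theta).
Proof.
move=> s0 st tT; have t0 := le_trans s0 st.
have th : 0 <= theta by case/andP: th0.
apply: (@L2le_lim _ _ _ _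
  (fun k w => Gt i ((tgrid T k t)%:R * (T / k.+1%:R)) w - Gt i ((tgrid T k s)%:R * (T / k.+1%:R)) w)
  _ (fun k => CG * (t - s + T / k.+1%:R) `^ theta)).
- exact: measurable_funB.
- by rewrite mulr_ge0 ?powR_ge0.
- by move=> w; apply: cvgB; apply: Gt_seq_cvg;
    do ?[exact: T0|exact: a01|exact: L0|exact: bL|exact: mx|exact: cx|exact: tgrid_cvg
        |by move=> n; exact: tgrid_le].
- move=> k; have u0 : 0 < T / k.+1%:R by rewrite divr_gt0.
  have /andP[ht0 ht] := tgrid_le T0 k t0; have hs := tgrid_ge T0 k s0.
  have h := @Gt_grid_L2le i _ _ _ u0 (tgrid_mono T0 k s0 st) (le_trans ht tT).
  apply: L2le_mono h; rewrite ler_wpM2l// ge0_ler_powR ?nnegrE//.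
  + by rewrite subr_ge0 ler_pM2r// ler_nat tgrid_mono.
  + by rewrite addr_ge0 ?subr_ge0// ltW.
  + move: ((tgrid T k t)%:R * _) ((tgrid T k s)%:R * _) ht hs => y z.
    by move: (T / k.+1%:R) => u; lra.
apply: cvgM; first exact: cvg_cst.
have [->|n0] := eqVneq theta 0.
  by under eq_fun do rewrite powRr0; rewrite powRr0; exact: cvg_cst.
apply: (@seq_powR_cvg _ (fun k : nat => t - s + T / k.+1%:R)).
- rewrite -[X in _ --> X]addr0; apply: cvgD; first exact: cvg_cst.
  rewrite -[X in _ --> X](mulr0 T); apply: cvgM; first exact: cvg_cst.
  exact: cvg_harmonic.
- by move=> n; rewrite ltr_wpDl ?subr_ge0// divr_gt0.
- by rewrite subr_ge0.
- by left; rewrite lt_neqAle eq_sym n0.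
Qed.

Lemma Gt_moment i t : 0 <= t <= T -> L2le P (Gt i t) (A + CG * T `^ theta).
Proof.
move=> /andP[t0 tT].
have h0 : L2le P (Gt i 0) A.
  by apply: L2le_ae (G0A i) => //; apply: GtG; rewrite lexx ltW.
have := L2leD h0 (Gt_holder i (lexx 0) t0 tT); rewrite subr0.
under eq_fun do rewrite addrC subrK.
apply: L2le_mono; rewrite lerD2l ler_wpM2l// ge0_ler_powR ?nnegrE ?(ltW T0)//.
by case/andP: th0.
Qed.

Lemma xc_moment_bound : exists Mx, 0 < Mx /\
  forall t i, 0 <= t <= T -> L2le P (fun w => xc t w i 0) Mx.
Proof.
have T' : 0 <= CG * T `^ theta by rewrite mulr_ge0 ?powR_ge0.
apply: (@xc_moment _ _ _ P T alpha g L d b x0 x T0 a01 L0 g0 bL mx cx (A + CG * T `^ theta)).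
  by move=> i; apply: L2le_mono (x0A i); rewrite lerDl.
by move=> i t tT; exact: Gt_moment.
Qed.

Lemma bx_L2le i s K : 0 <= K -> (forall j, L2le P (fun w => xc s w j 0) K) ->
  L2le P (fun w => bx i (s, w)) (vnorm (b 0) + L * (d%:R * K)).
Proof.
move=> K0 h.
have hS : L2le P (fun w => \sum_(j < d) `|xc s w j 0|) (d%:R * K).
  rewrite mulr_natl -[in X in _ *+ X](card_ord d) -sumr_const.
  by apply: L2le_sum => j _; exact: L2le_norm.
have := L2leD (L2le_cst P (vnorm_ge0 (b 0))) (L2leZ L hS); rewrite ger0_norm//.
apply: L2le_dom.
  apply: (measurableT_comp (bx_measurable T0 bL mx cx i) (measurable_pair1 s)).
move=> w; rewrite [leRHS]ger0_norm; last first.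
  by rewrite addr_ge0 ?vnorm_ge0// mulr_ge0// sumr_ge0.
apply: le_trans (b_coord_growth bL _ _) _; rewrite lerD2l.
by apply: ler_wpM2l => //; exact: vnorm_le_sum.
Qed.

Lemma b_diff_L2le i (u v : Omega -> 'cV[R]_d) K :
  (forall j, measurable_fun setT (fun w => u w j 0)) ->
  (forall j, measurable_fun setT (fun w => v w j 0)) ->
  (forall j, L2le P (fun w => u w j 0 - v w j 0) K) ->
  L2le P (fun w => b (u w) i 0 - b (v w) i 0) (L * (d%:R * K)).
Proof.
move=> mu mv h.
have hS : L2le P (fun w => \sum_(j < d) `|u w j 0 - v w j 0|) (d%:R * K).
  rewrite mulr_natl -[in X in _ *+ X](card_ord d) -sumr_const.
  by apply: L2le_sum => j _; exact: L2le_norm.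
have := L2leZ L hS; rewrite ger0_norm//; apply: L2le_dom.
  by apply: measurable_funB;
    apply: (measurable_lipschitz_comp (f := fun v => b v i 0)) => //; exact: b_coord_lip.
move=> w; rewrite [leRHS]ger0_norm; last by rewrite mulr_ge0// sumr_ge0.
apply: le_trans (b_coord_lip bL i _ _) _; apply: ler_wpM2l => //.
apply: le_trans (vnorm_le_sum _) _; rewrite le_eqVlt; apply/orP; left; apply/eqP.
by apply: eq_bigr => j _; rewrite !mxE.
Qed.

Lemma solution_regular : exists cb Cx, [/\ 0 < cb, 0 < Cx,
  forall t i, 0 <= t <= T -> L2le P (fun w => bx i (t, w)) cb &
  forall t s i, 0 <= s -> s <= t -> t <= T ->
    L2le P (fun w => bx i (t, w) - bx i (s, w)) (Cx * (t - s) `^ theta)].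
Proof.
have [Mx [Mx0 hx]] := xc_moment_bound.
have M0 := ltW Mx0.
pose cb := vnorm (b 0) + L * (d%:R * Mx) + 1.
have cb0 : 0 < cb by rewrite ltr_wpDl// addr_ge0 ?vnorm_ge0// !mulr_ge0.
have hb t i : 0 <= t <= T -> L2le P (fun w => bx i (t, w)) cb.
  move=> tT; have := @bx_L2le i t Mx M0 (fun j => hx t j tT).
  by apply: L2le_mono; rewrite lerDl.
pose K := CG + g * (cb * (Cfrac alpha alpha * T `^ (alpha - theta))).
have Cf : 0 < Cfrac alpha alpha.
  by rewrite addr_gt0 ?invr_gt0// mulr_gt0// subr_gt0; case/andP: a01.
have K0 : 0 <= K.
  by rewrite addr_ge0// !mulr_ge0 ?powR_ge0// ltW.
have hxd t s i : 0 <= s -> s <= t -> t <= T ->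
    L2le P (fun w => xc t w i 0 - xc s w i 0) (K * (t - s) `^ theta).
  move=> s0 st tT.
  have st' : 0 <= s <= t by rewrite s0.
  have := @fint_holder _ _ _ P alpha a01 (bx i) (bx_measurable T0 bL mx cx i)
    (bx_bounded T0 L0 bL cx i) s t cb st' cb0.
  move=> /(_ _)/wrap[|hf].
    by move=> r /andP[r0 rt]; apply: hb; rewrite r0 (le_trans rt).
  have := L2leD (Gt_holder i s0 st tT) (L2leZ g hf); rewrite ger0_norm// => h.
  rewrite (_ : (fun w => _) = fun w => Gt i t w - Gt i s w +
     g * (fint alpha (bx i) t w - fint alpha (bx i) s w)); last first.
    by apply/funext => w; rewrite /Gt; move: (fint _ _ _ _) (fint _ _ _ _) => y z; ring.
  apply: L2le_mono h; rewrite /K [leRHS]mulrDl lerD2l -!mulrA.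
  do 3 (apply: ler_wpM2l => //; rewrite ?(ltW cb0) ?(ltW Cf)//).
  have [e|n0] := eqVneq (t - s) 0.
    by rewrite e powR0 ?gt_eqF// mulr_ge0 ?powR_ge0.
  have ts : 0 < t - s by rewrite lt_neqAle eq_sym n0 subr_ge0.
  have -> : (t - s) `^ alpha = (t - s) `^ (alpha - theta) * (t - s) `^ theta.
    by rewrite -powR_split// subrK.
  rewrite ler_wpM2r ?powR_ge0//.
  rewrite ge0_ler_powR ?nnegrE ?subr_ge0 ?(ltW T0)//; first by case/andP: th0.
  by rewrite lerBlDr (le_trans tT)// lerDl.
exists cb, (L * (d%:R * K) + 1); split => //.
  by rewrite ltr_wpDl// !mulr_ge0.
move=> t s i s0 st tT.
have := @b_diff_L2le i (xc t) (xc s) (K * (t - s) `^ theta) (fun j => mx _ j) (fun j => mx _ j)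
  (fun j => hxd t s j s0 st tT).
apply: L2le_mono; rewrite !mulrA ler_wpM2r ?powR_ge0// -!mulrA lerDl//.
Qed.

End solution_holder.

(** * The fast scheme *)

Section kernel_weights.
Context {R : realType}.
Variables (alpha k : R).
Hypotheses (a01 : 0 < alpha < 1) (k0 : 0 < k).
Local Notation mu := (@lebesgue_measure R).

Let a0 : 0 < alpha. Proof. by case/andP: a01. Qed.

Definition kw (n j : nat) : R :=
  ((n%:R * k - j%:R * k) `^ alpha - (n%:R * k - j.+1%:R * k) `^ alpha) / alpha.

Lemma kw_integral n j : (j < n)%N ->
  \int[mu]_(s in `[j%:R * k, j.+1%:R * k]) kern alpha (n%:R * k) s = kw n j.
Proof.
move=> jn; rewrite /Rintegral integral_kern//.
  by rewrite ler_pM2r// ler_nat.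
by rewrite ler_pM2r// ler_nat.
Qed.

Lemma kw_ge0 n j : (j < n)%N -> 0 <= kw n j.
Proof.
move=> jn.
rewrite divr_ge0 ?(ltW a0)// subr_ge0 ge0_ler_powR ?nnegrE ?(ltW a0)//.
- by rewrite subr_ge0 ler_pM2r// ler_nat.
- by rewrite subr_ge0 ler_pM2r// ler_nat ltnW.
- by rewrite lerB// ler_pM2r// ler_nat.
Qed.

Lemma kw_le n j : (j < n)%N -> kw n j <= alpha^-1 * (k * ((n - j)%:R * k) `^ (alpha - 1)).
Proof.
move=> jn.
rewrite /kw mulrC ler_pM2l ?invr_gt0// -mulrBl -mulrBl -natrB ?(ltnW jn)// -natrB//.
have nj : 0 < (n - j)%:R * k by rewrite mulr_gt0// ltr0n subn_gt0.
have := @subr_powR_le R ((n - j)%:R * k) ((n - j.+1)%:R * k) alpha.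
rewrite -mulrBl -natrB ?leq_sub2l// (_ : (n - j - (n - j.+1) = 1)%N); last by clear -jn; lia.
rewrite mul1r => h; apply: le_trans (h _ _ _) _ => //.
- by rewrite mulr_ge0 ?(ltW k0)//= ler_pM2r// ler_nat leq_sub2l.
- by rewrite a0 ltW//; case/andP: a01.
- by rewrite mulrC.
Qed.

Lemma kw_sum n : \sum_(j < n) kw n j = (n%:R * k) `^ alpha / alpha.
Proof.
rewrite -mulr_suml; congr (_ / _).
pose f j := - (n%:R * k - j%:R * k) `^ alpha : R.
rewrite (eq_bigr (fun j : 'I_n => f j.+1 - f j)); last by move=> j _; rewrite /f opprK addrC.
rewrite -(big_mkord xpredT (fun j => f j.+1 - f j)) telescope_sumr//.
by rewrite /f subrr powR0 ?gt_eqF// oppr0 sub0r opprK mul0r subr0.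
Qed.

End kernel_weights.

Section weights.
Context {R : realType}.
Variables (T alpha g k eps : R) (N : nat) (gam : R -> R).
Hypotheses (T0 : 0 < T) (a01 : 0 < alpha < 1) (g0 : 0 <= g) (N0 : (0 < N)%N).
Hypotheses (kE : k = T / N%:R) (e01 : 0 <= eps <= 1).
Hypothesis mgam : measurable_fun setT gam.
Hypothesis hgam : forall t, 0 <= t <= T -> `|gam t - g * t `^ (alpha - 1)| <= g * eps.
Local Notation mu := (@lebesgue_measure R).

Let a0 : 0 < alpha. Proof. by case/andP: a01. Qed.

Lemma step_gt0 : 0 < k.
Proof. by rewrite kE divr_gt0// ltr0n. Qed.

Lemma step_le n : (n <= N)%N -> n%:R * k <= T.
Proof.
move=> nN; rewrite kE mulrCA ger_pMr// ler_pdivrMr ?ltr0n// mul1r ler_nat//.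
Qed.

Lemma soe_weight_dist n j : (n <= N)%N -> (j < n)%N ->
  `|soe_weight gam k n j - g * kw alpha k n j| <= g * eps * k.
Proof.
move=> nN jn; have k0 := step_gt0.
have jk : j%:R * k <= j.+1%:R * k by rewrite ler_pM2r// ler_nat.
have jn' : j.+1%:R * k <= n%:R * k by rewrite ler_pM2r// ler_nat.
pose D : set (measurableTypeR R) := `[j%:R * k, j.+1%:R * k]%classic.
rewrite /soe_weight (_ : [set s | _] = D); last first.
  by apply/seteqP; split => s /=; rewrite /D /= in_itv.
pose dl s := gam (n%:R * k - s) - g * kern alpha (n%:R * k) s.
have mdl : measurable_fun setT dl.
  apply: measurable_funB; last by apply: measurable_funM => //; exact: measurable_kern.
  by apply: (measurableT_comp mgam); exact: measurable_funB.
have hdl s : D s -> `|dl s| <= g * eps.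
  rewrite /D /= in_itv/= => /andP[s1 s2]; apply: hgam.
  rewrite subr_ge0 (le_trans s2 jn')/= lerBlDr (le_trans (step_le nN))// lerDl.
  by apply: le_trans s1; rewrite mulr_ge0// ltW.
have mD : measurable D by exact: measurable_itv.
have muD : mu D = k%:E.
  rewrite /D lebesgue_measure_itv/= lte_fin ltr_pM2r// ltr_nat ltnSn.
  by rewrite -EFinB -mulrBl -natrB// subSnn mul1r.
have idl : mu.-integrable D (EFin \o dl).
  apply/integrableP; split.
    by apply/measurable_EFinP; exact: measurable_funTS.
  apply: (@le_lt_trans _ _ (\int[mu]_(s in D) (g * eps)%:E)%E).
    apply: ge0_le_integral => //.
    by apply: measurableT_comp => //; apply/measurable_EFinP; exact: measurable_funTS.
  by rewrite integral_cst//= -/D muD -EFinM ltry.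
have ik : mu.-integrable D (EFin \o (fun s => kern alpha (n%:R * k) s * g)).
  exact: (@kern_integrable _ alpha a01 _ _ _ (cst g) `|g|).
have ig : mu.-integrable D (EFin \o (fun s => gam (n%:R * k - s))).
  rewrite (_ : (fun s => _) = fun s => dl s + kern alpha (n%:R * k) s * g); last first.
    by apply/funext => s; rewrite /dl [kern _ _ _ * g]mulrC subrK.
  exact: (integrableD mD idl ik).
have -> : g * kw alpha k n j = \int[mu]_(s in D) (kern alpha (n%:R * k) s * g).
  rewrite RintegralZr//; first by rewrite kw_integral// mulrC.
  have := @kern_integrable _ alpha a01 (n%:R * k) (j%:R * k) (j.+1%:R * k) (cst 1) 1 jn' (measurable_cst _).
  rewrite (_ : (fun u => _ * cst 1 u) = kern alpha (n%:R * k)); last first.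
    by apply/funext => u; rewrite /= mulr1.
  by apply => u; rewrite normr1.
rewrite -RintegralB// (_ : (fun s => _) = dl); last first.
  by apply/funext => s; rewrite /dl [kern _ _ _ * g]mulrC.
apply: le_trans (le_normr_Rintegral mD idl) _.
apply: (@le_trans _ _ (\int[mu]_(s in D) (g * eps))); last by rewrite Rintegral_cst//= muD.
apply: le_Rintegral => //; first exact: integrable_norm.
apply/integrableP; split; first exact/measurable_EFinP/measurable_cst.
by rewrite /= integral_cst//= -/D muD -EFinM ltry.
Qed.

Definition Cw : R := g * (alpha^-1 + T `^ (1 - alpha)).

Lemma soe_weight_le n j : (n <= N)%N -> (j < n)%N ->
  `|soe_weight gam k n j| <= Cw * (k * ((n - j)%:R * k) `^ (alpha - 1)).
Proof.
move=> nN jn; have k0 := step_gt0.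
rewrite -[soe_weight _ _ _ _](subrK (g * kw alpha k n j)).
apply: le_trans (ler_normD _ _) _; rewrite addrC /Cw mulrDr [leRHS]mulrDl.
apply: lerD.
  rewrite ger0_norm; last by apply: mulr_ge0 => //; exact: kw_ge0.
  by rewrite -[leRHS]mulrA ler_wpM2l// kw_le.
apply: le_trans (soe_weight_dist nN jn) _.
rewrite -!mulrA ler_wpM2l//.
have nj : 0 < (n - j)%:R * k by rewrite mulr_gt0// ltr0n subn_gt0.
apply: (@le_trans _ _ (1 * k)); first by rewrite ler_pM2r//; case/andP: e01.
rewrite mul1r mulrCA ler_peMr ?(ltW k0)//.
apply: (@le_trans _ _ (((n - j)%:R * k) `^ (1 - alpha) * ((n - j)%:R * k) `^ (alpha - 1))).
  by rewrite -powR_split// addrA subrK subrr powRr0.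
rewrite ler_wpM2r ?powR_ge0// ge0_ler_powR ?nnegrE ?(ltW nj) ?(ltW T0)//.
  by rewrite subr_ge0 ltW//; case/andP: a01.
by apply: step_le; rewrite (leq_trans (leq_subr _ _)).
Qed.

Lemma sum_kernel_exp n lam : (n <= N)%N -> 0 < lam ->
  \sum_(j < n) k * ((n - j)%:R * k) `^ (alpha - 1) * expR (lam * (j%:R * k)) <=
  expR (lam * (n%:R * k)) * (lam `^ (- (alpha / 2)) * (T `^ (alpha / 2) / (alpha / 2))).
Proof.
move=> nN l0; have k0 := step_gt0; have q0 : 0 < alpha / 2 by rewrite divr_gt0.
have q1 : alpha / 2 < 1 by case/andP: a01 => _; lra.
apply: (@le_trans _ _ (\sum_(j < n) expR (lam * (n%:R * k)) *
   (lam `^ (- (alpha / 2)) * (k `^ (alpha / 2) * (n - j)%:R `^ (alpha / 2 - 1))))).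
  apply: ler_sum => j _; have nj : 0 < (n - j)%:R :> R by rewrite ltr0n subn_gt0.
  have -> : lam * (j%:R * k) = lam * (n%:R * k) + - (lam * ((n - j)%:R * k)).
    by rewrite natrB ?(ltnW (ltn_ord j))//; ring.
  rewrite expRD mulrCA ler_wpM2l ?expR_ge0//.
  have pos : 0 < lam * ((n - j)%:R * k) by rewrite !mulr_gt0.
  have h := @expRN_le_powR R (lam * ((n - j)%:R * k)) (alpha / 2) pos.
  apply: le_trans (ler_wpM2l _ (h _)) _.
  - by rewrite mulr_ge0 ?powR_ge0// ltW.
  - by rewrite (ltW q0) ltW.
  rewrite !powRM ?(ltW l0) ?(ltW k0) ?(ltW nj) ?mulr_ge0 ?(ltW k0) ?(ltW nj)//.
  move: (n - j)%:R nj => x x0.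
  have -> : x `^ (alpha / 2 - 1) = x `^ (alpha - 1) * x `^ (- (alpha / 2)).
    by rewrite -powR_split//; congr (_ `^ _); field.
  have -> : k `^ (alpha / 2) = k * (k `^ (alpha - 1) * k `^ (- (alpha / 2))).
    by rewrite -{2}[k]powRr1 ?(ltW k0)// -!powR_split//; congr (_ `^ _); field.
  by rewrite le_eqVlt; apply/orP; left; apply/eqP; ring.
rewrite -mulr_sumr ler_wpM2l ?expR_ge0// -mulr_sumr ler_wpM2l ?powR_ge0// -mulr_sumr.
rewrite (reindex_inj rev_ord_inj)/= (eq_bigr (fun i : 'I_n => i.+1%:R `^ (alpha / 2 - 1))); last first.
  by move=> i _; rewrite subKn.
apply: le_trans (ler_wpM2l (powR_ge0 _ _) (@sum_powR_le R (alpha / 2) n _)) _.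
  by rewrite q0 ltW.
rewrite mulrA ler_pM2r ?invr_gt0// -powRM ?(ltW k0)// mulrC.
rewrite ge0_ler_powR ?nnegrE ?(ltW T0) ?(ltW q0)//; last exact: step_le.
by rewrite mulr_ge0 ?(ltW k0).
Qed.

End weights.

Lemma Rintegral_grid_sum {R : realType} (f : R -> R) (k : R) (n : nat) : 0 < k ->
  (@lebesgue_measure R).-integrable `[0, n%:R * k] (EFin \o f) ->
  \int[lebesgue_measure]_(s in `[0, n%:R * k]) f s =
  \sum_(j < n) \int[lebesgue_measure]_(s in `[j%:R * k, j.+1%:R * k]) f s.
Proof.
move=> k0; elim: n => [|n IH] fi.
  by rewrite mul0r set_itv1 Rintegral_set1 big_ord0.
have nk : n%:R * k <= n.+1%:R * k by rewrite ler_pM2r// ler_nat.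
have nk0 : 0 <= n%:R * k by rewrite mulr_ge0// ltW.
rewrite big_ord_recr/= -IH; last first.
  by apply: integrableS fi => //; apply: subset_itvl; rewrite bnd_simp.
have e := @Rintegral_itvB R f (BLeft 0) (BRight (n.+1%:R * k)) (n%:R * k) fi.
rewrite !bnd_simp in e; have {}e := e nk0 nk.
rewrite Rintegral_itv_obnd_cbnd in e; first by rewrite -e addrC subrK.
by apply: integrableS fi => //; apply: subset_itvr; rewrite bnd_simp.
Qed.

Section fast_scheme.
Context {R : realType} {d0 : measure_display} {Omega : measurableType d0}.
Variables (d : nat) (gam : R -> R) (k : R) (b : 'cV[R]_d -> 'cV[R]_d).
Variables (x0 : Omega -> 'cV[R]_d) (G : R -> Omega -> 'cV[R]_d).

Lemma size_fast_list w n : size (fast_list gam k b x0 G w n) = n.+1.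
Proof. by elim: n => //= n IH; rewrite size_rcons IH. Qed.

Lemma nth_fast_list w n j : (j <= n)%N ->
  nth 0 (fast_list gam k b x0 G w n) j = fast_scheme gam k b x0 G j w.
Proof.
elim: n => [|n IH]; first by rewrite leqn0 => /eqP ->.
rewrite leq_eqVlt => /predU1P[->//|jn].
by rewrite /= nth_rcons size_fast_list jn IH.
Qed.

Lemma fast_schemeE w n : fast_scheme gam k b x0 G n w =
  x0 w + \sum_(j < n) soe_weight gam k n j *: b (fast_scheme gam k b x0 G j w)
  + G (n%:R * k) w.
Proof.
rewrite /fast_scheme; case: n => [|n]; first by rewrite /= big_ord0 addr0 mul0r.
rewrite /= nth_rcons size_fast_list ltnn eqxx; congr (_ + _ + _).
by apply: eq_bigr => j _; rewrite nth_fast_list// -ltnS.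
Qed.

End fast_scheme.

Section scheme_error.
Context {R : realType} {d0 : measure_display} {Omega : measurableType d0}.
Variable P : probability Omega R.
Variables (T alpha g L : R) (d : nat) (b : 'cV[R]_d -> 'cV[R]_d).
Variables (x0 : Omega -> 'cV[R]_d) (x G : R -> Omega -> 'cV[R]_d).
Hypotheses (T0 : 0 < T) (a01 : 0 < alpha < 1) (L0 : 0 <= L) (g0 : 0 <= g).
Hypothesis bL : forall u v, vnorm (b u - b v) <= L * vnorm (u - v).
Hypothesis mx0 : forall i, measurable_fun setT (fun w => x0 w i 0).
Hypothesis mx : forall t i, measurable_fun setT (fun w => x t w i 0).
Hypothesis cx : forall w i,
  {within [set t : R | 0 <= t <= T], continuous (fun t => x t w i 0)}.
Hypothesis mG : forall i t, 0 <= t <= T -> measurable_fun setT (fun w => G t w i 0).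
Hypothesis GtG : forall i t, 0 <= t <= T ->
  {ae P, forall w, Gt T alpha g b x0 x i t w = G t w i 0}.
Variable cb : R.
Hypothesis cb0 : 0 < cb.
Hypothesis hcb : forall t i, 0 <= t <= T -> L2le P (fun w => bx T b x i (t, w)) cb.
Local Notation xc := (xc T x).
Local Notation bx := (bx T b x).
Local Notation Gt := (Gt T alpha g b x0 x).
Local Notation mu := (@lebesgue_measure R).

Let a0 : 0 < alpha. Proof. by case/andP: a01. Qed.

(* The quadrature error of the left-point rule for the exact kernel. *)
Definition qrem (f : measurableTypeR R * Omega -> R) (k : R) (n : nat) (w : Omega) : R :=
  \sum_(j < n) \int[mu]_(s in `[j%:R * k, j.+1%:R * k])
     (kern alpha (n%:R * k) s * (f (s, w) - f (j%:R * k, w))).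

Lemma qremE (f : measurableTypeR R * Omega -> R) k n w : 0 < k -> measurable_fun setT f ->
  (forall w, exists M, forall s, `|f (s, w)| <= M) ->
  qrem f k n w = fint alpha f (n%:R * k) w - \sum_(j < n) kw alpha k n j * f (j%:R * k, w).
Proof.
move=> k0 mf fb; rewrite /fint Rintegral_grid_sum//; last exact: process_integrable.
rewrite -sumrB; apply: eq_bigr => j _.
have jn : j.+1%:R * k <= n%:R * k by rewrite ler_pM2r// ler_nat.
under eq_Rintegral do rewrite mulrBr.
rewrite RintegralB//; last 2 first.
- exact: process_integrable.
- by apply: (@kern_integrable _ alpha a01 _ _ _ (cst (f (j%:R * k, w))) `|f (j%:R * k, w)|).
rewrite RintegralZr//; last first.
  have := @kern_integrable _ alpha a01 (n%:R * k) (j%:R * k) (j.+1%:R * k) (cst 1) 1 jn (measurable_cst _).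
  rewrite (_ : (fun u => _ * cst 1 u) = kern alpha (n%:R * k)); last first.
    by apply/funext => u; rewrite /= mulr1.
  by apply => u; rewrite normr1.
congr (_ - _ * _); rewrite /Rintegral integral_kern// ler_pM2r// ler_nat//.
Qed.

Section step.
Variables (N : nat) (eps : R) (gam : R -> R).
Hypotheses (N0 : (0 < N)%N) (e01 : 0 <= eps <= 1).
Hypothesis mgam : measurable_fun setT gam.
Hypothesis hgam : forall t, 0 <= t <= T -> `|gam t - g * t `^ (alpha - 1)| <= g * eps.
Let k := T / N%:R.
Local Notation y := (fast_scheme gam k b x0 G).

Let k0 : 0 < k. Proof. by rewrite divr_gt0// ltr0n. Qed.
Let tn n : (n <= N)%N -> 0 <= n%:R * k <= T.
Proof. by move=> nN; rewrite mulr_ge0 ?(ltW k0)//=; apply: (@step_le _ _ _ N). Qed.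

Lemma scheme_measurable n i : (n <= N)%N -> measurable_fun setT (fun w => y n w i 0).
Proof.
elim/ltn_ind: n i => n IH i nN.
have -> : (fun w => y n w i 0) = fun w => x0 w i 0 +
    \sum_(j < n) soe_weight gam k n j * b (y j w) i 0 + G (n%:R * k) w i 0.
  apply/funext => w; rewrite fast_schemeE !mxE summxE; congr (_ + _ + _).
  by apply: eq_bigr => j _; rewrite mxE.
apply: measurable_funD; last by apply: mG; exact: tn.
apply: measurable_funD => //; apply: measurable_sum => j.
apply: measurable_funM => //.
apply: (measurable_lipschitz_comp (f := fun v => b v i 0)); first exact: b_coord_lip.
by move=> l; apply: IH => //; rewrite (leq_trans (ltnW (ltn_ord j))).
Qed.

Lemma scheme_error_eq n i : (n <= N)%N -> {ae P, forall w,
  y n w i 0 - xc (n%:R * k) w i 0 =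
  \sum_(j < n) soe_weight gam k n j * (b (y j w) i 0 - b (xc (j%:R * k) w) i 0) +
  \sum_(j < n) (soe_weight gam k n j - g * kw alpha k n j) * bx i (j%:R * k, w) -
  g * qrem (bx i) k n w}.
Proof.
move=> nN; have := @GtG i (n%:R * k) (tn nN); apply: filterS => w hw.
rewrite fast_schemeE !mxE -hw summxE qremE//; last 2 first.
- exact: (bx_measurable T0 bL mx cx i).
- exact: (bx_bounded T0 L0 bL cx).
rewrite /Gt.
have -> : \sum_(j < n) (soe_weight gam k n j *: b (y j w)) i 0 =
  \sum_(j < n) soe_weight gam k n j * (b (y j w) i 0 - b (xc (j%:R * k) w) i 0) +
  \sum_(j < n) (soe_weight gam k n j - g * kw alpha k n j) * bx i (j%:R * k, w) +
  g * \sum_(j < n) kw alpha k n j * bx i (j%:R * k, w).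
  rewrite mulr_sumr -!big_split/=; apply: eq_bigr => j _.
  rewrite mxE /bx/=; ring.
move: (\sum_(j < n) _) (\sum_(j < n) _) (\sum_(j < n) _) (fint _ _ _ _) => p q r f; ring.
Qed.

Lemma scheme_gronwall r lam : 0 <= r -> 0 < lam ->
  L * d%:R * Cw T alpha g * (lam `^ (- (alpha / 2)) * (T `^ (alpha / 2) / (alpha / 2))) <= 2^-1 ->
  (forall n i, (n <= N)%N -> L2le P (qrem (bx i) k n) r) ->
  forall n i, (n <= N)%N -> L2le P (fun w => y n w i 0 - xc (n%:R * k) w i 0)
    (2 * (g * eps * T * cb + g * r) * expR (lam * (n%:R * k))).
Proof.
move=> r0 l0 hl hr; elim/ltn_ind => n IH i nN.
have e0 : 0 <= eps by case/andP: e01.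
set A := g * eps * T * cb + g * r.
have A0 : 0 <= A.
  by rewrite addr_ge0 ?mulr_ge0 ?(ltW T0) ?(ltW cb0).
apply: L2le_ae (scheme_error_eq i nN) _.
  by apply: measurable_funB; [exact: scheme_measurable|exact: mx].
have h1 : L2le P (fun w => \sum_(j < n) soe_weight gam k n j *
    (b (y j w) i 0 - b (xc (j%:R * k) w) i 0))
    (\sum_(j < n) `|soe_weight gam k n j| * (L * (d%:R * (2 * A * expR (lam * (j%:R * k)))))).
  apply: L2le_sum => j _; apply: L2leZ; have jn := ltn_ord j.
  have jN : (j <= N)%N by rewrite (leq_trans (ltnW jn)).
  apply: (b_diff_L2le L0 bL) => l; [exact: scheme_measurable|exact: mx|exact: IH].
have h2 : L2le P (fun w => \sum_(j < n) (soe_weight gam k n j - g * kw alpha k n j) *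
    bx i (j%:R * k, w)) (\sum_(j < n) g * eps * k * cb).
  apply: L2le_sum => j _; have jn := ltn_ord j.
  have jN : (j <= N)%N by rewrite (leq_trans (ltnW jn)).
  apply: L2le_mono (L2leZ _ (hcb i (tn jN))).
  rewrite ler_wpM2r ?(ltW cb0)//.
  by apply: (@soe_weight_dist _ T alpha g k eps N gam).
have := L2leB (L2leD h1 h2) (L2leZ g (hr n i nN)); rewrite ger0_norm//.
apply: L2le_mono.
have /andP[nk0 nkT] := tn nN.
have et : 1 <= expR (lam * (n%:R * k)).
  by rewrite -[leLHS]expR0 ler_expR; exact: (mulr_ge0 (ltW l0) nk0).
have b2 : \sum_(j < n) g * eps * k * cb <= g * eps * T * cb.
  rewrite sumr_const card_ord -mulr_natl.
  have -> : n%:R * (g * eps * k * cb) = g * eps * cb * (n%:R * k) by ring.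
  have -> : g * eps * T * cb = g * eps * cb * T by ring.
  by apply: ler_wpM2l => //; rewrite !mulr_ge0// ltW.
have b1 : \sum_(j < n) `|soe_weight gam k n j| * (L * (d%:R * (2 * A * expR (lam * (j%:R * k)))))
    <= A * expR (lam * (n%:R * k)).
  apply: (@le_trans _ _ (\sum_(j < n) (L * d%:R * Cw T alpha g * (2 * A)) *
     (k * ((n - j)%:R * k) `^ (alpha - 1) * expR (lam * (j%:R * k))))).
    apply: ler_sum => j _.
    have h := @soe_weight_le _ T alpha g k eps N gam T0 a01 g0 N0 erefl e01 mgam hgam n j nN (ltn_ord j).
    apply: le_trans (ler_wpM2r _ h) _; first by rewrite !mulr_ge0 ?expR_ge0.
    by rewrite le_eqVlt; apply/orP; left; apply/eqP; ring.
  rewrite -mulr_sumr.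
  have h := @sum_kernel_exp _ T alpha k N T0 a01 N0 erefl n lam nN l0.
  have C0 : 0 <= L * d%:R * Cw T alpha g * (2 * A).
    rewrite !mulr_ge0// addr_ge0 ?powR_ge0// invr_ge0 ltW//.
  apply: le_trans (ler_wpM2l C0 h) _.
  move: (expR _) et => e et; move: hl; move: (_ * (_ / _)) => z hl.
  have -> : L * d%:R * Cw T alpha g * (2 * A) * (e * z) = L * d%:R * Cw T alpha g * z * (2 * A * e) by ring.
  apply: (@le_trans _ _ (2^-1 * (2 * A * e))).
    by apply: ler_wpM2r => //; rewrite mulr_ge0// ?mulr_ge0// (le_trans ler01).
  by rewrite le_eqVlt; apply/orP; left; apply/eqP; field.
rewrite (_ : 2 * A * _ = A * expR (lam * (n%:R * k)) + A * expR (lam * (n%:R * k))); last by ring.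
rewrite -addrA; apply: lerD => //.
apply: (@le_trans _ _ A); first by rewrite /A lerD2r.
by rewrite ler_peMr.
Qed.

End step.

Theorem scheme_error : exists C, 0 <= C /\
  forall (N : nat) (eps : R) (gam : R -> R) (r : R), (0 < N)%N -> 0 <= eps <= 1 ->
  measurable_fun setT gam ->
  (forall t, 0 <= t <= T -> `|gam t - g * t `^ (alpha - 1)| <= g * eps) -> 0 <= r ->
  (forall n i, (n <= N)%N -> L2le P (qrem (bx i) (T / N%:R) n) r) ->
  forall n, (n <= N)%N ->
    (err2 P gam (T / N%:R) b x0 G x n <= ((C * (r + eps)) ^+ 2)%:E)%E.
Proof.
have Cw0 : 0 <= Cw T alpha g by rewrite mulr_ge0// addr_ge0 ?powR_ge0// invr_ge0 ltW.
have c0 : 0 <= L * d%:R * Cw T alpha g * (T `^ (alpha / 2) / (alpha / 2)).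
  apply: mulr_ge0; first by apply: mulr_ge0 => //; exact: mulr_ge0.
  by rewrite divr_ge0 ?powR_ge0// divr_ge0// ltW.
have [lam [l0 hl]] := exists_rate c0 (divr_gt0 a0 (ltr0n _ 2)).
exists (d%:R * (2 * (g * (T * cb + 1)) * expR (lam * T))); split.
  by rewrite !mulr_ge0 ?expR_ge0// addr_ge0// mulr_ge0// ltW.
move=> N eps gam r N0 e01 mgam hgam r0 hr n nN.
have e0 : 0 <= eps by case/andP: e01.
have hy : forall i, L2le P (fun w => fast_scheme gam (T / N%:R) b x0 G n w i 0 -
   xc (n%:R * (T / N%:R)) w i 0) (2 * (g * (T * cb + 1)) * expR (lam * T) * (r + eps)).
  move=> i; have := @scheme_gronwall N eps gam N0 e01 mgam hgam r lam r0 l0 _ hr n i nN.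
  move=> /(_ _)/wrap[|]; first by rewrite [_ * (_ / _)]mulrC mulrA.
  apply: L2le_mono; rewrite [leRHS]mulrAC; apply: ler_pM.
  - by rewrite mulr_ge0// addr_ge0 ?mulr_ge0 ?(ltW T0) ?(ltW cb0).
  - exact: expR_ge0.
  - rewrite -!mulrA ler_wpM2l//.
    have -> : g * (eps * (T * cb)) + g * r = g * (T * cb * eps + r) by ring.
    rewrite ler_wpM2l//.
    have -> : (T * cb + 1) * (r + eps) = T * cb * eps + r + (T * cb * r + eps) by ring.
    by rewrite lerDl addr_ge0// !mulr_ge0// ltW.
  - by rewrite ler_expR ler_pM2l//; apply: (@step_le _ _ _ N).
have hS : L2le P (fun w => \sum_(i < d) `|fast_scheme gam (T / N%:R) b x0 G n w i 0 -
   xc (n%:R * (T / N%:R)) w i 0|) (d%:R * (2 * (g * (T * cb + 1)) * expR (lam * T) * (r + eps))).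
  move: (2 * _ * _ * _) hy => K hy.
  have -> : d%:R * K = \sum_(i < d) K by rewrite sumr_const card_ord mulr_natl.
  by apply: L2le_sum => i _; exact: L2le_norm.
have [mS _ iS] := hS; rewrite -[_ * (r + eps)]mulrA; apply: le_trans iS.
have tnT : 0 <= n%:R * (T / N%:R) <= T.
  by rewrite mulr_ge0 ?divr_ge0 ?(ltW T0)//=; apply: (@step_le _ _ _ N).
apply: ge0_le_integral => //.
- by move=> w _; rewrite lee_fin nrm2_ge0.
- apply/measurable_EFinP; apply: measurable_sum => i; apply: measurable_funX.
  have -> : (fun w => (fast_scheme gam (T / N%:R) b x0 G n w - x (n%:R * (T / N%:R)) w) i 0) =
    fun w => fast_scheme gam (T / N%:R) b x0 G n w i 0 - x (n%:R * (T / N%:R)) w i 0.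
    by apply/funext => w; rewrite !mxE.
  apply: measurable_funB => //; exact: (@scheme_measurable N).
- exact: measurable_EFin_sqr.
move=> w _; rewrite lee_fin /nrm2.
rewrite (eq_bigr (fun i => `|fast_scheme gam (T / N%:R) b x0 G n w i 0 -
   xc (n%:R * (T / N%:R)) w i 0| ^+ 2)); last first.
  by move=> i _; rewrite !mxE real_normK ?num_real// xc_id.
exact: sum_sqr_le_sqr_sum.
Qed.

End scheme_error.

(** * The first rate *)

Section quadrature.
Context {R : realType} {d0 : measure_display} {Omega : measurableType d0}.
Variable P : probability Omega R.
Variable alpha : R.
Hypothesis a01 : 0 < alpha < 1.
Local Notation mu := (@lebesgue_measure R).

Lemma cell_L2le (f : measurableTypeR R * Omega -> R) (k K : R) (n j : nat) : 0 < k -> 0 <= K ->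
  measurable_fun setT f -> (j < n)%N ->
  (forall s, j%:R * k <= s <= j.+1%:R * k -> L2le P (fun w => f (s, w) - f (j%:R * k, w)) K) ->
  L2le P (fun w => \int[mu]_(s in `[j%:R * k, j.+1%:R * k])
     (kern alpha (n%:R * k) s * (f (s, w) - f (j%:R * k, w)))) (K * kw alpha k n j).
Proof.
move=> k0 K0 mf jn hf.
pose f' (z : measurableTypeR R * Omega) := f z - f (j%:R * k, z.2).
have mf' : measurable_fun setT f'.
  apply: measurable_funB => //.
  exact: (measurableT_comp mf (measurableT_comp (measurable_pair1 (j%:R * k : R)) measurable_snd)).
apply: (@kern_process_L2le_cst _ _ _ P alpha a01 f' mf' (n%:R * k)) => //.
  by rewrite ler_pM2r// ler_nat.
by rewrite ler_pM2r// ler_nat.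
Qed.

Lemma qrem_L2le (f : measurableTypeR R * Omega -> R) (k K T : R) (n : nat) :
  0 < k -> 0 <= K -> n%:R * k <= T ->
  measurable_fun setT f ->
  (forall j s, (j < n)%N -> j%:R * k <= s <= j.+1%:R * k ->
     L2le P (fun w => f (s, w) - f (j%:R * k, w)) K) ->
  L2le P (qrem alpha f k n) (K * (T `^ alpha / alpha)).
Proof.
move=> k0 K0 nT mf hf; have a0 : 0 < alpha by case/andP: a01.
have h : L2le P (qrem alpha f k n) (\sum_(j < n) K * kw alpha k n j).
  by apply: L2le_sum => j _; apply: cell_L2le => // s; apply: hf.
apply: L2le_mono h; rewrite -mulr_sumr ler_wpM2l// kw_sum// ler_pM2r ?invr_gt0//.
have nk0 : 0 <= n%:R * k by rewrite mulr_ge0// ltW.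
by rewrite ge0_ler_powR ?nnegrE ?(ltW a0)// (le_trans nk0).
Qed.

End quadrature.

Section soe.
Context {R : realType}.
Variables (T alpha k eps : R) (M : nat) (om sv : 'I_M -> R).
Hypothesis g0 : 0 <= (Gammaf alpha)^-1.
Hypothesis e0 : 0 <= eps.
Hypothesis hsoe : forall t, k <= t <= T ->
  `|powR t (alpha - 1) - \sum_(i < M) om i * expR (- sv i * t)| <= eps.

Lemma soe_kernel_measurable : measurable_fun setT (soe_kernel alpha k om sv).
Proof.
apply: measurable_fun_if => //.
- apply: measurable_fun_ler => //.
- by apply: measurable_funTS; apply: measurable_funM => //; exact: measurable_powR.
- apply: measurable_funTS; apply: measurable_funM => //; apply: measurable_sum => i.
  apply: measurable_funM => //; apply: measurableT_comp => //; exact: measurable_funM.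
Qed.

Lemma soe_kernel_dist t : 0 <= t <= T ->
  `|soe_kernel alpha k om sv t - (Gammaf alpha)^-1 * t `^ (alpha - 1)| <= (Gammaf alpha)^-1 * eps.
Proof.
move=> /andP[t0 tT]; rewrite /soe_kernel; case: (leP t k) => [tk|kt].
  by rewrite subrr normr0 mulr_ge0.
rewrite -mulrBr normrM ger0_norm// ler_wpM2l// distrC; apply: hsoe.
by rewrite (ltW kt).
Qed.

End soe.

Section gamma.
Context {R : realType}.
Variable alpha : R.
Hypothesis a01 : 0 < alpha < 1.
Local Notation mu := (@lebesgue_measure R).

Lemma Gammaf_ge0 : 0 <= Gammaf alpha.
Proof. by apply: Rintegral_ge0 => x _; rewrite mulr_ge0 ?powR_ge0 ?expR_ge0. Qed.

Lemma Gammaf_gt0 : 0 < Gammaf alpha.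
Proof.
have a0 : 0 < alpha by case/andP: a01.
pose f (x : R) := x `^ (alpha - 1) * expR (- x).
have mf : measurable_fun setT f.
  apply: measurable_funM; first exact: measurable_powR.
  by apply: measurableT_comp => //; exact: measurableT_comp.
have f0 x : 0 <= f x by rewrite mulr_ge0 ?powR_ge0 ?expR_ge0.
have mfE (D : set R) : measurable_fun D (EFin \o f).
  by apply/measurable_EFinP; exact: measurable_funTS.
have mp : measurable_fun (`[0, 1]%classic : set R) (fun x : R => (x `^ (alpha - 1))%:E).
  by apply/measurable_EFinP; apply: measurable_funTS; exact: measurable_powR.
have DE : [set x : R | 0 <= x] = `[0, 1]%classic `|` `]1, +oo[%classic.
  apply/seteqP; split => x /=; rewrite !in_itv/= ?andbT.
    by move=> ->; case: (leP x 1) => _; [left|right].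
  by case=> [/andP[]//|/ltW]; exact: le_trans.
have I1 : (\int[mu]_(x in `[0%R, 1%R]) (x `^ (alpha - 1))%:E = (alpha^-1)%:E)%E.
  by rewrite integral_powR0// powR1 mul1r.
have split : (\int[mu]_(x in [set x : R | (0 <= x)%R]) (f x)%:E =
    \int[mu]_(x in `[0%R, 1%R]) (f x)%:E + \int[mu]_(x in `]1%R, +oo[) (f x)%:E)%E.
  rewrite DE ge0_integral_setU//.
  - exact: mfE.
  - by move=> x _; rewrite lee_fin.
  - apply/disj_setPS => x /=; rewrite !in_itv/= => -[/andP[_ x1]].
    by rewrite andbT ltNge x1.
have lo : ((expR (-1) / alpha)%:E <= \int[mu]_(x in `[0%R, 1%R]) (f x)%:E)%E.
  rewrite EFinM -I1 -ge0_integralZl//; last first.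
    by move=> x _; rewrite lee_fin powR_ge0.
  apply: ge0_le_integral => //.
  - by move=> x _; rewrite -EFinM lee_fin mulr_ge0 ?expR_ge0 ?powR_ge0.
  - exact: measurable_funeM.
  - exact: mfE.
  - move=> x /=; rewrite in_itv/= => /andP[_ x1]; rewrite -EFinM lee_fin mulrC.
    by rewrite ler_wpM2l ?powR_ge0// ler_expR lerN2.
have up1 : (\int[mu]_(x in `[0%R, 1%R]) (f x)%:E <= (alpha^-1)%:E)%E.
  rewrite -I1; apply: ge0_le_integral => //.
  - by move=> x _; rewrite lee_fin.
  - exact: mfE.
  - move=> x /=; rewrite in_itv/= => /andP[x0 _]; rewrite lee_fin ler_piMr ?powR_ge0//.
    by rewrite -expR0 ler_expR oppr_le0.
have mexp := @measurable_exponential_pdf R 1.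
have e0 (x : R) : 0 <= exponential_pdf 1 x by exact: exponential_pdf_ge0.
have up2 : (\int[mu]_(x in `]1%R, +oo[) (f x)%:E <= 1)%E.
  rewrite -(@integral_exponential_pdf R 1)//.
  apply: (@le_trans _ _ (\int[mu]_(x in `]1%R, +oo[) (exponential_pdf 1 x)%:E)%E).
    apply: ge0_le_integral => //.
    - by move=> x _; rewrite lee_fin.
    - exact: mfE.
    - by apply/measurable_EFinP; exact: measurable_funTS.
    move=> x /=; rewrite in_itv/= andbT => x1; have x0 : 0 <= x by rewrite (le_trans ler01)// ltW.
    rewrite lee_fin exponential_pdfE// mul1r mulN1r ler_piMl ?expR_ge0//.
    rewrite -[leRHS](powRr0 x) ler_powR ?(ltW x1)// subr_le0 ltW//; by case/andP: a01.
  apply: ge0_subset_integral => //; first exact/measurable_EFinP.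
  by move=> x _; rewrite lee_fin.
rewrite /Gammaf /Rintegral fine_gt0// split; apply/andP; split.
  apply: lt_le_trans (leeDl _ _); last by apply: integral_ge0 => x _; rewrite lee_fin.
  by apply: lt_le_trans lo; rewrite lte_fin divr_gt0 ?expR_gt0.
by apply: le_lt_trans (leeD up1 up2) _; rewrite -EFinD ltry.
Qed.

End gamma.

Section scalar_noise.
Context {R : realType} {d0 : measure_display} {Omega : measurableType d0}.
Variable P : probability Omega R.
Variables (T : R) (d : nat) (alpha H sigma : R).
Variables (Bh G : R -> Omega -> 'cV[R]_d).
Hypotheses (T0 : 0 < T) (a01 : 0 < alpha < 1) (H12 : 1 / 2 < H < 1) (s0 : 0 < sigma).
Hypothesis hB : is_fBm P H Bh.
Hypothesis hG : is_G P T alpha sigma Bh G.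

Lemma is_fBm_scalar i : (forall w, Bh 0 w i 0 = 0) /\
  (forall (m : nat) (ts c : 'I_m -> R), (forall l, 0 <= ts l) ->
     centered_gaussian P (fun w => \sum_(l < m) c l * Bh (ts l) w i 0)
       (\sum_(l < m) \sum_(l' < m) c l * c l' * fbm_cov H (ts l) (ts l'))).
Proof. by have [B0 [Bg _]] := hB; split => // m ts c; exact: Bg. Qed.

Let kap0 : 0 < sigma / Gammaf alpha.
Proof. by rewrite divr_gt0// Gammaf_gt0. Qed.

Lemma is_G_measurable i t : 0 <= t <= T -> measurable_fun setT (fun w => G t w i 0).
Proof. by move=> tT; have [mG _] := hG tT. Qed.

Lemma is_G_cvgL2 i t : 0 <= t <= T ->
  cvgL2 P (Gsum alpha (sigma / Gammaf alpha) (fun t w => Bh t w i 0) t) (fun w => G t w i 0).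
Proof.
move=> tT e e0; have [mG /fine_cvgP[cfin /cvgrPdist_lt cG]] := hG tT.
have [B0 Bg] := is_fBm_scalar i.
have e2 : 0 < e ^+ 2 by rewrite exprn_gt0.
have {}cG := cG _ e2; near=> n.
have n0 : (0 < n)%N by near: n; exact: nbhs_infty_gt.
have t0 : 0 <= t by case/andP: tT.
have [c hS] := @Gsum_L2 _ _ _ P H alpha (sigma / Gammaf alpha) (fun t w => Bh t w i 0) H12 B0 Bg t n t0 n0.
split; [by apply: measurable_funB => //; exact: L2le_measurable hS|exact: ltW|].
have fn : (\int[P]_w (nrm2 (G t w - RL_sum alpha sigma Bh t n w))%:E)%E \is a fin_num by near: n.
have : `|0 - fine (\int[P]_w (nrm2 (G t w - RL_sum alpha sigma Bh t n w))%:E)%E| < e ^+ 2 by near: n.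
rewrite sub0r normrN => /(le_lt_trans (ler_norm _)) h.
apply: (@le_trans _ _ (\int[P]_w (nrm2 (G t w - RL_sum alpha sigma Bh t n w))%:E)%E); last first.
  by rewrite -(fineK fn) lee_fin ltW.
have GE w j : (G t w - RL_sum alpha sigma Bh t n w) j 0 = G t w j 0 -
    Gsum alpha (sigma / Gammaf alpha) (fun t w => Bh t w j 0) t n w.
  rewrite !mxE summxE /Gsum; congr (_ - _ * _).
  by apply: eq_bigr => l _; rewrite !mxE.
have mS j : measurable_fun setT (Gsum alpha (sigma / Gammaf alpha) (fun t w => Bh t w j 0) t n).
  have [B0' Bg'] := is_fBm_scalar j.
  have [c' hS'] := @Gsum_L2 _ _ _ P H alpha (sigma / Gammaf alpha) (fun t w => Bh t w j 0) H12 B0' Bg' t n t0 n0.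
  exact: L2le_measurable hS'.
apply: ge0_le_integral => //.
- by move=> w _; rewrite lee_fin sqr_ge0.
- by apply: measurable_EFin_sqr; apply: measurable_funB.
- apply/measurable_EFinP; apply: measurable_sum => j; apply: measurable_funX.
  by under eq_fun do rewrite GE; exact: measurable_funB.
move=> w _; rewrite lee_fin -GE /nrm2 (bigD1 i)//= lerDl.
by apply: sumr_ge0 => j _; exact: sqr_ge0.
Unshelve. all: by end_near. Qed.

Lemma theta_nonneg : (0 < d)%N -> 0 <= H + alpha - 1.
Proof.
move=> dp; pose i := Ordinal dp.
have [B0 Bg] := is_fBm_scalar i.
have := @theta_ge0 _ _ _ P H alpha _ T (fun t w => Bh t w i 0) (fun t w => G t w i 0)
  H12 T0 B0 Bg (@is_G_cvgL2 i) kap0.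
by rewrite [alpha + H]addrC.
Qed.

Lemma G_grid_bound : (0 < d)%N -> exists CG, 0 <= CG /\
  forall i (m n : nat) u, 0 < u -> (m <= n)%N -> n%:R * u <= T ->
  L2le P (fun w => G (n%:R * u) w i 0 - G (m%:R * u) w i 0)
    (CG * (n%:R * u - m%:R * u) `^ (H + alpha - 1)).
Proof.
move=> i0; have := theta_nonneg i0; rewrite le_eqVlt => /predU1P[th0|th0].
  have hb i : exists c, 0 <= c /\ forall t, 0 <= t <= T -> L2le P (fun w => G t w i 0) c.
    have [B0 Bg] := is_fBm_scalar i.
    apply: (@G_bounded_theta0 _ _ _ P H alpha _ T (fun t w => Bh t w i 0)
      (fun t w => G t w i 0) H12 a01 T0 B0 Bg
      (@is_G_measurable i) (@is_G_cvgL2 i)).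
    by rewrite [alpha + H]addrC.
  have [c hc] := choice hb; exists (\sum_i (c i + c i)); split.
    by apply: sumr_ge0 => i _; rewrite addr_ge0//; case: (hc i).
  move=> i m n u u0 mn nT; rewrite -th0 powRr0 mulr1.
  have [ci hi] := hc i.
  have mT : m%:R * u <= T by apply: le_trans nT; rewrite ler_pM2r// ler_nat.
  apply: L2le_mono (L2leB (hi (n%:R * u) _) (hi (m%:R * u) _)).
  - rewrite (bigD1 i)//= lerDl; apply: sumr_ge0 => j _; rewrite addr_ge0//; case: (hc j) => //.
  - by rewrite nT mulr_ge0// ltW.
  - by rewrite mT mulr_ge0// ltW.
have th1 : 0 < alpha + H - 1 < 1.
  by rewrite [alpha + H]addrC th0/=; case/andP: H12 => _; case/andP: a01 => _; lra.
exists (CG H alpha (sigma / Gammaf alpha)); split.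
  exact: CG_ge0 (ltW kap0) th1.
move=> i m n u u0 mn nT; have [B0 Bg] := is_fBm_scalar i.
have := @G_holder_grid _ _ _ P H alpha _ T (fun t w => Bh t w i 0)
   (fun t w => G t w i 0) H12 a01 (ltW kap0) T0 Bg
   (@is_G_measurable i) (@is_G_cvgL2 i) n m u th1 u0 mn nT.
by rewrite [alpha + H]addrC.
Qed.

Lemma G_start_L2 : exists A, 0 <= A /\ forall i, L2le P (fun w => G 0 w i 0) A.
Proof.
have h i : exists c, L2le P (fun w => G 0 w i 0) c.
  have [B0 Bg] := is_fBm_scalar i.
  apply: (@G_L2 _ _ _ P H alpha (sigma / Gammaf alpha) T (fun t w => Bh t w i 0)
    (fun t w => G t w i 0) H12 B0 Bg (@is_G_cvgL2 i)).
  by rewrite lexx ltW.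
have [c hc] := choice h; exists (\sum_i c i); split.
  by apply: sumr_ge0 => i _; exact: L2le_ge0 (hc i).
move=> i; apply: L2le_mono (hc i); rewrite (bigD1 i)//= lerDl.
by apply: sumr_ge0 => j _; exact: L2le_ge0 (hc j).
Qed.

End scalar_noise.

Lemma nrm2_coord_L2le {R : realType} d0 (Omega : measurableType d0) (P : probability Omega R)
    d (u : Omega -> 'cV[R]_d) : (forall i, measurable_fun setT (fun w => u w i 0)) ->
  (\int[P]_w (nrm2 (u w))%:E < +oo)%E ->
  exists A, 0 <= A /\ forall i, L2le P (fun w => u w i 0) A.
Proof.
move=> mu fin; set I := (\int[P]_w _)%E in fin.
have I0 : (0 <= I)%E by apply: integral_ge0 => w _; rewrite lee_fin nrm2_ge0.
have If : I \is a fin_num by rewrite ge0_fin_numE.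
exists (Num.sqrt (fine I)); split => // i; split => //.
rewrite sqr_sqrtr ?fine_ge0// fineK//; apply: ge0_le_integral => //.
- by move=> w _; rewrite lee_fin sqr_ge0.
- exact: measurable_EFin_sqr.
- by apply/measurable_EFinP; apply: measurable_sum => j; exact: measurable_funX.
move=> w _; rewrite lee_fin /nrm2 (bigD1 i)//= lerDl.
by apply: sumr_ge0 => j _; exact: sqr_ge0.
Qed.

Section convergence.
Context {R : realType} {d0 : measure_display} {Omega : measurableType d0}.
Variable P : probability Omega R.
Variables (T : R) (d : nat) (alpha H sigma : R).
Variables (x0 : Omega -> 'cV[R]_d) (Bh G : R -> Omega -> 'cV[R]_d).
Hypotheses (T0 : 0 < T) (dp : (0 < d)%N) (a01 : 0 < alpha < 1) (H12 : 1 / 2 < H < 1).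
Hypothesis s0 : 0 < sigma.
Hypothesis mx0 : forall i, measurable_fun setT (fun w => x0 w i 0).
Hypothesis hB : is_fBm P H Bh.
Hypothesis hG : is_G P T alpha sigma Bh G.
Variables (L : R) (b : 'cV[R]_d -> 'cV[R]_d) (x : R -> Omega -> 'cV[R]_d).
Hypothesis L0 : 0 <= L.
Hypothesis bL : forall u v, vnorm (b u - b v) <= L * vnorm (u - v).
Hypothesis sol : is_solution P T alpha b x0 G x.
Hypothesis fx0 : (\int[P]_w (nrm2 (x0 w))%:E < +oo)%E.
Local Notation g := (Gammaf alpha)^-1.
Local Notation theta := (H + alpha - 1).

Let g0 : 0 <= g. Proof. by rewrite invr_ge0 Gammaf_ge0. Qed.

Let mx t i : measurable_fun setT (fun w => x t w i 0). Proof. by case: sol. Qed.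

Let cx w i : {within [set t : R | 0 <= t <= T], continuous (fun t => x t w i 0)}.
Proof. by case: sol => _ []. Qed.

Let th : 0 <= theta <= alpha.
Proof.
rewrite (theta_nonneg T0 a01 H12 s0 hB hG dp)/=.
by case/andP: H12 => _; lra.
Qed.

Lemma Gt_ae i t : 0 <= t <= T -> {ae P, forall w, Gt T alpha g b x0 x i t w = G t w i 0}.
Proof.
move=> tT; case: sol => _ [_ /(_ t tT)]; apply: filterS => w hw.
have e : x t w i 0 = x0 w i 0 + RL_drift alpha b x t w i 0 + G t w i 0.
  by rewrite hw mxE; congr (_ + _); rewrite mxE.
rewrite /Gt xc_id// e (RL_driftE _ _ _ _ _ tT)//; move: (fint _ _ _ _) => f; ring.
Qed.

Lemma solution_bounds : exists CG cb Cx, [/\ 0 <= CG, 0 < cb, 0 < Cx,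
  forall i s t, 0 <= s -> s <= t -> t <= T ->
    L2le P (fun w => Gt T alpha g b x0 x i t w - Gt T alpha g b x0 x i s w) (CG * (t - s) `^ theta) &
  (forall t i, 0 <= t <= T -> L2le P (fun w => bx T b x i (t, w)) cb) /\
  forall t s i, 0 <= s -> s <= t -> t <= T ->
    L2le P (fun w => bx T b x i (t, w) - bx T b x i (s, w)) (Cx * (t - s) `^ theta)].
Proof.
have [CG [CG0 hCG]] := G_grid_bound T0 a01 H12 s0 hB hG dp.
have [A [A0 hA]] := nrm2_coord_L2le mx0 fx0.
have [A' [A'0 hA']] := G_start_L2 T0 H12 hB hG.
have hx0 i : L2le P (fun w => x0 w i 0) (A + A') by apply: L2le_mono (hA i); rewrite lerDl.
have hG0 i : L2le P (fun w => G 0 w i 0) (A + A') by apply: L2le_mono (hA' i); rewrite lerDr.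
have [cb [Cx [cb0 Cx0 h1 h2]]] := solution_regular T0 a01 L0 g0 bL mx0 mx cx th CG0 hx0 hG0 hCG Gt_ae.
exists CG, cb, Cx; split => // i s t st0 st tT.
exact: (Gt_holder T0 a01 L0 bL mx0 mx cx th CG0 hCG Gt_ae).
Qed.

Lemma fast_scheme_rate : exists C, 0 <= C /\
  forall (N : nat) (eps : R) (M : nat) (om sv : 'I_M -> R),
    (0 < N)%N -> T / N%:R < 1 -> 0 <= eps <= 1 ->
    (forall t, T / N%:R <= t <= T ->
       `|powR t (alpha - 1) - \sum_(i < M) om i * expR (- sv i * t)| <= eps) ->
    forall n, (n <= N)%N ->
      (err2 P (soe_kernel alpha (T / N%:R) om sv) (T / N%:R) b x0 G x n
        <= ((C * (powR (T / N%:R) theta + eps)) ^+ 2)%:E)%E.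
Proof.
have [CG [cb [Cx [CG0 cb0 Cx0 _ [hb hx]]]]] := solution_bounds.
have [C [C0 hC]] := scheme_error T0 a01 L0 g0 bL mx0 mx cx
  (fun i t tT => is_G_measurable hG i tT) Gt_ae cb0 hb.
have a0 : 0 < alpha by case/andP: a01.
pose K := Cx * (T `^ alpha / alpha).
have K0 : 0 <= K by rewrite mulr_ge0 ?(ltW Cx0)// divr_ge0 ?powR_ge0// ltW.
exists (C * (K + 1)); split; first by rewrite mulr_ge0// addr_ge0.
move=> N eps M om sv N0 k1 /[dup] e01 /andP[e0 _] hsoe n nN.
have k0 : 0 < T / N%:R by rewrite divr_gt0// ltr0n.
set k := T / N%:R in k0 hsoe *.
have r0 : 0 <= K * k `^ theta by rewrite mulr_ge0 ?powR_ge0.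
have := hC N eps (soe_kernel alpha k om sv) (K * k `^ theta) N0 e01
  (soe_kernel_measurable _ _ _ _) (soe_kernel_dist g0 e0 hsoe) r0.
move=> /(_ _ n nN)/wrap[|h].
  move=> m i mN; have := @qrem_L2le _ _ _ P alpha a01 (bx T b x i) k (Cx * k `^ theta) T m k0.
  have -> : K * k `^ theta = Cx * k `^ theta * (T `^ alpha / alpha) by rewrite /K mulrAC.
  apply.
  - by rewrite mulr_ge0 ?powR_ge0// ltW.
  - exact: (@step_le _ _ _ N).
  - exact: (bx_measurable T0 bL mx cx i).
  move=> j s jm /andP[s1 s2].
  have jk : 0 <= j%:R * k by rewrite mulr_ge0// ltW.
  have jT : j.+1%:R * k <= T by apply: (@step_le _ _ _ N) => //; exact: leq_trans mN.
  apply: L2le_mono (hx s _ i jk s1 (le_trans s2 jT)).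
  rewrite ler_wpM2l ?(ltW Cx0)// ge0_ler_powR ?nnegrE ?subr_ge0 ?(ltW k0)//.
    by rewrite -subr_ge0; case/andP: th.
  by rewrite lerBlDl; apply: le_trans s2 _; rewrite -addn1 natrD mulrDl mul1r.
apply: le_trans h _; rewrite lee_fin lerXn2r ?nnegrE//.
- by rewrite mulr_ge0// addr_ge0.
- by rewrite mulr_ge0 ?mulr_ge0 ?addr_ge0 ?powR_ge0.
rewrite -mulrA ler_wpM2l// mulrDr; apply: lerD.
  by rewrite ler_wpM2r ?powR_ge0// lerDl.
by rewrite ler_peMl// lerDr.
Qed.

End convergence.

(** * The linear case *)

Section negative_correlation.
Context {R : realType} {d0 : measure_display} {Omega : measurableType d0}.
Variable P : probability Omega R.
Variable alpha : R.
Hypothesis a01 : 0 < alpha < 1.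
Local Notation mu := (@lebesgue_measure R).

Lemma ip_sqr_lin a b X Y : L2 P X -> L2 P Y ->
  ip P (fun w => a * X w + b * Y w) (fun w => a * X w + b * Y w) =
  a ^+ 2 * ip P X X + 2 * a * b * ip P X Y + b ^+ 2 * ip P Y Y.
Proof.
move=> hX hY; have aX := L2Z a hX; have bY := L2Z b hY.
have r c U V : L2 P U -> L2 P V -> ip P U (fun w => c * V w) = c * ip P U V.
  by move=> hU hV; rewrite ipC ipZl// ipC.
rewrite ipDl//; last exact: L2D.
rewrite !ipDr// !ipZl// !r// (ipC P Y X); ring.
Qed.

Lemma L2le_sum_neg n (Y : 'I_n -> Omega -> R) (K : 'I_n -> R) :
  (forall j, L2le P (Y j) (K j)) ->
  (forall j l, j != l -> ip P (Y j) (Y l) <= 0) ->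
  L2le P (fun w => \sum_(j < n) Y j w) (Num.sqrt (\sum_(j < n) K j ^+ 2)).
Proof.
move=> hY hneg; have LY j : L2 P (Y j) by exists (K j).
have LS : L2 P (fun w => \sum_(j < n) Y j w) by exact: L2_sum.
apply: L2le_mono (L2le_ip LS); apply: ler_wsqrtr.
rewrite ip_suml//; apply: ler_sum => j _.
rewrite ipC ip_suml// (bigD1 j)//= -[leRHS]addr0; apply: lerD; first exact: ip_sqr_le.
by apply: sumr_le0 => l lj; exact: hneg.
Qed.

(* [k Z + e Y = int kern (Z + e f)] has norm at most [k sqrt (|Z|^2 + e^2 c^2)];
   expanding the square and letting [e] tend to [0] gives the sign. *)
Lemma ip_integral_le0 (f : measurableTypeR R * Omega -> R) (Z : Omega -> R) (t a b c : R) :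
  a <= b -> b <= t -> measurable_fun setT f ->
  (forall w, exists M, forall s, `|f (s, w)| <= M) -> L2 P Z ->
  (forall s, a <= s <= b -> L2le P (fun w => f (s, w)) c) ->
  (forall s, a <= s <= b -> ip P Z (fun w => f (s, w)) <= 0) ->
  ip P Z (fun w => \int[mu]_(s in `[a, b]) (kern alpha t s * f (s, w))) <= 0.
Proof.
move=> ab bt mf fb LZ hf hneg.
have c0 : 0 <= c by apply: L2le_ge0 (hf a _); rewrite lexx.
set Y := fun w => _.
set kap := (((t - a) `^ alpha - (t - b) `^ alpha) / alpha).
have hY : L2le P Y (c * kap) by exact: kern_process_L2le_cst.
have LY : L2 P Y by exists (c * kap).
have k0 : 0 <= kap.
  have a0 : 0 < alpha by case/andP: a01.
  rewrite divr_ge0 ?(ltW a0)// subr_ge0 ge0_ler_powR ?nnegrE ?(ltW a0)//; lra.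
have [mZ hZ] := (L2le_measurable (L2le_ip LZ), L2le_ip LZ).
have step e : 0 < e -> 2 * kap * ip P Z Y <= e * (c ^+ 2 * kap ^+ 2).
  move=> e0; pose f' (z : measurableTypeR R * Omega) := Z z.2 + e * f z.
  have mf' : measurable_fun setT f'.
    by apply: measurable_funD; [exact: measurableT_comp mZ measurable_snd|exact: measurable_funM].
  pose q := Num.sqrt (ip P Z Z + e ^+ 2 * c ^+ 2).
  have q2 : q ^+ 2 = ip P Z Z + e ^+ 2 * c ^+ 2.
    by rewrite sqr_sqrtr// addr_ge0 ?ip_sqr_ge0// mulr_ge0// sqr_ge0.
  have h : L2le P (fun w => \int[mu]_(s in `[a, b]) (kern alpha t s * f' (s, w))) (q * kap).
    apply: kern_process_L2le_cst => //; first exact: sqrtr_ge0.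
    move=> s sab; have hs := hf s sab; have Ls : L2 P (fun w => f (s, w)) by exists c.
    have LS : L2 P (fun w => 1 * Z w + e * f (s, w)) by apply: L2D; exact: L2Z.
    rewrite (_ : (fun w => f' (s, w)) = fun w => 1 * Z w + e * f (s, w)); last first.
      by apply/funext => w; rewrite mul1r.
    apply: L2le_mono (L2le_ip LS); apply: ler_wsqrtr; rewrite ip_sqr_lin//.
    rewrite expr1n mul1r mulr1 -addrA lerD2l -[leRHS]add0r; apply: lerD.
      by apply: mulr_ge0_le0; [rewrite mulr_ge0// ltW|exact: hneg].
    by apply: ler_wpM2l; [exact: sqr_ge0|exact: ip_sqr_le].
  have E : (fun w => \int[mu]_(s in `[a, b]) (kern alpha t s * f' (s, w))) =
      fun w => kap * Z w + e * Y w.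
    apply/funext => w; rewrite /f'/=.
    under eq_Rintegral do rewrite mulrDr [_ * (e * _)]mulrCA.
    have [M hM] := fb w.
    have i1 : mu.-integrable `[a, b] (EFin \o (fun s => kern alpha t s * f (s, w))).
      exact: process_integrable.
    have i2 : mu.-integrable `[a, b] (EFin \o kern alpha t).
      have := @kern_integrable _ alpha a01 t a b (cst 1) 1 bt (measurable_cst _).
      rewrite (_ : (fun u => _ * cst 1 u) = kern alpha t); last first.
        by apply/funext => u; rewrite /= mulr1.
      by apply => u; rewrite normr1.
    rewrite RintegralD//.
    - rewrite RintegralZr// RintegralZl//; congr (_ * _ + _).
      by rewrite /Rintegral integral_kern.
    - by apply: (@kern_integrable _ alpha a01 _ _ _ (cst (Z w)) `|Z w|).
    - have := @process_integrable _ _ _ alpha a01 (fun z => e * f z) _ _ t a b w bt.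
      rewrite (_ : (fun s => kern alpha t s * (e * f (s, w))) =
        fun s => e * (kern alpha t s * f (s, w))); last by apply/funext => s; rewrite mulrCA.
      apply; first exact: measurable_funM.
      move=> w'; have [M' hM'] := fb w'; exists (e * M') => s.
      by rewrite normrM (ger0_norm (ltW e0)) ler_pM2l.
  rewrite E in h; have := ip_sqr_le h; rewrite ip_sqr_lin// [(q * kap) ^+ 2]exprMn q2 => h2.
  have y0 : 0 <= e ^+ 2 * ip P Y Y by rewrite mulr_ge0 ?sqr_ge0// ip_sqr_ge0.
  rewrite -(ler_pM2l e0); move: h2 y0; move: (ip P Z Y) (ip P Z Z) (ip P Y Y) => u v y; lra.
have [k00|kn0] := eqVneq kap 0.
  have := ip_norm_le hZ hY; rewrite k00 !mulr0 => h.
  exact: le_trans (ler_norm _) h.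
have kp : 0 < kap by rewrite lt_neqAle eq_sym kn0.
rewrite leNgt; apply/negP => p0.
have D0 : 0 < kap * (c ^+ 2 + 1) by rewrite mulr_gt0// ltr_wpDl// sqr_ge0.
have := step (ip P Z Y / (kap * (c ^+ 2 + 1))) (divr_gt0 p0 D0).
have -> : ip P Z Y / (kap * (c ^+ 2 + 1)) * (c ^+ 2 * kap ^+ 2) =
  kap * ip P Z Y * (c ^+ 2 / (c ^+ 2 + 1)).
  by field; rewrite (gt_eqF kp) gt_eqF// ltr_wpDl// sqr_ge0.
have r1 : c ^+ 2 / (c ^+ 2 + 1) <= 1.
  by rewrite ler_pdivrMr ?mul1r ?lerDl// ltr_wpDl// sqr_ge0.
have kp0 : 0 < kap * ip P Z Y by rewrite mulr_gt0.
have := ler_wpM2l (ltW kp0) r1; rewrite mulr1.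
move: (_ * (_ / _)) => u; rewrite -mulrA; move: (kap * _) kp0 => v; lra.
Qed.

Lemma ip_lim_ge0 (X_ Y_ : nat -> Omega -> R) X Y :
  (forall n, L2 P (X_ n)) -> (forall n, L2 P (Y_ n)) ->
  cvgL2 P X_ X -> cvgL2 P Y_ Y -> (forall n, 0 <= ip P (X_ n) (Y_ n)) -> 0 <= ip P X Y.
Proof.
move=> hX hY cX cY h.
have LX := cvgL2_L2 hX cX; have LY := cvgL2_L2 hY cY.
have [a ha] := LX; have [b hb] := LY.
have a0 := L2le_ge0 ha; have b0 := L2le_ge0 hb.
apply/ler_addgt0Pr => e e0.
have ab : 0 < a + b + 1 by lra.
pose dl := Num.min 1 (e / (a + b + 1)).
have dl0 : 0 < dl by rewrite lt_min ltr01 divr_gt0.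
have dl1 : dl <= 1 by rewrite ge_min lexx.
have dle : dl * (a + b + 1) <= e by rewrite -ler_pdivlMr// ge_min lexx orbT.
near \oo => n.
have hXn : L2le P (fun w => X w - X_ n w) dl by near: n; exact: cX.
have hYn : L2le P (fun w => Y w - Y_ n w) dl by near: n; exact: cY.
have hXn' : L2le P (X_ n) (a + dl).
  have := L2leB ha hXn; congr (L2le _ _ _).
  by apply/funext => w; rewrite subKr.
have e1 := ip_norm_le hXn hb; have e2 := ip_norm_le hXn' hYn.
rewrite ipBl// in e1; rewrite ipBr// in e2.
move/ler_normlP: e1 => [e1 _]; move/ler_normlP: e2 => [e2 _].
have hn := h n.
have : dl * b + (a + dl) * dl <= e.
  apply: le_trans dle; have : dl * dl <= 1 * dl by rewrite ler_pM2r.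
  nra.
move: (ip _ _ _) (ip _ _ _) (ip _ _ _) hn e1 e2 => u v y; lra.
Unshelve. all: by end_near. Qed.

Lemma ip_eq_L2le0 X X' Y : L2 P X -> L2 P X' -> L2 P Y ->
  L2le P (fun w => X w - X' w) 0 -> ip P X Y = ip P X' Y.
Proof.
move=> hX hX' hY h0; have [b hb] := hY.
have := ip_norm_le h0 hb; rewrite mul0r ipBl// normr_le0 subr_eq0.
by move/eqP.
Qed.

End negative_correlation.

Section quadrature_linear.
Context {R : realType} {d0 : measure_display} {Omega : measurableType d0}.
Variable alpha : R.
Hypothesis a01 : 0 < alpha < 1.
Local Notation mu := (@lebesgue_measure R).

Definition bproc (f : measurableTypeR R * Omega -> R) : Prop :=
  measurable_fun setT f /\ forall w, exists M, forall s, `|f (s, w)| <= M.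

Lemma bproc_lin c f h : bproc f -> bproc h -> bproc (fun z => c * f z + h z).
Proof.
move=> [mf bf] [mh bh]; split.
  by apply: measurable_funD => //; exact: measurable_funM.
move=> w; have [M hM] := bf w; have [M' hM'] := bh w.
exists (`|c| * M + M') => s; apply: le_trans (ler_normD _ _) _; apply: lerD => //.
by rewrite normrM ler_wpM2l.
Qed.

Lemma bproc0 : bproc (fun=> 0).
Proof. by split => // w; exists 0 => s; rewrite normr0. Qed.

Lemma bproc_sum (I : Type) (r : seq I) (c : I -> R) f : (forall i, bproc (f i)) ->
  bproc (fun z => \sum_(i <- r) c i * f i z).
Proof.
move=> hf; elim: r => [|i r IH].
  by under eq_fun do rewrite big_nil; exact: bproc0.
by under eq_fun do rewrite big_cons; exact: bproc_lin.
Qed.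

Lemma fint_lin c f h t w : bproc f -> bproc h ->
  fint alpha (fun z => c * f z + h z) t w = c * fint alpha f t w + fint alpha h t w.
Proof.
move=> [mf bf] [mh bh]; rewrite /fint.
have If : mu.-integrable `[0, t] (EFin \o (fun s => kern alpha t s * f (s, w))).
  exact: process_integrable.
have Ih : mu.-integrable `[0, t] (EFin \o (fun s => kern alpha t s * h (s, w))).
  exact: process_integrable.
under eq_Rintegral do rewrite mulrDr mulrCA.
rewrite RintegralD//; last first.
  have [m1 b1] := bproc_lin c (conj mf bf) bproc0.
  have := @process_integrable _ _ _ alpha a01 _ m1 b1 t 0 t w (lexx t).
  by congr (integrable _ _ _); apply/funext => s /=; rewrite addr0 mulrCA.
by rewrite RintegralZl.
Qed.

Lemma qrem_lin c f h k n w : 0 < k -> bproc f -> bproc h ->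
  qrem alpha (fun z => c * f z + h z) k n w = c * qrem alpha f k n w + qrem alpha h k n w.
Proof.
move=> k0 hf hh; have [m1 b1] := bproc_lin c hf hh.
have [mf bf] := hf; have [mh bh] := hh.
rewrite !qremE// fint_lin//.
have -> : \sum_(j < n) kw alpha k n j * (c * f (j%:R * k, w) + h (j%:R * k, w)) =
  c * \sum_(j < n) kw alpha k n j * f (j%:R * k, w) + \sum_(j < n) kw alpha k n j * h (j%:R * k, w).
  by rewrite mulr_sumr -big_split/=; apply: eq_bigr => j _; ring.
move: (fint _ _ _ _) (fint _ _ _ _) (\sum_(_ < _) _) (\sum_(_ < _) _) => u v y z; ring.
Qed.

Lemma qrem_sum (I : Type) (r : seq I) (c : I -> R) f k n w : 0 < k -> (forall i, bproc (f i)) ->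
  qrem alpha (fun z => \sum_(i <- r) c i * f i z) k n w = \sum_(i <- r) c i * qrem alpha (f i) k n w.
Proof.
move=> k0 hf; elim: r => [|i r IH].
  rewrite big_nil /qrem; apply: big1 => j _.
  rewrite /Rintegral; under eq_integral do rewrite !big_nil subrr mulr0.
  by rewrite integral0.
rewrite big_cons -IH -qrem_lin//; last exact: bproc_sum.
by rewrite /qrem; apply: eq_bigr => j _; apply: eq_Rintegral => s _; rewrite !big_cons.
Qed.

End quadrature_linear.

Section real_estimates.
Context {R : realType}.
Local Notation mu := (@lebesgue_measure R).

Lemma powR_diff_le (s t k rho beta : R) : 0 <= t <= s -> s - t <= k -> 0 <= beta ->
  0 < rho - beta -> rho < 1 ->
  s `^ (rho - beta) - t `^ (rho - beta) <= k `^ rho * s `^ (- beta).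
Proof.
move=> /andP[t0 ts] stk b0 a0 r1.
have [->|nst] := eqVneq s t; first by rewrite subrr mulr_ge0 ?powR_ge0.
have st : t < s by rewrite lt_neqAle eq_sym nst.
have s0 : 0 < s by exact: le_lt_trans st.
have d0 : 0 < s - t by rewrite subr_gt0.
apply: le_trans (@subr_powR_le R s t (rho - beta) _ s0 _) _; [by rewrite t0| |].
  by rewrite a0; lra.
have -> : rho - beta - 1 = (rho - 1) + - beta by ring.
rewrite powR_split// mulrAC ler_wpM2r ?powR_ge0//.
apply: (@le_trans _ _ ((s - t) `^ (rho - 1) * (s - t))).
  rewrite ler_pM2r//; apply: ler_powRN; last by lra.
  by rewrite d0 lerBlDr lerDl.
rewrite -{2}[s - t]powRr1 ?(ltW d0)// -powR_split// subrK.
by apply: ge0_ler_powR => //; rewrite ?nnegrE; lra.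
Qed.

Lemma kern_singular_le (alpha beta s t : R) : 0 < alpha < 1 -> 0 <= beta -> 0 <= s <= t ->
  (t - s) `^ (alpha - 1) * s `^ (- beta) <=
  (t - s) `^ (alpha - beta - 1) + s `^ (alpha - beta - 1).
Proof.
move=> /andP[a0 a1] b0 /andP[s0 st].
have [->|bn0] := eqVneq beta 0.
  by rewrite subr0 oppr0 powRr0 mulr1 lerDl powR_ge0.
have nb0 : - beta != 0 by rewrite oppr_eq0.
have na1 : alpha - 1 != 0 by rewrite lt_eqF// subr_lt0.
have [->|sn0] := eqVneq s 0.
  by rewrite [0 `^ (- beta)]powR0// mulr0 addr_ge0 ?powR_ge0.
have [->|snt] := eqVneq s t.
  by rewrite subrr [0 `^ (alpha - 1)]powR0// mul0r addr_ge0 ?powR_ge0.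
have sp : 0 < s by rewrite lt_neqAle eq_sym sn0.
have tp : 0 < t - s by rewrite subr_gt0 lt_neqAle snt.
have -> : alpha - beta - 1 = (alpha - 1) + - beta by ring.
have [h|h] := leP (t - s) s.
  apply: (@le_trans _ _ ((t - s) `^ (alpha - 1 + - beta))); last by rewrite lerDl powR_ge0.
  by rewrite [leRHS]powR_split// ler_wpM2l ?powR_ge0//; apply: ler_powRN; [rewrite tp|lra].
apply: (@le_trans _ _ (s `^ (alpha - 1 + - beta))); last by rewrite lerDr powR_ge0.
by rewrite [leRHS]powR_split// ler_wpM2r ?powR_ge0//; apply: ler_powRN; [rewrite sp ltW|lra].
Qed.

Lemma integral_powR_itv (a b p : R) : 0 <= a <= b -> 0 < p ->
  (\int[mu]_(s in `[a, b]) (s `^ (p - 1))%:E = ((b `^ p - a `^ p) / p)%:E)%E.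
Proof.
move=> /andP[a0 ab] p0; have b0 := le_trans a0 ab.
have mp (D : set R) : measurable_fun D (fun s : R => (s `^ (p - 1))%:E).
  by apply/measurable_EFinP; apply: measurable_funTS; exact: measurable_powR.
have U : `[0, b]%classic = `[0, a]%classic `|` `]a, b]%classic :> set R.
  by rewrite -itv_bndbnd_setU ?bnd_simp.
have e : (\int[mu]_(s in `[0%R, b]) (s `^ (p - 1))%:E =
   \int[mu]_(s in `[0%R, a]) (s `^ (p - 1))%:E + \int[mu]_(s in `[a, b]) (s `^ (p - 1))%:E)%E.
  rewrite -(@integral_itv_obnd_cbnd _ a (BRight b) _ (mp _)).
  rewrite -ge0_integral_setU//=.
  - by rewrite U.
  - exact: mp.
  - by move=> s _; rewrite lee_fin powR_ge0.
  - apply/disj_setPS => s /=; rewrite !in_itv/= => -[/andP[_ sa] /andP[]].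
    by rewrite ltNge sa.
rewrite !integral_powR0// in e.
have -> : ((b `^ p - a `^ p) / p)%:E = ((b `^ p / p)%:E - (a `^ p / p)%:E)%E.
  by rewrite -EFinB mulrBl.
by rewrite e addeC addeK.
Qed.

Lemma integral_kern_singular (alpha beta a b t : R) : 0 < alpha < 1 -> 0 <= beta ->
  0 < alpha - beta -> 0 <= a <= b -> b <= t ->
  (\int[mu]_(s in `[a, b]) (kern alpha t s * (1 + s `^ (- beta)))%:E <=
   (((t - a) `^ alpha - (t - b) `^ alpha) / alpha +
    (((t - a) `^ (alpha - beta) - (t - b) `^ (alpha - beta)) / (alpha - beta) +
     (b `^ (alpha - beta) - a `^ (alpha - beta)) / (alpha - beta)))%:E)%E.
Proof.
move=> a01 b0 p0 /[dup] hab /andP[a0 ab] bt.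
have mk q : measurable_fun setT (fun s : R => (t - s) `^ q).
  by apply: (measurableT_comp (measurable_powR _)); exact: measurable_funB.
have mE (f : R -> R) (D : set R) : measurable_fun setT f -> measurable_fun D (EFin \o f).
  by move=> mf; apply/measurable_EFinP; exact: measurable_funTS.
rewrite !EFinD -(@integral_kern _ alpha)// -(@integral_powR_rev _ t a b (alpha - beta))//; last 2 first.
- by rewrite gt_eqF.
- by left.
rewrite -integral_powR_itv//.
have mpw q : measurable_fun setT (fun s : R => s `^ q) by exact: measurable_powR.
rewrite -ge0_integralD//; last 4 first.
- by move=> s _; rewrite lee_fin powR_ge0.
- exact: (mE (fun s => (t - s) `^ (alpha - beta - 1))).
- by move=> s _; rewrite lee_fin powR_ge0.
- exact: (mE (fun s => s `^ (alpha - beta - 1))).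
rewrite -ge0_integralD//; last 4 first.
- by move=> s _; rewrite lee_fin powR_ge0.
- exact: (mE _ _ (measurable_kern alpha t)).
- by move=> s _; rewrite -EFinD lee_fin addr_ge0 ?powR_ge0.
- by apply: (mE (fun s => (t - s) `^ (alpha - beta - 1) + s `^ (alpha - beta - 1)));
    exact: measurable_funD.
apply: ge0_le_integral => //.
- by move=> s _; rewrite lee_fin mulr_ge0 ?kern_ge0// addr_ge0 ?powR_ge0.
- apply: (mE (fun s => kern alpha t s * (1 + s `^ (- beta)))).
  by apply: measurable_funM; [exact: measurable_kern|exact: measurable_funD].
- apply: (mE (fun s => kern alpha t s + ((t - s) `^ (alpha - beta - 1) + s `^ (alpha - beta - 1)))).
  by apply: measurable_funD; [exact: measurable_kern|exact: measurable_funD].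
move=> s /=; rewrite in_itv/= => /andP[sa sb]; rewrite -!EFinD lee_fin mulrDr mulr1 lerD2l.
by apply: kern_singular_le => //; rewrite (le_trans a0)//= (le_trans sb).
Qed.

End real_estimates.

Section quadrature_orthogonal.
Context {R : realType} {d0 : measure_display} {Omega : measurableType d0}.
Variable P : probability Omega R.
Variable alpha : R.
Hypothesis a01 : 0 < alpha < 1.
Local Notation mu := (@lebesgue_measure R).

Lemma bproc_sub (f : measurableTypeR R * Omega -> R) (r : R) : bproc f ->
  bproc (fun z => f z - f (r, z.2)).
Proof.
move=> [mf bf]; split.
  apply: measurable_funB => //.
  exact: (measurableT_comp mf (measurableT_comp (measurable_pair1 r) measurable_snd)).
move=> w; have [M hM] := bf w; exists (M + M) => s.
by apply: le_trans (ler_normB _ _) _; exact: lerD.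
Qed.

Lemma qrem_neg_L2le (f : measurableTypeR R * Omega -> R) (k K : R) (n : nat) :
  0 < k -> 0 <= K -> bproc f ->
  (forall j s, (j < n)%N -> j%:R * k <= s <= j.+1%:R * k ->
     L2le P (fun w => f (s, w) - f (j%:R * k, w)) K) ->
  (forall j l r s, (j < l)%N -> (l < n)%N -> j%:R * k <= r <= j.+1%:R * k ->
     l%:R * k <= s <= l.+1%:R * k ->
     ip P (fun w => f (r, w) - f (j%:R * k, w)) (fun w => f (s, w) - f (l%:R * k, w)) <= 0) ->
  L2le P (qrem alpha f k n)
    (K * (alpha^-1 * (k `^ alpha * Num.sqrt (\sum_(i < n) i.+1%:R `^ (2 * alpha - 2))))).
Proof.
move=> k0 K0 hf hL hneg; have [mf bf] := hf.
have a0 : 0 < alpha by case/andP: a01.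
pose fj j (z : measurableTypeR R * Omega) := f z - f (j%:R * k, z.2).
pose Y j w := \int[mu]_(s in `[j%:R * k, j.+1%:R * k]) (kern alpha (n%:R * k) s * fj j (s, w)).
have hY (j : nat) : (j < n)%N -> L2le P (Y j) (K * kw alpha k n j).
  by move=> jn; apply: cell_L2le => // s; apply: hL.
have jj (j : nat) : j%:R * k <= j.+1%:R * k by rewrite ler_pM2r// ler_nat.
have jn' (j : nat) : (j < n)%N -> j.+1%:R * k <= n%:R * k.
  by move=> jn; rewrite ler_pM2r// ler_nat.
have neg (j l : nat) : (j < l)%N -> (l < n)%N -> ip P (Y l) (Y j) <= 0.
  move=> jl ln; have jn := ltn_trans jl ln.
  have [mfj bfj] := bproc_sub (j%:R * k) hf; have [mfl bfl] := bproc_sub (l%:R * k) hf.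
  apply: (@ip_integral_le0 _ _ _ P alpha a01 (fj j) (Y l) (n%:R * k) _ _ K) => //.
  - exact: jn'.
  - by exists (K * kw alpha k n l); exact: hY.
  - by move=> r rj; exact: hL.
  move=> r rj; rewrite ipC.
  apply: (@ip_integral_le0 _ _ _ P alpha a01 (fj l) _ (n%:R * k) _ _ K) => //.
  - exact: jn'.
  - by exists K; exact: hL.
  - by move=> s sl; exact: hL.
  by move=> s sl; exact: hneg.
have := @L2le_sum_neg _ _ _ P n (fun j => Y j) (fun j => K * kw alpha k n j) (fun j => hY j (ltn_ord j)).
move=> /(_ _)/wrap[|].
  move=> j l jl; have [h|h|h] := ltngtP j l.
  - by rewrite ipC; exact: neg.
  - exact: neg.
  - by move: jl; rewrite (val_inj h) eqxx.
apply: L2le_mono.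
have -> : K * (alpha^-1 * (k `^ alpha * Num.sqrt (\sum_(i < n) i.+1%:R `^ (2 * alpha - 2)))) =
   Num.sqrt (\sum_(i < n) (K * (alpha^-1 * (k `^ alpha * i.+1%:R `^ (alpha - 1)))) ^+ 2).
  have c0 : 0 <= K * (alpha^-1 * k `^ alpha).
    by rewrite !mulr_ge0 ?powR_ge0// invr_ge0 ltW.
  rewrite !mulrA -[K * alpha^-1 * _]mulrA -[LHS]mulr1 mulr1.
  rewrite -[K * (alpha^-1 * k `^ alpha)]ger0_norm// -sqrtr_sqr -sqrtrM ?sqr_ge0//.
  rewrite mulr_sumr; congr Num.sqrt; apply: eq_bigr => i _.
  have i0 : 0 < (i.+1%:R : R) by rewrite ltr0n.
  have -> : 2 * alpha - 2 = (alpha - 1) + (alpha - 1) by ring.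
  rewrite powR_split//; ring.
apply: ler_wsqrtr; rewrite (reindex_inj rev_ord_inj)/=; apply: ler_sum => i _.
have ni : (n - i.+1 < n)%N by rewrite ltn_subrL (leq_trans _ (ltn_ord i)).
rewrite lerXn2r ?nnegrE//.
- by apply: mulr_ge0 => //; exact: kw_ge0.
- by rewrite !mulr_ge0 ?powR_ge0// invr_ge0 ltW.
rewrite ler_wpM2l//; apply: le_trans (kw_le a01 k0 ni) _.
rewrite subKn// ler_pM2l ?invr_gt0//.
have i0 : 0 <= (i.+1%:R : R) by [].
rewrite powRM ?(ltW k0)// mulrCA [X in X <= _]mulrC ler_wpM2r ?powR_ge0//.
by rewrite -{1}[k]powRr1 ?(ltW k0)// -powR_split// addrC subrK.
Qed.

End quadrature_orthogonal.

Section solution_processes.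
Context {R : realType} {d0 : measure_display} {Omega : measurableType d0}.
Variables (T alpha g L : R) (d : nat) (b : 'cV[R]_d -> 'cV[R]_d).
Variables (x0 : Omega -> 'cV[R]_d) (x : R -> Omega -> 'cV[R]_d).
Hypotheses (T0 : 0 < T) (a01 : 0 < alpha < 1) (L0 : 0 <= L).
Hypothesis bL : forall u v, vnorm (b u - b v) <= L * vnorm (u - v).
Hypothesis mx0 : forall i, measurable_fun setT (fun w => x0 w i 0).
Hypothesis mx : forall t i, measurable_fun setT (fun w => x t w i 0).
Hypothesis cx : forall w i,
  {within [set t : R | 0 <= t <= T], continuous (fun t => x t w i 0)}.

Definition Dp i (z : measurableTypeR R * Omega) : R := fint alpha (bx T b x i) (clamp T z.1) z.2.
Definition Gp i (z : measurableTypeR R * Omega) : R := Gt T alpha g b x0 x i (clamp T z.1) z.2.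

Lemma fint_clamp_continuous i w : continuous (fun t => fint alpha (bx T b x i) (clamp T t) w).
Proof.
have [M hM] := bx_bounded T0 L0 bL cx i w; have a0 : 0 < alpha by case/andP: a01.
have M1 : 0 < `|M| + 1 by rewrite ltr_wpDl.
have Cf : 0 < Cfrac alpha alpha.
  by rewrite addr_gt0 ?invr_gt0// mulr_gt0// subr_gt0; case/andP: a01.
pose c := (`|M| + 1) * Cfrac alpha alpha; have c0 : 0 < c by rewrite mulr_gt0.
have bnd s r : s <= r -> `|fint alpha (bx T b x i) (clamp T r) w - fint alpha (bx T b x i) (clamp T s) w| <=
    c * `|s - r| `^ alpha.
  move=> sr.
  have csr : clamp T s <= clamp T r.
    by rewrite /clamp ge_max !le_max lexx/= ge_min; case: leP => //=; rewrite le_min ge_min sr ge_min lexx !orbT.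
  have /andP[cs0 _] := clamp_itv T0 s.
  have := @fint_path_holder _ _ _ alpha (bx T b x i) (clamp T s) (clamp T r) (`|M| + 1) w a01
    (bx_measurable T0 bL mx cx i) (bx_bounded T0 L0 bL cx i).
  rewrite cs0 csr => /(_ isT M1) h; apply: le_trans (h _) _.
    by move=> u _; apply: le_trans (hM u) _; rewrite (le_trans (ler_norm M))// lerDl.
  rewrite mulrA ler_wpM2l ?(ltW c0)// ge0_ler_powR ?nnegrE ?subr_ge0 ?(ltW a0)//.
  have := clamp_lip T0 r s; rewrite ger0_norm ?subr_ge0// => /le_trans; apply.
  by rewrite distrC.
move=> s; apply/cvgrPdist_le => e e0.
exists ((e / c) `^ alpha^-1) => /=; first by rewrite powR_gt0// divr_gt0.
move=> r hr.
have h : `|fint alpha (bx T b x i) (clamp T s) w - fint alpha (bx T b x i) (clamp T r) w| <=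
    c * `|s - r| `^ alpha.
  have [sr|/ltW rs] := leP s r; first by rewrite -normrN opprB; exact: bnd.
  by rewrite -[`|s - r|]normrN opprB; exact: bnd.
apply: le_trans h _; rewrite mulrC -ler_pdivlMr//.
apply: (@le_trans _ _ (((e / c) `^ alpha^-1) `^ alpha)).
  by rewrite ge0_ler_powR ?nnegrE ?powR_ge0 ?(ltW a0)// ltW.
by rewrite -powRrM mulVf ?gt_eqF// powRr1// divr_ge0 ?(ltW e0) ?(ltW c0).
Qed.

Lemma Dp_bproc i : bproc (Dp i).
Proof.
split.
  apply: (@measurable_caratheodory _ _ _ (fun s w => fint alpha (bx T b x i) (clamp T s) w)).
    by move=> s; apply: fint_measurable; exact: (bx_measurable T0 bL mx cx i).
  by move=> w; exact: fint_clamp_continuous.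
move=> w; exact: (@comp_clamp_bounded _ _ T0 (fun t => fint alpha (bx T b x i) t w)
  (@fint_clamp_continuous i w)).
Qed.

Lemma xc_bproc i : bproc (fun z : measurableTypeR R * Omega => xc T x z.1 z.2 i 0).
Proof.
split.
  apply: (measurable_caratheodory (X := fun s w => xc T x s w i 0)).
    by move=> s; exact: mx.
  by move=> w; exact: (@xc_continuous _ _ _ _ _ _ T0 cx).
move=> w; have [M hM] := xc_bounded T0 cx w; exists M => s /=.
exact: le_trans (coord_le_vnorm _ _) (hM s).
Qed.

Lemma Gp_bproc i : bproc (Gp i).
Proof.
have [mX bX] := xc_bproc i; have [mD bD] := Dp_bproc i.
have GE z : Gp i z = xc T x z.1 z.2 i 0 - x0 z.2 i 0 - g * Dp i z.
  by rewrite /Gp /Gt /xc (clamp_id (clamp_itv T0 _)).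
split.
  rewrite (_ : Gp i = fun z => xc T x z.1 z.2 i 0 - x0 z.2 i 0 - g * Dp i z); last exact/funext.
  apply: measurable_funB; last exact: measurable_funM.
  by apply: measurable_funB => //; exact: (measurableT_comp (mx0 i) measurable_snd).
move=> w; have [M hM] := bX w; have [M' hM'] := bD w.
exists (M + `|x0 w i 0| + `|g| * M') => s; rewrite GE/=.
apply: le_trans (ler_normB _ _) _; apply: lerD.
  by apply: le_trans (ler_normB _ _) _; apply: lerD => //; exact: hM.
by rewrite normrM ler_wpM2l.
Qed.

Lemma xcE i s w : xc T x s w i 0 = x0 w i 0 + (g * Dp i (s, w) + Gp i (s, w)).
Proof.
by rewrite /Gp /Gt /Dp /xc/= (clamp_id (clamp_itv T0 s)); move: (fint _ _ _ _) => f; ring.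
Qed.

End solution_processes.

Section linear_drift.
Context {R : realType} {d0 : measure_display} {Omega : measurableType d0}.
Variable P : probability Omega R.
Variables (T alpha g L : R) (d : nat) (b : 'cV[R]_d -> 'cV[R]_d).
Variables (x0 : Omega -> 'cV[R]_d) (x : R -> Omega -> 'cV[R]_d).
Hypotheses (T0 : 0 < T) (a01 : 0 < alpha < 1) (L0 : 0 <= L).
Hypothesis bL : forall u v, vnorm (b u - b v) <= L * vnorm (u - v).
Hypothesis mx0 : forall i, measurable_fun setT (fun w => x0 w i 0).
Hypothesis mx : forall t i, measurable_fun setT (fun w => x t w i 0).
Hypothesis cx : forall w i,
  {within [set t : R | 0 <= t <= T], continuous (fun t => x t w i 0)}.
Variables (theta cb Cx : R).
Hypotheses (cb0 : 0 < cb) (Cx0 : 0 < Cx).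
Hypothesis hb : forall t i, 0 <= t <= T -> L2le P (fun w => bx T b x i (t, w)) cb.
Hypothesis hx : forall t s i, 0 <= s -> s <= t -> t <= T ->
    L2le P (fun w => bx T b x i (t, w) - bx T b x i (s, w)) (Cx * (t - s) `^ theta).
Local Notation mu := (@lebesgue_measure R).
Local Notation Dp := (Dp T alpha b x).

Let a0 : 0 < alpha. Proof. by case/andP: a01. Qed.

Variable beta : R.
Hypotheses (b0 : 0 <= beta <= theta) (ab1 : alpha + beta < 1) (p0 : 0 < alpha - beta).

Definition Cdrift : R := Cx * T `^ (theta - beta) * Cfrac alpha (alpha + beta) + cb / alpha.

Lemma Cdrift_gt0 : 0 < Cdrift.
Proof.
have c1 : 0 < cb / alpha by rewrite divr_gt0.
apply: ltr_wpDl => //; apply: mulr_ge0; first by rewrite mulr_ge0 ?powR_ge0// ltW.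
have r0 : 0 < alpha + beta by apply: ltr_wpDr => //; case/andP: b0.
by rewrite addr_ge0 ?invr_ge0 ?(ltW a0)// mulr_ge0 ?(ltW r0)// subr_ge0 ltW.
Qed.

Lemma drift_incr_L2le i k s t : 0 <= t -> t <= s -> s <= T -> s - t <= k ->
  L2le P (fun w => fint alpha (bx T b x i) s w - fint alpha (bx T b x i) t w)
    (Cdrift * k `^ (alpha + beta) * (1 + s `^ (- beta))).
Proof.
move=> t0 ts sT stk; have /andP[bt0 bth] := b0.
have st0 : 0 <= s - t by rewrite subr_ge0.
have k0 : 0 <= k by exact: le_trans stk.
have r0 : 0 < alpha + beta by apply: ltr_wpDr.
have Cf : 0 <= Cfrac alpha (alpha + beta).
  by rewrite addr_ge0 ?invr_ge0 ?(ltW a0)// mulr_ge0 ?(ltW r0)// subr_ge0 ltW.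
have C'0 : 0 < Cx * T `^ (theta - beta) by rewrite mulr_gt0// powR_gt0.
have tT : 0 <= t <= T by rewrite t0 (le_trans ts).
have ts' : 0 <= t <= s by rewrite t0.
have pw y : 0 <= y -> y <= T -> Cx * y `^ theta <= Cx * T `^ (theta - beta) * y `^ beta.
  move=> y0 yT; rewrite -mulrA ler_wpM2l ?(ltW Cx0)//.
  have [yz|yn0] := eqVneq y 0.
    have [tz|tn0] := eqVneq theta 0.
      have bz : beta = 0 by apply/eqP; rewrite eq_le bt0 andbT -tz.
      by rewrite tz bz subrr !powRr0 mulr1.
    by rewrite yz powR0// mulr_ge0 ?powR_ge0.
  have yp : 0 < y by rewrite lt_neqAle eq_sym yn0.
  have -> : y `^ theta = y `^ (theta - beta) * y `^ beta by rewrite -powR_split// subrK.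
  by rewrite ler_wpM2r ?powR_ge0// ge0_ler_powR ?nnegrE ?subr_ge0 ?(ltW T0).
have := @fint_holder_centered _ _ _ P alpha a01 (bx T b x i) t s beta _ cb
  (bx_measurable T0 bL mx cx i) (bx_bounded T0 L0 bL cx i) ts' bt0 ab1 C'0.
move=> /(_ _ (hb i tT))/wrap[|].
  move=> r /andP[r1 rs]; have rT := le_trans rs sT.
  have [tr|/ltW rt] := leP t r.
    apply: L2le_mono (hx i t0 tr rT); rewrite ger0_norm ?subr_ge0//.
    by apply: pw; rewrite ?subr_ge0// lerBlDr (le_trans rT)// lerDl.
  have := L2leN (hx i r1 rt (le_trans ts sT)); under eq_fun do rewrite opprB.
  apply: L2le_mono; rewrite distrC ger0_norm ?subr_ge0//.
  by apply: pw; rewrite ?subr_ge0// lerBlDr (le_trans (le_trans ts sT))// lerDl.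
apply: L2le_mono; rewrite /Cdrift.
have sa : 0 <= s `^ (- beta) by exact: powR_ge0.
have e1 : (s - t) `^ (alpha + beta) <= k `^ (alpha + beta).
  by rewrite ge0_ler_powR ?nnegrE ?(ltW r0).
have e2 : s `^ alpha - t `^ alpha <= k `^ (alpha + beta) * s `^ (- beta).
  have := @powR_diff_le R s t k (alpha + beta) beta ts' stk bt0; rewrite addrK.
  by apply.
have kr : 0 <= k `^ (alpha + beta) by exact: powR_ge0.
apply: (@le_trans _ _ (Cx * T `^ (theta - beta) * Cfrac alpha (alpha + beta) * k `^ (alpha + beta)
   + cb / alpha * (k `^ (alpha + beta) * s `^ (- beta)))).
  apply: lerD; first by rewrite mulrA ler_wpM2l// mulr_ge0// ltW.
  have -> : cb * ((s `^ alpha - t `^ alpha) / alpha) = cb / alpha * (s `^ alpha - t `^ alpha) by ring.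
  by apply: ler_wpM2l => //; rewrite divr_ge0 ?(ltW cb0) ?(ltW a0).
have c1 : 0 <= cb / alpha by rewrite divr_ge0// ltW.
have c2 : 0 <= Cx * T `^ (theta - beta) * Cfrac alpha (alpha + beta) by rewrite mulr_ge0// ltW.
move: (Cx * _ * _) c2 (cb / _) c1 (k `^ _) kr (s `^ _) sa => u u0 v v0 y y0 z z0.
rewrite -subr_ge0.
have -> : (u + v) * y * (1 + z) - (u * y + v * (y * z)) = u * y * z + v * y by ring.
by rewrite addr_ge0 ?mulr_ge0.
Qed.

Lemma qrem_drift_L2le i k n : 0 < k -> n%:R * k <= T ->
  L2le P (qrem alpha (Dp i) k n) (Cdrift * k `^ (alpha + beta) *
    (T `^ alpha / alpha + (T `^ (alpha - beta) / (alpha - beta) + T `^ (alpha - beta) / (alpha - beta)))).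
Proof.
move=> k0 nT; have C0 := Cdrift_gt0.
have kr : 0 < k `^ (alpha + beta) by rewrite powR_gt0.
have hD := Dp_bproc T0 a01 L0 bL mx cx i.
pose C := Cdrift * k `^ (alpha + beta); have Cp : 0 < C by rewrite mulr_gt0.
have p01 : 0 < alpha - beta < 1 by rewrite p0; case/andP: b0; case/andP: a01; lra.
pose q j := (j%:R * k) `^ (alpha - beta) : R.
pose E (j : nat) := kw alpha k n j + (kw (alpha - beta) k n j + (q j.+1 - q j) / (alpha - beta)).
have Ecell (j : 'I_n) : L2le P (fun w => \int[mu]_(s in `[j%:R * k, j.+1%:R * k])
     (kern alpha (n%:R * k) s * (Dp i (s, w) - Dp i (j%:R * k, w)))) (C * E j).
  have jk : j%:R * k <= j.+1%:R * k by rewrite ler_pM2r// ler_nat.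
  have jn : j.+1%:R * k <= n%:R * k by rewrite ler_pM2r// ler_nat.
  have j0 : 0 <= j%:R * k by rewrite mulr_ge0// ltW.
  have mc : measurable_fun setT (fun s : R => 1 + s `^ (- beta)).
    by apply: measurable_funD => //; exact: measurable_powR.
  have q0 : 0 <= (q j.+1 - q j) / (alpha - beta).
    rewrite divr_ge0 ?(ltW p0)// subr_ge0 ge0_ler_powR ?nnegrE ?(ltW p0)//.
    exact: le_trans jk.
  apply: (@L2le_int _ _ _ P _ _ mu `[j%:R * k, j.+1%:R * k]%classic (kern alpha (n%:R * k))
    (fun s => C * (1 + s `^ (- beta))) (fun z => Dp i z - Dp i (j%:R * k, z.2))).
  - exact: measurable_itv.
  - exact: measurable_kern.
  - exact: measurable_funM.
  - by have [] := bproc_sub (j%:R * k) hD.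
  - by move=> s _; exact: kern_ge0.
  - by move=> s _; rewrite mulr_gt0// ltr_wpDr ?powR_ge0.
  - move=> s /=; rewrite in_itv/= => /andP[s1 s2].
    have sT : s <= T by rewrite (le_trans s2)// (le_trans jn).
    rewrite /Dp/= !clamp_id; last 2 first.
      by rewrite j0 (le_trans s1).
      by rewrite sT (le_trans j0).
    apply: drift_incr_L2le => //.
    by rewrite lerBlDl; apply: le_trans s2 _; rewrite -addn1 natrD mulrDl mul1r.
  - by rewrite mulr_ge0 ?(ltW Cp)// addr_ge0 ?kw_ge0// addr_ge0// kw_ge0.
  under eq_integral do rewrite mulrCA EFinM.
  rewrite ge0_integralZl//; last 3 first.
  - apply/measurable_EFinP; apply: measurable_funTS; apply: measurable_funM => //.
    exact: measurable_kern.
  - by move=> s _; rewrite lee_fin mulr_ge0 ?kern_ge0// addr_ge0 ?powR_ge0.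
  - by rewrite lee_fin ltW.
  rewrite [leRHS]EFinM; apply: lee_wpmul2l; first by rewrite lee_fin ltW.
  by apply: integral_kern_singular => //; [case/andP: b0|rewrite j0].
have h : L2le P (qrem alpha (Dp i) k n) (\sum_(j < n) C * E j).
  by apply: L2le_sum => j _; exact: Ecell.
apply: L2le_mono h; rewrite -mulr_sumr ler_wpM2l ?(ltW Cp)//.
have nk0 : 0 <= n%:R * k by rewrite mulr_ge0// ltW.
have tq : \sum_(j < n) (q j.+1 - q j) / (alpha - beta) = (n%:R * k) `^ (alpha - beta) / (alpha - beta).
  rewrite -mulr_suml -(big_mkord xpredT (fun j => q j.+1 - q j)) telescope_sumr//.
  by rewrite /q mul0r powR0 ?gt_eqF// subr0.
rewrite !big_split/= tq !kw_sum//.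
have m p : 0 < p -> (n%:R * k) `^ p / p <= T `^ p / p.
  by move=> pp; rewrite ler_pM2r ?invr_gt0// ge0_ler_powR ?nnegrE ?(ltW pp) ?(ltW T0).
by apply: lerD; [exact: m|apply: lerD; exact: m].
Qed.

End linear_drift.

Section noise.
Context {R : realType} {d0 : measure_display} {Omega : measurableType d0}.
Variable P : probability Omega R.
Variables (T : R) (d : nat) (alpha H sigma : R).
Variables (x0 : Omega -> 'cV[R]_d) (Bh G : R -> Omega -> 'cV[R]_d).
Hypotheses (T0 : 0 < T) (dp : (0 < d)%N) (a01 : 0 < alpha < 1) (H12 : 1 / 2 < H < 1).
Hypothesis s0 : 0 < sigma.
Hypothesis aE : alpha = 2 - 2 * H.
Hypothesis mx0 : forall i, measurable_fun setT (fun w => x0 w i 0).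
Hypothesis hB : is_fBm P H Bh.
Hypothesis hG : is_G P T alpha sigma Bh G.
Variables (L : R) (b : 'cV[R]_d -> 'cV[R]_d) (x : R -> Omega -> 'cV[R]_d).
Hypothesis L0 : 0 <= L.
Hypothesis bL : forall u v, vnorm (b u - b v) <= L * vnorm (u - v).
Hypothesis sol : is_solution P T alpha b x0 G x.
Local Notation g := (Gammaf alpha)^-1.
Local Notation theta := (H + alpha - 1).
Local Notation Gt := (Gt T alpha g b x0 x).
Local Notation Gp := (Gp T alpha g b x0 x).
Variable CG : R.
Hypothesis CG0 : 0 <= CG.
Hypothesis hCG : forall i s t, 0 <= s -> s <= t -> t <= T ->
  L2le P (fun w => Gt i t w - Gt i s w) (CG * (t - s) `^ theta).

Let mx t i : measurable_fun setT (fun w => x t w i 0). Proof. by case: sol. Qed.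

Let cx w i : {within [set t : R | 0 <= t <= T], continuous (fun t => x t w i 0)}.
Proof. by case: sol => _ []. Qed.

Let th0 : 0 < theta. Proof. by case/andP: H12; rewrite aE; lra. Qed.

Let tau k t : R := (tgrid T k t)%:R * (T / k.+1%:R).

Let tau_itv k t : 0 <= t -> t <= T -> 0 <= tau k t <= T.
Proof. by move=> t0 tT; have /andP[-> h] := tgrid_le T0 k t0; exact: le_trans tT. Qed.

Let Gt0 i t : 0 <= t <= T -> L2le P (fun w => Gt i t w - G t w i 0) 0.
Proof.
move=> tT; apply: L2le_ae (L2le0 P).
  apply: measurable_funB; last exact: (is_G_measurable hG).
  by apply: Gt_measurable => //; exact: bL.
by apply: filterS (Gt_ae sol i tT) => w ->; rewrite subrr.
Qed.

Let G_L2' i t : 0 <= t <= T -> L2 P (fun w => G t w i 0).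
Proof.
move=> tT; have [B0 Bg] := is_fBm_scalar hB i.
exact: (@G_L2 _ _ _ P H alpha (sigma / Gammaf alpha) T (fun t w => Bh t w i 0)
  (fun t w => G t w i 0) H12 B0 Bg (fun t tT => is_G_cvgL2 H12 hB hG i tT)).
Qed.

Let Gt_L2 i t : 0 <= t <= T -> L2 P (Gt i t).
Proof.
move=> tT; have [c hc] := G_L2' i tT; exists (0 + c).
have := L2leD (Gt0 i tT) hc; congr (L2le _ _ _).
by apply/funext => w; rewrite subrK.
Qed.

Lemma Gt_tau_cvg i t : 0 <= t -> t <= T -> cvgL2 P (fun k => Gt i (tau k t)) (Gt i t).
Proof.
move=> t0 tT e e0.
have : (fun k : nat => CG * (T / k.+1%:R) `^ theta) @ \oo --> 0.
  rewrite -[X in _ --> X](mulr0 CG); apply: cvgM; first exact: cvg_cst.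
  have z : (0 : R) `^ theta = 0 by rewrite powR0 ?gt_eqF.
  rewrite -[X in _ --> X]z.
  apply: (@seq_powR_cvg _ (fun k : nat => T / k.+1%:R)) => //.
  - rewrite -[X in _ --> X](mulr0 T); apply: cvgM; first exact: cvg_cst.
    exact: cvg_harmonic.
  - by move=> n; rewrite divr_gt0.
  - by left.
move=> /cvgrPdist_le /(_ _ e0); apply: filterS => k.
rewrite sub0r normrN ger0_norm; last by rewrite mulr_ge0 ?powR_ge0.
move=> h; have /andP[h1 h2] := tgrid_le T0 k t0.
apply: L2le_mono (hCG i h1 h2 tT); apply: le_trans h.
rewrite ler_wpM2l// ge0_ler_powR ?nnegrE ?subr_ge0 ?divr_ge0 ?(ltW T0)//.
  by rewrite -subr_ge0 ltW.
by have := tgrid_ge T0 k t0; rewrite lerBlDr lerBlDl.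
Qed.

Lemma Gt_ip_ge0 i s1 s2 t1 t2 : 0 <= s1 -> s1 <= s2 -> s2 <= t1 -> t1 <= t2 -> t2 <= T ->
  0 <= ip P (fun w => Gt i t1 w - Gt i t2 w) (fun w => Gt i s2 w - Gt i s1 w).
Proof.
move=> s10 s12 st t12 tT.
have s20 := le_trans s10 s12; have t10 := le_trans s20 st; have t20 := le_trans t10 t12.
have t1T := le_trans t12 tT; have s2T := le_trans st t1T; have s1T := le_trans s12 s2T.
apply: (@ip_lim_ge0 _ _ _ P (fun k w => Gt i (tau k t1) w - Gt i (tau k t2) w)
   (fun k w => Gt i (tau k s2) w - Gt i (tau k s1) w)).
- by move=> k; apply: L2B; apply: Gt_L2; exact: tau_itv.
- by move=> k; apply: L2B; apply: Gt_L2; exact: tau_itv.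
- by apply: cvgL2B; exact: Gt_tau_cvg.
- by apply: cvgL2B; exact: Gt_tau_cvg.
move=> k.
have dd u v : 0 <= u <= T -> 0 <= v <= T ->
    L2le P (fun w => (Gt i u w - Gt i v w) - (G u w i 0 - G v w i 0)) 0.
  move=> uT vT; have := L2leB (Gt0 i uT) (Gt0 i vT); rewrite addr0; congr (L2le _ _ _).
  by apply/funext => w; move: (Gt i u w) (Gt i v w) (G u w i 0) (G v w i 0) => p q r y; ring.
have gg u v : 0 <= u <= T -> 0 <= v <= T -> L2 P (fun w => G u w i 0 - G v w i 0).
  by move=> uT vT; apply: L2B; exact: G_L2'.
have tt u v : 0 <= u <= T -> 0 <= v <= T -> L2 P (fun w => Gt i u w - Gt i v w).
  by move=> uT vT; apply: L2B; exact: Gt_L2.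
have [T1 T2] := (tau_itv k t10 t1T, tau_itv k t20 tT).
have [S1 S2] := (tau_itv k s10 s1T, tau_itv k s20 s2T).
rewrite (ip_eq_L2le0 (tt _ _ T1 T2) (gg _ _ T1 T2) (tt _ _ S2 S1) (dd _ _ T1 T2)).
rewrite ipC (ip_eq_L2le0 (tt _ _ S2 S1) (gg _ _ S2 S1) (gg _ _ T1 T2) (dd _ _ S2 S1)) ipC.
have [B0 Bg] := is_fBm_scalar hB i.
have kap0 : 0 <= sigma / Gammaf alpha by rewrite divr_ge0 ?(ltW s0)// Gammaf_ge0.
apply: (@ip_G_grid_ge0 _ _ _ P H alpha (sigma / Gammaf alpha) T (fun t w => Bh t w i 0)
  (fun t w => G t w i 0) H12 aE kap0 T0 B0 Bg (fun t tT => is_G_cvgL2 H12 hB hG i tT)).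
- by rewrite divr_gt0.
- exact: tgrid_mono.
- exact: tgrid_mono.
- exact: tgrid_mono.
- by case/andP: T2.
Qed.

Lemma qrem_noise_L2le i k n : 0 < k -> n%:R * k <= T ->
  L2le P (qrem alpha (Gp i) k n) (CG * k `^ theta *
    (alpha^-1 * (k `^ alpha * Num.sqrt (\sum_(i < n) i.+1%:R `^ (2 * alpha - 2))))).
Proof.
move=> k0 nT.
have jT (j : nat) : (j < n)%N -> j.+1%:R * k <= T.
  by move=> jn; apply: le_trans nT; rewrite ler_pM2r// ler_nat.
have jk (j : nat) : 0 <= j%:R * k by rewrite mulr_ge0// ltW.
have GpE (j : nat) s w : (j < n)%N -> j%:R * k <= s <= j.+1%:R * k -> Gp i (s, w) = Gt i s w.
  move=> jn /andP[h1 h2]; rewrite /Gp/= clamp_id// (le_trans (jk j) h1)/=.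
  exact: le_trans h2 (jT _ jn).
have GpE' (j : nat) w : (j < n)%N -> Gp i (j%:R * k, w) = Gt i (j%:R * k) w.
  by move=> jn; apply: (GpE j) => //; rewrite lexx/= ler_pM2r// ler_nat.
apply: qrem_neg_L2le => //.
- by rewrite mulr_ge0 ?powR_ge0.
- exact: (Gp_bproc g T0 a01 L0 bL mx0 mx cx).
- move=> j s jn /[dup] sj /andP[s1 s2].
  under eq_fun do rewrite (GpE j)// GpE'//.
  apply: L2le_mono (hCG i (jk j) s1 (le_trans s2 (jT _ jn))).
  rewrite ler_wpM2l// ge0_ler_powR ?nnegrE ?(ltW th0) ?(ltW k0)//; first by rewrite subr_ge0.
  by rewrite lerBlDl; apply: le_trans s2 _; rewrite -addn1 natrD mulrDl mul1r.
move=> j l r s jl ln /[dup] rj /andP[r1 r2] /[dup] sl /andP[s1 s2].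
have jn := ltn_trans jl ln.
rewrite [X in ip _ X _](_ : _ = fun w => Gt i r w - Gt i (j%:R * k) w); last first.
  by apply/funext => w; rewrite (GpE j r w jn rj) (GpE' j w jn).
rewrite [X in ip _ _ X](_ : _ = fun w => - (Gt i (l%:R * k) w - Gt i s w)); last first.
  by apply/funext => w; rewrite (GpE l s w ln sl) (GpE' l w ln) [RHS]opprB.
have lT : 0 <= l%:R * k <= T.
  by rewrite jk (le_trans _ (jT _ ln))// ler_pM2r// ler_nat.
have sT : 0 <= s <= T by rewrite (le_trans (jk l) s1)/= (le_trans s2 (jT _ ln)).
have jjT : 0 <= j%:R * k <= T.
  by rewrite jk (le_trans _ (jT _ jn))// ler_pM2r// ler_nat.
have rT : 0 <= r <= T by rewrite (le_trans (jk j) r1)/= (le_trans r2 (jT _ jn)).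
have Lr : L2 P (fun w => Gt i r w - Gt i (j%:R * k) w) by apply: L2B; exact: Gt_L2.
have Ls : L2 P (fun w => Gt i (l%:R * k) w - Gt i s w) by apply: L2B; exact: Gt_L2.
rewrite ipC ipNl// oppr_le0; apply: Gt_ip_ge0 => //.
- by apply: le_trans r2 _; rewrite ler_pM2r// ler_nat.
- by case/andP: sT.
Qed.

End noise.

Section rates.
Context {R : realType}.
Variable T : R.
Hypothesis T0 : 0 < T.

Lemma step_powR_le1 (N : nat) (p : R) : T / N%:R < 1 -> 0 <= p -> (T / N%:R) `^ p <= 1.
Proof.
move=> k1 p0; have k0 : 0 <= T / N%:R by rewrite divr_ge0// ltW.
have e : (1 : R) `^ p = 1 by rewrite powR1.
by rewrite -[leRHS]e ge0_ler_powR ?nnegrE// ltW.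
Qed.

(* The admissible steps [T / N < 1] stay away from [1], because [N] is an integer. *)
Lemma ln_step_ge : exists c, 0 < c /\
  forall N : nat, (0 < N)%N -> T / N%:R < 1 -> c <= `|ln (T / N%:R)|.
Proof.
pose m := `|Num.floor T|%N.+1.
have f0 : 0 <= Num.floor T by rewrite floor_ge0 ltW.
have mE : (m%:R : R) = (Num.floor T + 1)%:~R.
  by rewrite /m -addn1 natrD natr_absz ger0_norm// intrD.
have Tm : T < m%:R by rewrite mE; have /andP[] := floor_itv T.
have m0 : 0 < (m%:R : R) by rewrite ltr0n.
exists (- ln (T / m%:R)); split.
  rewrite oppr_gt0 ln_lt0// divr_gt0//= ltr_pdivrMr// mul1r//.
move=> N N0; have Np : 0 < (N%:R : R) by rewrite ltr0n.
rewrite ltr_pdivrMr// mul1r => TN.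
have mN : m%:R <= (N%:R : R).
  rewrite ler_nat /m -ltz_nat gez0_abs// -(ltr_int R).
  by apply: le_lt_trans TN; exact: floor_le_tmp.
rewrite -[leRHS]normrN; apply: le_trans (ler_norm _); rewrite lerN2 ler_ln ?posrE ?divr_gt0//.
by rewrite ler_pM2l// lef_pV2.
Qed.

Definition rate (H k : R) : R :=
  if 3 / 4 < H then powR k (3 - 3 * H)
  else if H == 3 / 4 then Num.sqrt `|ln k| * powR k (3 / 4)
  else powR k (3 / 2 - H).

Lemma rate_ge0 H k : 0 <= rate H k.
Proof.
rewrite /rate; case: ifP => _; first exact: powR_ge0.
by case: ifP => _; rewrite ?mulr_ge0 ?powR_ge0.
Qed.

Lemma rate_drift H : exists C, 0 <= C /\
  forall N : nat, (0 < N)%N -> T / N%:R < 1 ->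
    (T / N%:R) `^ (Num.min (3 / 2 - H) (3 - 3 * H)) <= C * rate H (T / N%:R).
Proof.
have [c [c0 hc]] := ln_step_ge; rewrite /rate.
have [H34|H34] := ltP (3 / 4) H.
  exists 1; split => // N _ _; rewrite mul1r (_ : Num.min _ _ = 3 - 3 * H)//.
  by apply/min_idPr; lra.
have [e|ne] := eqVneq H (3 / 4).
  have s0 : 0 < Num.sqrt c by rewrite sqrtr_gt0.
  exists (Num.sqrt c)^-1; split; first by rewrite invr_ge0 ltW.
  move=> N N0 k1.
  have -> : Num.min (3 / 2 - H) (3 - 3 * H) = 3 / 4.
    have e1 : 3 / 2 - H = 3 / 4 by rewrite e; field.
    have e2 : 3 - 3 * H = 3 / 4 by rewrite e; field.
    by rewrite e1 e2 minxx.
  rewrite mulrA ler_peMl ?powR_ge0// mulrC ler_pdivlMr// mul1r ler_wsqrtr//.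
  exact: hc.
exists 1; split => // N _ _; rewrite mul1r (_ : Num.min _ _ = 3 / 2 - H)//.
by apply/min_idPl; lra.
Qed.

Lemma rate_noise H : 1 / 2 < H < 1 -> exists C, 0 <= C /\
  forall N n : nat, (0 < N)%N -> T / N%:R < 1 -> (n <= N)%N ->
    (T / N%:R) `^ (1 - H) * ((T / N%:R) `^ (2 - 2 * H) *
       Num.sqrt (\sum_(i < n) i.+1%:R `^ (2 * (2 - 2 * H) - 2))) <= C * rate H (T / N%:R).
Proof.
move=> /andP[h1 h2].
have pw (k : R) : 0 < k -> k `^ (1 - H) * k `^ (2 - 2 * H) = k `^ (3 - 3 * H).
  by move=> k0; rewrite -powR_split//; congr (_ `^ _); ring.
have kp (N : nat) : (0 < N)%N -> 0 < T / N%:R by move=> N0; rewrite divr_gt0// ltr0n.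
rewrite /rate; have [H34|H34] := ltP (3 / 4) H.
  pose p := 4 - 4 * H; have p01 : 0 < p < 1 by rewrite /p; lra.
  exists (Num.sqrt (1 + 1 / (1 - p))); split; first exact: sqrtr_ge0.
  move=> N n N0 k1 nN; rewrite mulrA pw ?kp// mulrC ler_wpM2r ?powR_ge0// ler_wsqrtr//.
  have -> : 2 * (2 - 2 * H) - 2 = p - 2 by rewrite /p; ring.
  case: n {nN} => [|n]; first by rewrite big_ord0 addr_ge0// divr_ge0// subr_ge0 ltW//; case/andP: p01.
  rewrite -(big_mkord xpredT (fun i => i.+1%:R `^ (p - 2))) big_ltn//.
  rewrite powR1 lerD2l; have := @sum_powR_tail R p 1 n.+1 p01 isT.
  by rewrite powR1.
have [e|ne] := eqVneq H (3 / 4).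
  have [c [c0 hc]] := ln_step_ge.
  exists (Num.sqrt ((1 + `|ln T|) / c + 1)); split; first exact: sqrtr_ge0.
  move=> N n N0 k1 nN; have kk := kp _ N0.
  rewrite mulrA pw// [leRHS]mulrA [leLHS]mulrC.
  have -> : 3 - 3 * H = 3 / 4 by rewrite e; field.
  rewrite ler_wpM2r ?powR_ge0// -sqrtrM; last first.
    by rewrite addr_ge0// divr_ge0 ?addr_ge0// ltW.
  apply: ler_wsqrtr.
  have lk := hc _ N0 k1.
  apply: (@le_trans _ _ (1 + `|ln T| + `|ln (T / N%:R)|)).
    case: n nN => [|n] nN; first by rewrite big_ord0 !addr_ge0.
    have -> : 2 * (2 - 2 * H) - 2 = -1 by rewrite e; field.
    rewrite (eq_bigr (fun i : 'I_n.+1 => (i.+1%:R : R)^-1)); last first.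
      by move=> i _; rewrite powR_inv1.
    apply: le_trans (@sum_harmonic_le R n.+1 isT) _.
    rewrite -addrA lerD2l; apply: (@le_trans _ _ (ln N%:R)).
      by rewrite ler_ln ?posrE ?ltr0n// ler_nat.
    have Np : 0 < (N%:R : R) by rewrite ltr0n.
    have -> : (N%:R : R) = T / (T / N%:R) by field; rewrite !gt_eqF.
    rewrite ln_div ?posrE//; apply: le_trans (ler_norm _) _.
    by apply: le_trans (ler_normB _ _) _; rewrite lerD2l (_ : T / (T / N%:R) = N%:R)//; field; rewrite !gt_eqF.
  rewrite mulrDl mul1r lerD2r mulrAC ler_pdivlMr// ler_wpM2l// addr_ge0//.
pose p := 3 - 4 * H.
have Hlt : H < 3 / 4 by rewrite lt_neqAle ne.
have p01 : 0 < p <= 1 by rewrite /p; lra.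
exists (Num.sqrt (T `^ p / p)); split; first exact: sqrtr_ge0.
move=> N n N0 k1 nN; have kk := kp _ N0; have Np : 0 < (N%:R : R) by rewrite ltr0n.
have pp : 0 < p by case/andP: p01.
rewrite mulrA pw//.
apply: (@le_trans _ _ ((T / N%:R) `^ (3 - 3 * H) * Num.sqrt (T `^ p / p * (T / N%:R) `^ (- p)))).
  rewrite ler_wpM2l ?powR_ge0// ler_wsqrtr//.
  have -> : 2 * (2 - 2 * H) - 2 = p - 1 by rewrite /p; ring.
  apply: le_trans (sum_powR_le n p01) _.
  rewrite mulrAC ler_pM2r ?invr_gt0//.
  apply: (@le_trans _ _ (N%:R `^ p)).
    by rewrite ge0_ler_powR ?nnegrE ?(ltW pp)// ler_nat.
  have {1}-> : (N%:R : R) = T * (T / N%:R)^-1 by field; rewrite !gt_eqF.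
  rewrite powRM ?(ltW T0)// ?invr_ge0 ?(ltW kk)//.
  by rewrite -[(T / N%:R)^-1]powR_inv1 ?(ltW kk)// -powRrM mulN1r.
rewrite sqrtrM; last by rewrite divr_ge0 ?powR_ge0// ltW.
rewrite mulrCA ler_wpM2l ?sqrtr_ge0//.
have -> : - p = (- p / 2) * 2 by field.
rewrite powRrM powR_mulrn ?powR_ge0// sqrtr_sqr ger0_norm ?powR_ge0// -powR_split//.
rewrite (_ : 3 - 3 * H + - p / 2 = 3 / 2 - H)//.
by rewrite /p; field.
Qed.

End rates.

Section linear_case.
Context {R : realType} {d0 : measure_display} {Omega : measurableType d0}.
Variable P : probability Omega R.
Variables (T : R) (d : nat) (alpha H sigma : R).
Variables (x0 : Omega -> 'cV[R]_d) (Bh G : R -> Omega -> 'cV[R]_d).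
Hypotheses (T0 : 0 < T) (dp : (0 < d)%N) (a01 : 0 < alpha < 1) (H12 : 1 / 2 < H < 1).
Hypothesis s0 : 0 < sigma.
Hypothesis aE : alpha = 2 - 2 * H.
Hypothesis mx0 : forall i, measurable_fun setT (fun w => x0 w i 0).
Hypothesis hB : is_fBm P H Bh.
Hypothesis hG : is_G P T alpha sigma Bh G.
Variables (B : 'M[R]_d) (x : R -> Omega -> 'cV[R]_d).
Let b (v : 'cV[R]_d) := B *m v.
Hypothesis sol : is_solution P T alpha b x0 G x.
Hypothesis fx0 : (\int[P]_w (nrm2 (x0 w))%:E < +oo)%E.
Local Notation g := (Gammaf alpha)^-1.
Let L : R := \sum_i \sum_j `|B i j|.
Local Notation rho := (Num.min (3 / 2 - H) (3 - 3 * H)).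

Let L0 : 0 <= L. Proof. by apply: sumr_ge0 => i _; exact: sumr_ge0. Qed.

Let bL u v : vnorm (b u - b v) <= L * vnorm (u - v).
Proof.
rewrite /b -mulmxBr; apply: le_trans (vnorm_le_sum _) _.
rewrite /L mulr_suml; apply: ler_sum => i _; rewrite mxE mulr_suml.
apply: le_trans (ler_norm_sum _ _ _) _; apply: ler_sum => j _.
by rewrite normrM ler_wpM2l// coord_le_vnorm.
Qed.

Let g0 : 0 <= g. Proof. by rewrite invr_ge0 Gammaf_ge0. Qed.

Let mx t i : measurable_fun setT (fun w => x t w i 0). Proof. by case: sol. Qed.

Let cx w i : {within [set t : R | 0 <= t <= T], continuous (fun t => x t w i 0)}.
Proof. by case: sol => _ []. Qed.

Lemma qrem_linear i k n w : 0 < k -> qrem alpha (bx T b x i) k n w =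
  \sum_l B i l * (g * qrem alpha (Dp T alpha b x l) k n w + qrem alpha (Gp T alpha g b x0 x l) k n w).
Proof.
move=> k0.
have hD l := Dp_bproc T0 a01 L0 bL mx cx l.
have hGp l := Gp_bproc g T0 a01 L0 bL mx0 mx cx l.
pose h l (z : measurableTypeR R * Omega) := g * Dp T alpha b x l z + Gp T alpha g b x0 x l z.
have hh l : bproc (h l) by exact: bproc_lin.
transitivity (qrem alpha (fun z => \sum_l B i l * h l z) k n w).
  apply: eq_bigr => j _; apply: eq_Rintegral => s _; congr (_ * _).
  have E r : bx T b x i (r, w) = \sum_l B i l * x0 w l 0 + \sum_l B i l * h l (r, w).
    rewrite /bx /b mxE -big_split/=; apply: eq_bigr => l _.
    by rewrite -mulrDr (xcE alpha g b x0 _ T0).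
  by rewrite (E s) (E (j%:R * k)) opprD addrACA subrr add0r.
rewrite qrem_sum//; apply: eq_bigr => l _; congr (_ * _).
exact: qrem_lin.
Qed.

Lemma fast_scheme_linear_rate : exists C, 0 <= C /\
  forall (N : nat) (M : nat) (om sv : 'I_M -> R),
    (0 < N)%N -> T / N%:R < 1 ->
    (forall t, T / N%:R <= t <= T ->
       `|powR t (alpha - 1) - \sum_(i < M) om i * expR (- sv i * t)| <= powR (T / N%:R) rho) ->
    forall n, (n <= N)%N ->
      (err2 P (soe_kernel alpha (T / N%:R) om sv) (T / N%:R) b x0 G x n
        <= ((C * rate H (T / N%:R)) ^+ 2)%:E)%E.
Proof.
have [CG [cb [Cx [CG0 cb0 Cx0 hCG [hb hx]]]]] :=
  solution_bounds T0 dp a01 H12 s0 mx0 hB hG L0 bL sol fx0.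
have [C [C0 hC]] := scheme_error T0 a01 L0 g0 bL mx0 mx cx
  (fun i t tT => is_G_measurable hG i tT) (fun i t tT => Gt_ae sol i tT) cb0 hb.
have [C1 [C10 hC1]] := rate_noise T0 H12.
have [C2 [C20 hC2]] := rate_drift T0 H.
have a0 : 0 < alpha by case/andP: a01.
have /andP[H1 H2] := H12.
have rhoP : [/\ alpha <= rho, rho < 1, rho - alpha <= H + alpha - 1 & 0 < alpha - (rho - alpha)].
  by rewrite aE; case: (leP (3 / 2 - H) (3 - 3 * H)) => h; split; lra.
have [ra r1 rth rp] := rhoP.
have r0 : 0 <= rho by apply: le_trans ra; exact: ltW.
pose beta := rho - alpha.
have abE : alpha + beta = rho by rewrite /beta addrC subrK.
have b0 : 0 <= beta <= H + alpha - 1 by rewrite subr_ge0 ra.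
have ab1 : alpha + beta < 1 by rewrite abE.
pose KT := T `^ alpha / alpha + (T `^ (alpha - beta) / (alpha - beta) + T `^ (alpha - beta) / (alpha - beta)).
pose CD := Cdrift T alpha (H + alpha - 1) cb Cx beta.
have CD0 : 0 <= CD by rewrite ltW//; exact: Cdrift_gt0.
have KT0 : 0 <= KT.
  by rewrite addr_ge0 ?divr_ge0 ?powR_ge0 ?(ltW a0)// addr_ge0 ?divr_ge0 ?powR_ge0 ?(ltW rp).
pose K := L * (g * (CD * C2 * KT) + CG * (alpha^-1 * C1)).
have K0 : 0 <= K.
  by rewrite mulr_ge0// addr_ge0 ?mulr_ge0// invr_ge0 ltW.
exists (C * (K + C2)); split; first by rewrite mulr_ge0// addr_ge0.
move=> N M om sv N0 k1 hsoe n nN.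
have k0 : 0 < T / N%:R by rewrite divr_gt0// ltr0n.
have hdr := hC2 N N0 k1; have hno m mN := hC1 N m N0 k1 mN.
have rt0 := rate_ge0 H (T / N%:R).
have e01 : 0 <= (T / N%:R) `^ rho <= 1 by rewrite powR_ge0 step_powR_le1.
have stepT m : (m <= N)%N -> m%:R * (T / N%:R) <= T by move=> mN; exact: (@step_le _ _ _ N).
move: (T / N%:R) k0 k1 hdr hno rt0 e01 stepT hsoe (hC N) => k k0 k1 hdr hno rt0 e01 stepT hsoe hCN.
have rr0 : 0 <= K * rate H k by rewrite mulr_ge0.
have := hCN (k `^ rho) (soe_kernel alpha k om sv) (K * rate H k) N0 e01
  (soe_kernel_measurable _ _ _ _) (soe_kernel_dist g0 (powR_ge0 _ _) hsoe) rr0.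
move=> /(_ _ n nN)/wrap[|h].
  move=> m i mN.
  have hq l : L2le P (fun w => B i l * (g * qrem alpha (Dp T alpha b x l) k m w +
      qrem alpha (Gp T alpha g b x0 x l) k m w))
      (`|B i l| * ((g * (CD * C2 * KT) + CG * (alpha^-1 * C1)) * rate H k)).
    apply: L2leZ.
    have q1 := qrem_drift_L2le T0 a01 L0 bL mx cx cb0 Cx0 hb hx b0 ab1 rp l k0 (stepT _ mN).
    have q2 := qrem_noise_L2le T0 a01 H12 s0 aE mx0 hB hG L0 bL sol CG0 hCG l k0 (stepT _ mN).
    have := L2leD (L2leZ g q1) q2; rewrite ger0_norm//; apply: L2le_mono.
    rewrite [leRHS]mulrDl -/KT -/CD abE; apply: lerD.
      rewrite -[leRHS]mulrA ler_wpM2l// [leRHS]mulrAC ler_wpM2r// -[leRHS]mulrA ler_wpM2l//.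
    have -> : H + alpha - 1 = 1 - H by rewrite aE; ring.
    rewrite -!mulrA ler_wpM2l// [leLHS]mulrCA ler_wpM2l ?invr_ge0 ?(ltW a0)//.
    by have := hno m mN; rewrite aE.
  have := @L2le_sum _ _ _ P _ (index_enum 'I_d) xpredT _ _ (fun l _ => hq l).
  rewrite (_ : (fun w => _) = qrem alpha (bx T b x i) k m); last first.
    by apply/funext => w; rewrite qrem_linear.
  apply: L2le_mono; rewrite -mulr_suml /K -[leRHS]mulrA ler_wpM2r//.
    by rewrite mulr_ge0// addr_ge0 ?mulr_ge0// invr_ge0 ltW.
  by rewrite /L [leRHS](bigD1 i)//= lerDl; apply: sumr_ge0 => j _; exact: sumr_ge0.
apply: le_trans h _; rewrite lee_fin lerXn2r ?nnegrE//.
- by rewrite mulr_ge0// addr_ge0// powR_ge0.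
- by rewrite mulr_ge0// mulr_ge0// addr_ge0.
by rewrite -[leRHS]mulrA ler_wpM2l// [leRHS]mulrDl lerD2l.
Qed.

End linear_case.

Theorem mainTheorem9 (R : realType) (d0 : measure_display)
  (Omega : measurableType d0) (P : probability Omega R)
  (T : R) (d : nat) (alpha H sigma : R)
  (x0 : Omega -> 'cV[R]_d) (Bh G : R -> Omega -> 'cV[R]_d) :
  0 < T -> (0 < d)%N -> 0 < alpha < 1 -> 1 / 2 < H < 1 -> 0 < sigma ->
  (forall i : 'I_d, measurable_fun setT (fun w => x0 w i 0)) ->
  is_fBm P H Bh ->
  is_G P T alpha sigma Bh G ->
  (* part (1) *)
  (forall (L : R) (b : 'cV[R]_d -> 'cV[R]_d) (x : R -> Omega -> 'cV[R]_d),
     0 <= L ->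
     (forall u v, Num.sqrt (nrm2 (b u - b v)) <= L * Num.sqrt (nrm2 (u - v))) ->
     is_solution P T alpha b x0 G x ->
     (\int[P]_w (nrm2 (x0 w) + nrm2 (b (x0 w)))%:E < +oo)%E ->
     (exists C : R, 0 <= C /\
       forall (N : nat) (eps : R) (M : nat) (om sv : 'I_M -> R),
         (0 < N)%N -> T / N%:R < 1 -> 0 < eps < 1 ->
         (forall i, 0 < om i) -> (forall i, 0 < sv i) ->
         (forall t, T / N%:R <= t <= T ->
            `|powR t (alpha - 1) - \sum_(i < M) om i * expR (- sv i * t)| <= eps) ->
         forall n, (n <= N)%N ->
           (err2 P (soe_kernel alpha (T / N%:R) om sv) (T / N%:R) b x0 G x n
             <= ((C * (powR (T / N%:R) (H + alpha - 1) + eps)) ^+ 2)%:E)%E)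
     /\
     (exists C : R, 0 <= C /\
       forall (N : nat) (M : nat) (om sv : 'I_M -> R),
         (0 < N)%N -> T / N%:R < 1 ->
         (forall i, 0 < om i) -> (forall i, 0 < sv i) ->
         (forall t, T / N%:R <= t <= T ->
            `|powR t (alpha - 1) - \sum_(i < M) om i * expR (- sv i * t)|
              <= powR (T / N%:R) (H + alpha - 1)) ->
         forall n, (n <= N)%N ->
           (err2 P (soe_kernel alpha (T / N%:R) om sv) (T / N%:R) b x0 G x n
             <= ((C * powR (T / N%:R) (H + alpha - 1)) ^+ 2)%:E)%E))
  /\
  (* part (2) *)
  (forall (B : 'M[R]_d) (x : R -> Omega -> 'cV[R]_d),
     alpha = 2 - 2 * H ->
     is_solution P T alpha (fun v => B *m v) x0 G x ->
     (\int[P]_w (nrm2 (x0 w))%:E < +oo)%E ->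
     exists C : R, 0 <= C /\
       forall (N : nat) (M : nat) (om sv : 'I_M -> R),
         (0 < N)%N -> T / N%:R < 1 ->
         (forall i, 0 < om i) -> (forall i, 0 < sv i) ->
         (forall t, T / N%:R <= t <= T ->
            `|powR t (alpha - 1) - \sum_(i < M) om i * expR (- sv i * t)|
              <= powR (T / N%:R) (Num.min (3 / 2 - H) (3 - 3 * H))) ->
         forall n, (n <= N)%N ->
           (err2 P (soe_kernel alpha (T / N%:R) om sv) (T / N%:R)
              (fun v => B *m v) x0 G x n
             <= ((C * (if 3 / 4 < H then powR (T / N%:R) (3 - 3 * H)
                       else if H == 3 / 4 then
                         Num.sqrt `|ln (T / N%:R)| * powR (T / N%:R) (3 / 4)
                       else powR (T / N%:R) (3 / 2 - H))) ^+ 2)%:E)%E).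
Proof.
move=> T0 dp a01 H12 s0 mx0 hB hG; split.
  move=> L b x L0 bL sol fin.
  have mbx i : measurable_fun setT (fun w => b (x0 w) i 0).
    apply: (measurable_lipschitz_comp (f := fun v => b v i 0) (L := L)) => // u v.
    exact: (b_coord_lip bL i u v).
  have fx0 : (\int[P]_w (nrm2 (x0 w))%:E < +oo)%E.
    apply: le_lt_trans fin; apply: ge0_le_integral => //.
    - by move=> w _; rewrite lee_fin nrm2_ge0.
    - by apply/measurable_EFinP; apply: measurable_sum => i; exact: measurable_funX.
    - by apply/measurable_EFinP; apply: measurable_funD;
        apply: measurable_sum => i; exact: measurable_funX.
    - by move=> w _; rewrite lee_fin lerDl nrm2_ge0.
  have [C [C0 hC]] := fast_scheme_rate T0 dp a01 H12 s0 mx0 hB hG L0 bL sol fx0.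
  split.
    exists C; split => // N eps M om sv N0 k1 /andP[e0 e1] _ _ hsoe n nN.
    by apply: hC => //; rewrite !ltW.
  exists (C * 2); split; first by rewrite mulr_ge0.
  move=> N M om sv N0 k1 _ _ hsoe n nN.
  have th := theta_nonneg T0 a01 H12 s0 hB hG dp.
  rewrite -mulrA mulr_natl mulr2n; apply: hC => //.
  by rewrite powR_ge0 step_powR_le1.
move=> B x aE sol fx0.
have [C [C0 hC]] := fast_scheme_linear_rate T0 dp a01 H12 s0 aE mx0 hB hG sol fx0.
by exists C; split => // N M om sv N0 k1 _ _ hsoe n nN; exact: hC.
Qed.
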